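(* Assume Schanuel's conjecture. Let $\mathscr{K}\subset\mathbb{R}$ be a subfield of finite transcendence degree over $\mathbb{Q}$, let $G_1$ and $G_2$ be semisimple algebraic $\mathscr{K}$-groups, and for $j\in\{1,2\}$ let $\Gamma_j\subset G_j(\mathscr{K})\subset G_j(\mathbb{R})$ be a discrete Zariski-dense torsion-free subgroup. Let $\mathscr{F}_j$ be the subfield of $\mathbb{R}$ generated by the values $\lambda_{\Gamma_j}(\gamma)$ for all nontrivial semisimple $\gamma\in\Gamma_j$. Assume that condition $(C_i)$ holds for either $i=1$ or $i=2$. Then, for this $i$, the transcendence degree of $\mathscr{F}_1\mathscr{F}_2$ over $\mathscr{F}_{3-i}$ is infinite.
   Context: Schanuel's conjecture: if $z_1,\dots,z_n\in\mathbb{C}$ are linearly independent over $\mathbb{Q}$, then the field $\mathbb{Q}(z_1,\dots,z_n,e^{z_1},\dots,e^{z_n})$ has transcendence degree at least $n$ over $\mathbb{Q}$. For a semisimple $\gamma\in\Gamma_j$, $$\lambda_{\Gamma_j}(\gamma)=\Bigl(\sum_{\alpha}(\log|\alpha(\gamma)|)^2\Bigr)^{1/2},$$ where the sum is over all roots $\alpha$ of $G_j$ with respect to an arbitrary maximal $\mathbb{R}$-torus $T$ of $G_j$ containing $\gamma$. For a torus $T$, $X(T)$ denotes its group of characters over an algebraic closure of the base field. Below take $F=\mathbb{R}$. Weak containment: semisimple elements $\gamma^{(i)}_1,\dots,\gamma^{(i)}_{m}\in\Gamma_i$ are weakly contained in $\Gamma_{3-i}$ if there are (finitely many) semisimple elements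 $\gamma^{(3-i)}_1,\dots,\gamma^{(3-i)}_{m'}\in\Gamma_{3-i}$ such that $$\chi^{(i)}_1(\gamma^{(i)}_1)\cdots\chi^{(i)}_{m}(\gamma^{(i)}_{m})=\chi^{(3-i)}_1(\gamma^{(3-i)}_1)\cdots\chi^{(3-i)}_{m'}(\gamma^{(3-i)}_{m'})\neq 1$$ for some maximal $F$-tori $T^{(j)}_k$ of $G_j$ containing $\gamma^{(j)}_k$ and some characters $\chi^{(j)}_k\in X(T^{(j)}_k)$. (This is independent of the choice of the tori.) Multiplicative independence: semisimple elements $\gamma_1,\dots,\gamma_m\in G(F)$ of a semisimple $F$-group $G$ are multiplicatively independent if for some (equivalently, any) maximal $F$-tori $T_k$ of $G$ with $\gamma_k\in T_k(F)$, any relation $\chi_1(\gamma_1)\cdots\chi_m(\gamma_m)=1$ with $\chi_k\in X(T_k)$ implies $\chi_1(\gamma_1)=\dots=\chi_m(\gamma_m)=1$. Condition $(C_i)$: for any $m\geqslant 1$ there exist semisimple elements $\gamma_1,\dots,\gamma_m\in\Gamma_i$ of infinite order that are multiplicatively independent and are not weakly contained in $\Gamma_{3-i}$. *)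

(* Defs.v *)
From HB Require Import structures.
From mathcomp Require Import all_boot all_order all_algebra.
From mathcomp Require Import all_classical all_reals all_analysis.
From mathcomp Require Import complex.
From mathcomp Require Import (canonicals) mpoly.
Set Implicit Arguments.
Unset Strict Implicit.
Unset Printing Implicit Defensive.
Import Order.TTheory GRing.Theory Num.Theory.
Import numFieldNormedType.Exports.
Local Open Scope classical_set_scope.
Local Open Scope ring_scope.

Definition is_subfield (F : fieldType) (K : set F) : Prop :=
  divring_closed (mem K).

Definition generated_field (F : fieldType) (S : set F) : set F :=
  smallest (@is_subfield F) S.

(* The prime field Q, for F of characteristic 0. *)
Definition rationals (F : fieldType) : set F := range (@ratr F).

Definition mpoly_over (F : fieldType) (k : set F) (n : nat)
    (p : mpoly.mpoly n F) : Prop :=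
  forall u, k (mpoly.mcoeff u p).

Definition algebraically_independent (F : fieldType) (k : set F) (m : nat)
    (x : 'I_m -> F) : Prop :=
  forall p : mpoly.mpoly m F,
    mpoly_over k p -> mpoly.meval x p = 0 -> p = 0.

(* tr.deg_k E >= m, the transcendence degree being the supremum of the sizes of
   the algebraically independent families of E over k. *)
Definition trdeg_ge (F : fieldType) (k E : set F) (m : nat) : Prop :=
  exists x : 'I_m -> F, (forall i, E (x i)) /\ algebraically_independent k x.

Definition finite_trdeg (F : fieldType) (k E : set F) : Prop :=
  exists d : nat, forall m, trdeg_ge k E m -> (m <= d)%N.

Definition infinite_trdeg (F : fieldType) (k E : set F) : Prop :=
  forall m, trdeg_ge k E m.

Definition cexp (R : realType) (z : R[i]) : R[i] :=
  ((expR (complex.Re z) * cos (complex.Im z))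
     +i* (expR (complex.Re z) * sin (complex.Im z)))%C.

Definition rationally_independent (F : fieldType) (n : nat)
    (z : 'I_n -> F) : Prop :=
  forall q : 'I_n -> rat,
    \sum_(i < n) ratr (q i) * z i = 0 -> forall i, q i = 0.

Definition schanuel_conjecture (R : realType) : Prop :=
  forall (n : nat) (z : 'I_n -> R[i]),
    rationally_independent z ->
    trdeg_ge (@rationals R[i])
      (generated_field (range z `|` range (fun i => cexp (z i)))) n.

Definition is_matrix_group (F : fieldType) (n : nat) (H : set 'M[F]_n) : Prop :=
  [/\ forall g, H g -> g \in unitmx,
      H 1%:M,
      forall g h, H g -> H h -> H (g *m h)
    & forall g, H g -> H (invmx g)].

Definition derived (F : fieldType) (n : nat) (H : set 'M[F]_n) : set 'M[F]_n :=
  smallest (@is_matrix_group F n)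
    [set c | exists g h, [/\ H g, H h
                           & c = g *m h *m invmx g *m invmx h]].

Definition solvable_group (F : fieldType) (n : nat) (H : set 'M[F]_n) : Prop :=
  exists k : nat, iter k (@derived F n) H `<=` [set 1%:M].

Definition normal_in (F : fieldType) (n : nat) (G H : set 'M[F]_n) : Prop :=
  H `<=` G /\ forall g h, G g -> H h -> H (g *m h *m invmx g).

Definition torsion_free (F : fieldType) (n : nat) (H : set 'M[F]_n) : Prop :=
  forall g (k : nat), H g -> (0 < k)%N -> g ^+ k = 1%:M -> g = 1%:M.

Definition infinite_order (F : fieldType) (n : nat) (g : 'M[F]_n) : Prop :=
  forall k : nat, (0 < k)%N -> g ^+ k <> 1%:M.

(* In the definitions on algebraic groups, F is algebraically closed of
   characteristic 0 (it will be R[i]), an algebraic group is identified with its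
   group of F-points in some GL_n(F), and k is a subfield of F. *)

Definition mx_eval (F : fieldType) (n : nat) (p : mpoly.mpoly (n * n) F)
    (g : 'M[F]_n) : F :=
  mpoly.meval (fun i => mxvec g 0 i) p.

(* Zero sets in GL_n(F) of families of polynomials over k. Allowing 1 / det
   in the equations would give the same sets. *)
Definition zariski_closed (F : fieldType) (k : set F) (n : nat)
    (A : set 'M[F]_n) : Prop :=
  exists2 S : set (mpoly.mpoly (n * n) F),
    (forall p, S p -> mpoly_over k p)
    & A = [set g | g \in unitmx /\ forall p, S p -> mx_eval p g = 0].

(* As char F = 0, a closed subgroup is defined over k as soon as it is the zero
   set of polynomials over k. *)
Definition algebraic_group (F : fieldType) (k : set F) (n : nat)
    (G : set 'M[F]_n) : Prop :=
  is_matrix_group G /\ zariski_closed k G.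

Definition zariski_connected (F : fieldType) (n : nat)
    (G : set 'M[F]_n) : Prop :=
  forall A B : set 'M[F]_n,
    zariski_closed setT A -> zariski_closed setT B ->
    G `<=` A `|` B -> G `&` A `&` B = set0 -> G `<=` A \/ G `<=` B.

Definition zariski_dense (F : fieldType) (n : nat)
    (X G : set 'M[F]_n) : Prop :=
  X `<=` G /\ forall A, zariski_closed setT A -> X `<=` A -> G `<=` A.

(* Semisimple groups are connected by convention; the last clause says that the
   radical is trivial. *)
Definition semisimple_group (F : fieldType) (k : set F) (n : nat)
    (G : set 'M[F]_n) : Prop :=
  [/\ algebraic_group k G, zariski_connected G
    & forall H : set 'M[F]_n,
        algebraic_group setT H -> zariski_connected H -> normal_in G H ->
        solvable_group H -> H `<=` [set 1%:M]].

(* Elements of F[A], the regular functions of GL_n being F[x_ij, 1 / det]. *)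
Definition regular_on (F : fieldType) (n : nat) (A : set 'M[F]_n)
    (f : 'M[F]_n -> F) : Prop :=
  exists (p : mpoly.mpoly (n * n) F) (e : nat),
    forall g, A g -> f g = mx_eval p g / \det g ^+ e.

Definition algebraic_morphism (F : fieldType) (n m : nat)
    (G : set 'M[F]_n) (H : set 'M[F]_m) (f : 'M[F]_n -> 'M[F]_m) : Prop :=
  [/\ forall g, G g -> H (f g),
      forall g h, G g -> G h -> f (g *m h) = f g *m f h
    & forall i j, regular_on G (fun g => f g i j)].

Definition isomorphic_groups (F : fieldType) (n m : nat)
    (G : set 'M[F]_n) (H : set 'M[F]_m) : Prop :=
  exists (f : 'M[F]_n -> 'M[F]_m) (f' : 'M[F]_m -> 'M[F]_n),
    [/\ algebraic_morphism G H f, algebraic_morphism H G f',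
        forall g, G g -> f' (f g) = g & forall h, H h -> f (f' h) = h].

(* The split torus GL_1^d *)
Definition diagonal_group (F : fieldType) (d : nat) : set 'M[F]_d :=
  [set a | a \in unitmx /\ is_diag_mx a].

Definition torus (F : fieldType) (k : set F) (n : nat)
    (T : set 'M[F]_n) : Prop :=
  algebraic_group k T /\ exists d, isomorphic_groups T (@diagonal_group F d).

Definition maximal_torus (F : fieldType) (k : set F) (n : nat)
    (G T : set 'M[F]_n) : Prop :=
  [/\ torus k T, T `<=` G
    & forall T', torus k T' -> T' `<=` G -> T `<=` T' -> T' = T].

(* X(T). A character is represented by the function that extends it by 0
   outside T, so that equality of characters is equality of functions. *)
Definition characters (F : fieldType) (n : nat) (T : set 'M[F]_n) :
    set ('M[F]_n -> F) :=
  [set chi | [/\ regular_on T chi,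
                 forall t, T t -> chi t != 0,
                 forall s t, T s -> T t -> chi (s *m t) = chi s * chi t
               & forall g, ~ T g -> chi g = 0]].

(* The tangent space of G at 1, for G closed in GL_n(F) *)
Definition lie_algebra (F : fieldType) (n : nat) (G : set 'M[F]_n) :
    set 'M[F]_n :=
  [set X | forall p : mpoly.mpoly (n * n) F,
     (forall g, G g -> mx_eval p g = 0) ->
     \sum_(i < n * n) mx_eval (mpoly.mderiv i p) 1%:M * mxvec X 0 i = 0].

Definition roots (F : fieldType) (n : nat) (G T : set 'M[F]_n) :
    set ('M[F]_n -> F) :=
  [set alpha | [/\ characters T alpha,
                   exists2 t, T t & alpha t <> 1
                 & exists X, [/\ lie_algebra G X, X <> 0
                     & forall t, T t ->
                         t *m X *m invmx t = alpha t *: X]]].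

Definition in_complex (R : realType) (k : set R) : set R[i] :=
  [set (x%:C)%C | x in k].

Definition mx_complex (R : realType) (n : nat) (g : 'M[R]_n) : 'M[R[i]]_n :=
  map_mx (real_complex R) g.

Definition rational_points (R : realType) (k : set R) (n : nat)
    (G : set 'M[R[i]]_n) : set 'M[R]_n :=
  [set g : 'M[R]_n | (forall i j, k (g i j)) /\ G (mx_complex g)].

Definition semisimple_element (R : realType) (n : nat) (g : 'M[R]_n) : Prop :=
  diagonalizable (mx_complex g).

Definition discrete_set (T : topologicalType) (X : set T) : Prop :=
  X `<=` isolated X.

Definition maximal_real_torus_at (R : realType) (n : nat)
    (G : set 'M[R[i]]_n) (g : 'M[R]_n) (T : set 'M[R[i]]_n) : Prop :=
  maximal_torus (in_complex [set: R]) G T /\ T (mx_complex g).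

(* The sum is a finite one, since roots G T is a finite set for a torus T. *)
Definition lambda_wrt (R : realType) (n : nat) (G T : set 'M[R[i]]_n)
    (g : 'M[R]_n) : R :=
  Num.sqrt
    (\sum_(alpha \in roots G T) ln (complex.Re `|alpha (mx_complex g)|) ^+ 2).

(* The value of lambda at g is independent of the torus T used to compute it. *)
Definition length_field (R : realType) (n : nat) (G : set 'M[R[i]]_n)
    (Gamma : set 'M[R]_n) : set R :=
  generated_field
    [set x | exists g T, [/\ Gamma g, g <> 1%:M, semisimple_element g,
                             maximal_real_torus_at G g T
                           & x = lambda_wrt G T g]].

Definition multiplicatively_independent (R : realType) (n : nat)
    (G : set 'M[R[i]]_n) (m : nat) (g : 'I_m -> 'M[R]_n) : Prop :=
  exists T : 'I_m -> set 'M[R[i]]_n,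
    (forall k, maximal_real_torus_at G (g k) (T k)) /\
    forall chi : 'I_m -> 'M[R[i]]_n -> R[i],
      (forall k, characters (T k) (chi k)) ->
      \prod_(k < m) chi k (mx_complex (g k)) = 1 ->
      forall k, chi k (mx_complex (g k)) = 1.

(* z is a value chi_1(g_1) ... chi_m(g_m), the tori T_k being arbitrary. *)
Definition character_product (R : realType) (n : nat) (G : set 'M[R[i]]_n)
    (m : nat) (g : 'I_m -> 'M[R]_n) (z : R[i]) : Prop :=
  exists (T : 'I_m -> set 'M[R[i]]_n) (chi : 'I_m -> 'M[R[i]]_n -> R[i]),
    [/\ forall k, maximal_real_torus_at G (g k) (T k),
        forall k, characters (T k) (chi k)
      & z = \prod_(k < m) chi k (mx_complex (g k))].

Definition weakly_contained (R : realType) (n n' : nat)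
    (G : set 'M[R[i]]_n) (G' : set 'M[R[i]]_n') (m : nat) (g : 'I_m -> 'M[R]_n)
    (Gamma' : set 'M[R]_n') : Prop :=
  exists (m' : nat) (g' : 'I_m' -> 'M[R]_n') (z : R[i]),
    [/\ forall k, Gamma' (g' k) /\ semisimple_element (g' k),
        character_product G g z, character_product G' g' z & z <> 1].

(* Condition (C_i), where (G, Gamma) has index i and (G', Gamma') index 3 - i *)
Definition condition_C (R : realType) (n n' : nat)
    (G : set 'M[R[i]]_n) (Gamma : set 'M[R]_n)
    (G' : set 'M[R[i]]_n') (Gamma' : set 'M[R]_n') : Prop :=
  forall m : nat, (1 <= m)%N ->
    exists g : 'I_m -> 'M[R]_n,
      [/\ forall k, [/\ Gamma (g k), semisimple_element (g k)
                      & infinite_order (g k)],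
          multiplicatively_independent G g
        & ~ weakly_contained G G' g Gamma'].

Definition admissible_subgroup (R : realType) (K : set R) (n : nat)
    (G : set 'M[R[i]]_n) (Gamma : set 'M[R]_n) : Prop :=
  [/\ is_matrix_group Gamma, Gamma `<=` rational_points K G,
      discrete_set Gamma, zariski_dense [set mx_complex g | g in Gamma] G
    & torsion_free Gamma].

(* Main.v *)
(** The square of a length lambda(gamma) is the sum of the squares of the
    logarithms of |alpha(gamma)| over the roots alpha. Since |chi|^2 is again a
    character of a real torus, multiplicative independence and the absence of
    weak containment say that the groups of logarithms of |chi(gamma_k)|,
    together with the group W of all logarithms coming from the other lattice,
    form a direct sum over Q. The exponentials of these logarithms are algebraic
    over the entry field K. Schanuel's conjecture then bounds from below the
    transcendence degree of finite Q-independent families of such logarithms, up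
    to trdeg K. For each k, one logarithm is algebraic, through a quadratic
    equation, over the other ones and lambda(gamma_k), so that almost all of the
    lambda(gamma_k) have to be algebraically independent over W.

    This requires lambda(gamma) to be nonzero for gamma of infinite order. Let
    g = gamma, diagonalised, and suppose that all the roots have modulus 1 at g.
    The hyperbolic part s of g (same eigenlines, eigenvalues replaced by their
    moduli) belongs to G, because a polynomial vanishing on all the powers of g
    is an exponential sum vanishing at all the integers, hence at every
    multiplicative function of the eigenvalues. The logarithm of s centralises
    the Lie algebra of G, so s commutes with all its conjugates; the Zariski
    closure of the subgroup these generate is connected because s has positive
    eigenvalues. Being normal and commutative it is trivial. Thus g has eigenvalues
    of modulus 1, and some positive power of it is arbitrarily close to 1, which
    contradicts discreteness and infinite order. *)
Require Import Defs.
From HB Require Import structures.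
From mathcomp Require Import all_boot all_order all_algebra.
From mathcomp Require Import all_classical all_reals all_analysis.
From mathcomp Require Import complex.
From mathcomp Require Import (canonicals, coercions) mpoly.
From mathcomp Require Import (coercions) perm.
From mathcomp Require Import (canonicals, coercions) finmap.
From mathcomp Require Import ring lra zify.
Set Implicit Arguments.
Unset Strict Implicit.
Unset Printing Implicit Defensive.
Import Order.TTheory GRing.Theory Num.Theory.
Import numFieldNormedType.Exports.
Local Open Scope classical_set_scope.
Local Open Scope ring_scope.

(** Constants and variables generate the ring, so evaluation, derivation and base change can be
    compared on generators alone. *)
Lemma mpoly_gen_ind (R : comNzRingType) n (P : mpoly.mpoly n R -> Prop) :
  (forall c, P (mpoly.mpolyC n c)) ->
  (forall i : 'I_n, P (mpoly.mpolyX R (mpoly.mnm1 i))) ->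
  (forall p q, P p -> P q -> P (p + q)) ->
  (forall p q, P p -> P q -> P (p * q)) ->
  forall p, P p.
Proof.
move=> PC PX PD PM p; rewrite [p]mpoly.mpolyE.
apply: (big_ind P) => [|//|m _]; first by rewrite -(mpoly.mpolyC0 n R).
rewrite -mpoly.mul_mpolyC; apply: (PM) => //.
rewrite mpoly.mpolyXE_id.
apply: (big_ind P) => [|//|i _]; first by rewrite -(mpoly.mpolyC1 n R).
elim: (m i) => [|k IH]; first by rewrite expr0 -(mpoly.mpolyC1 n R).
by rewrite exprS; apply: PM.
Qed.

(** * Fields generated by a set and algebraic independence *)

Section SubfieldType.
Variables (F : fieldType) (K : set F) (hK : is_subfield K).

(** The proof that [K] is a subfield is an argument, so that the closure instance declared next can
    be inferred from the predicate. This turns a set into a field type to which the theory of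
    algebraic elements applies. *)
Definition subfield_pred & is_subfield K : {pred F} := mem K.
HB.instance Definition _ :=
  GRing.isDivringClosed.Build F (subfield_pred hK) hK.

Record subfield_type :=
  Subfield { subfield_val : F; _ : subfield_val \in subfield_pred hK }.
HB.instance Definition _ := [isSub for subfield_val].
HB.instance Definition _ := [Choice of subfield_type by <:].
HB.instance Definition _ := [SubChoice_isSubComUnitRing of subfield_type by <:].
HB.instance Definition _ :=
  [SubComUnitRing_isSubIntegralDomain of subfield_type by <:].
HB.instance Definition _ :=
  [SubIntegralDomain_isSubField of subfield_type by <:].

Lemma in_subfield x : (x \in subfield_pred hK) <-> K x.
Proof. by split; rewrite inE. Qed.

Lemma subfield_polyP (p : {poly F}) : (forall i, K p`_i) ->
  exists q : {poly subfield_type}, p = map_poly val q.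
Proof.
move=> Kp; exists (\poly_(i < size p) insubd 0 p`_i).
apply/polyP => i; rewrite coef_map /= coef_poly.
case: ltnP => [_|szi]; last by rewrite nth_default ?raddf0.
by rewrite insubdK //; apply/in_subfield.
Qed.

End SubfieldType.

Section AlgebraicClosure.
Variable F : fieldType.
Implicit Types (K S T A : set F) (s t : seq F).

Lemma is_subfield_generated S : is_subfield (generated_field S).
Proof.
split; first by apply/mem_set => K [[]]; rewrite inE.
- move=> x y /set_mem Sx /set_mem Sy; apply/mem_set => K [KK SK].
  have [_ KB _] := KK; have /mem_set Kx := Sx K (conj KK SK).
  by have /mem_set Ky := Sy K (conj KK SK); have := KB _ _ Kx Ky; rewrite inE.
- move=> x y /set_mem Sx /set_mem Sy; apply/mem_set => K [KK SK].
  have [_ _ KD] := KK; have /mem_set Kx := Sx K (conj KK SK).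
  by have /mem_set Ky := Sy K (conj KK SK); have := KD _ _ Kx Ky; rewrite inE.
Qed.

Lemma sub_generated_field S : S `<=` generated_field S.
Proof. by move=> x Sx K [_ /(_ _ Sx)]. Qed.

Lemma generated_field_min S K :
  is_subfield K -> S `<=` K -> generated_field S `<=` K.
Proof. by move=> KK SK x; apply. Qed.

Definition algebraic_over K (a : F) : Prop :=
  exists p : {poly F}, [/\ p != 0, forall i, K p`_i & root p a].

Lemma algebraic_overP K (hK : is_subfield K) a :
  algebraic_over K a <->
  algebraicOver (val : subfield_type hK -> F) a.
Proof.
split=> [[p [p0 Kp pa]] | [q q0 qa]].
  by have [q Dq] := subfield_polyP hK Kp; exists q; rewrite -?Dq //;
     apply: contraNneq p0 => q0; rewrite Dq q0 map_poly0.
exists (map_poly val q); split=> //; first by rewrite map_poly_eq0.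
by move=> i; rewrite coef_map; apply/in_subfield; apply: valP.
Qed.

Lemma algebraic_over_id K a : is_subfield K -> K a -> algebraic_over K a.
Proof.
move=> hK Ka; apply/(algebraic_overP hK).
have /in_subfield Ka' := (Ka : K a).
by have := algebraic_id (val : subfield_type hK -> F) (Subfield (Ka' hK)).
Qed.

Lemma is_subfield_algebraic K : is_subfield K -> is_subfield (algebraic_over K).
Proof.
move=> hK; split; first by apply/mem_set/(algebraic_over_id hK)/(in_subfield hK)/rpred1.
- move=> x y; rewrite !inE => /(algebraic_overP hK) Kx /(algebraic_overP hK) Ky.
  by apply/(algebraic_overP hK); apply: algebraic_sub.
- move=> x y; rewrite !inE => /(algebraic_overP hK) Kx /(algebraic_overP hK) Ky.
  by apply/(algebraic_overP hK); apply: algebraic_div.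
Qed.

(** Over a field, algebraic elements are the integral ones, and a root of a nonzero polynomial with
    integral coefficients is again integral here. *)
Lemma algebraic_over_trans K a :
  is_subfield K -> algebraic_over (algebraic_over K) a -> algebraic_over K a.
Proof.
move=> hK [p [p0 Kp pa]].
apply/(algebraic_overP hK)/integral_algebraic; apply: (integral_root p0 pa).
by apply/integral_poly => i; apply/integral_algebraic/(algebraic_overP hK).
Qed.

(** Algebraic closure inside [F] of the field generated by [S]. With the exchange property below it
    is the closure operator of a matroid, whose rank is the transcendence degree. *)
Definition algcl S : set F := algebraic_over (generated_field S).

Lemma is_subfield_algcl S : is_subfield (algcl S).
Proof. exact/is_subfield_algebraic/is_subfield_generated. Qed.

Lemma sub_algcl S : S `<=` algcl S.
Proof.
move=> x Sx; apply: algebraic_over_id; first exact: is_subfield_generated.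
exact: sub_generated_field.
Qed.

Lemma algcl_closed S a : algebraic_over (algcl S) a -> algcl S a.
Proof. exact/algebraic_over_trans/is_subfield_generated. Qed.

Lemma algebraic_over_mono K L : K `<=` L ->
  algebraic_over K `<=` algebraic_over L.
Proof. by move=> KL x [p [p0 Kp px]]; exists p; split=> // i; apply: KL. Qed.

Lemma algcl_min S T : S `<=` algcl T -> algcl S `<=` algcl T.
Proof.
move=> ST x Sx; apply/algcl_closed; apply: algebraic_over_mono Sx.
by apply: generated_field_min => //; apply: is_subfield_algcl.
Qed.

Lemma algcl_mono S T : S `<=` T -> algcl S `<=` algcl T.
Proof. by move=> ST; apply: algcl_min => x /ST; apply: sub_algcl. Qed.

(** Only the finitely many coefficients below [size p] have to be gathered; all later ones are 0. *)
Lemma poly_over_directed I (D : I -> set F) (p : {poly F}) :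
  (exists i, D i 0) ->
  (forall i j, exists l, D i `<=` D l /\ D j `<=` D l) ->
  (forall n, exists i, D i p`_n) -> exists i, forall n, D i p`_n.
Proof.
move=> [i0 Di0] dir Dp.
have [i Di] : exists i, D i 0 /\ forall n, (n < size p)%N -> D i p`_n.
  elim: (size p) => [|m [i [Di IH]]]; first by exists i0.
  have [j Dj] := Dp m; have [l [il jl]] := dir i j.
  exists l; split=> [|n]; first exact: il.
  by rewrite ltnS leq_eqVlt => /predU1P[-> | /IH/il //]; apply: jl.
exists i => n; case: (ltnP n (size p)) => [/Di.2 // | sz].
by rewrite nth_default //; apply: Di.1.
Qed.

Lemma algcl_finite S T a : algcl (S `|` T) a ->
  exists t, [set` t] `<=` T /\ algcl (S `|` [set` t]) a.
Proof.
(* Intersecting with [T] lets [t] range over all lists; the elements outside [T] are filtered out at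
   the end. *)
pose D t := generated_field (S `|` ([set` t] `&` T)).
have hD t : is_subfield (D t) by apply: is_subfield_generated.
have dir t u : exists v, D t `<=` D v /\ D u `<=` D v.
  exists (t ++ u); split; apply: generated_field_min => // x [Sx | [/= tx Tx]];
    apply: sub_generated_field; first [by left | by right; rewrite /= mem_cat tx ?orbT].
have gen x : generated_field (S `|` T) x -> exists t, D t x.
  move: x; apply: generated_field_min => [|x [Sx | Tx]]; last 2 first.
  - by exists [::]; apply: sub_generated_field; left.
  - by exists [:: x]; apply: sub_generated_field; right => /=; rewrite inE.
  split.
  - by apply/mem_set; exists [::]; apply/(in_subfield (hD _)); rewrite rpred1.
  - move=> x y; rewrite !inE => -[i Dx] [j Dy]; have [l [il jl]] := dir i j.
    exists l; apply/(in_subfield (hD _)); rewrite rpredB //;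
      by apply/(in_subfield (hD _)); first [exact: il | exact: jl].
  - move=> x y; rewrite !inE => -[i Dx] [j Dy]; have [l [il jl]] := dir i j.
    exists l; apply/(in_subfield (hD _)); rewrite rpred_div //;
      by apply/(in_subfield (hD _)); first [exact: il | exact: jl].
move=> [p [p0 Sp pa]].
have [||t Dp] := @poly_over_directed (seq F) D p _ dir.
- by exists [::]; apply/(in_subfield (hD _)); rewrite rpred0.
- by move=> n; apply: gen.
exists [seq x <- t | `[< T x >]]; split.
  by move=> x /=; rewrite mem_filter => /andP[/asboolP].
exists p; split=> // i; apply: generated_field_min (Dp i) => [|x].
  exact: is_subfield_generated.
move=> [Sx | [/= tx Tx]]; apply: sub_generated_field; first by left.
by right; rewrite /= mem_filter tx andbT; apply/asboolP.
Qed.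

(** The fractions with numerator and denominator in the subring [A] form a subfield that contains
    [S]. *)
Lemma generated_field_frac S A : subring_closed (mem A) -> S `<=` A ->
  forall x, generated_field S x -> exists2 d, A d /\ d != 0 & A (d * x).
Proof.
move=> hA SA.
have A1 : A 1 by have [] := hA; rewrite inE.
have AB x y : A x -> A y -> A (x - y).
  by have [_ h _] := hA; move=> Ax Ay; have := h x y; rewrite !inE; apply.
have AM x y : A x -> A y -> A (x * y).
  by have [_ _ h] := hA; move=> Ax Ay; have := h x y; rewrite !inE; apply.
have A0 : A 0 by rewrite -(subrr 1); apply: AB.
apply: generated_field_min => [|x /SA Ax]; last first.
  by exists 1; rewrite ?mul1r ?oner_neq0.
split; first by rewrite inE; exists 1; rewrite ?mul1r ?oner_neq0.
- move=> x y; rewrite !inE => -[d [Ad d0] dx] [e [Ae e0] ey].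
  exists (d * e); first by rewrite mulf_neq0 //; split=> //; apply: AM.
  have -> : d * e * (x - y) = e * (d * x) - d * (e * y) by ring.
  by apply: AB; apply: AM.
- move=> x y; rewrite !inE => -[d [Ad d0] dx] [e [Ae e0] ey].
  have [-> | y0] := eqVneq y 0.
    by exists 1; rewrite ?invr0 ?mulr0 ?oner_neq0.
  exists (d * (e * y)); first by rewrite !mulf_neq0 //; split=> //; apply: AM.
  have -> : d * (e * y) * (x / y) = e * (d * x) by field.
  exact: AM.
Qed.

Lemma poly_generated_field_frac S A (p : {poly F}) :
  subring_closed (mem A) -> S `<=` A -> (forall i, generated_field S p`_i) ->
  exists2 d, d != 0 & forall i, A (d *: p)`_i.
Proof.
move=> hA SA Sp.
have [A1 AB AM] : [/\ A 1, forall x y, A x -> A y -> A (x - y) &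
    forall x y, A x -> A y -> A (x * y)].
  have [h1 hB hM] := hA; rewrite inE in h1; split=> // x y Ax Ay.
  - by have := hB x y; rewrite !inE; apply.
  - by have := hM x y; rewrite !inE; apply.
have A0 : A 0 by rewrite -(subrr 1); apply: AB.
have [d [Ad d0] dp] : exists2 d, A d /\ d != 0 &
    forall n, (n < size p)%N -> A (d * p`_n).
  elim: (size p) => [|m [d [Ad d0] IH]]; first by exists 1; rewrite ?oner_neq0.
  have [e [Ae e0] em] := generated_field_frac hA SA (Sp m).
  exists (d * e) => [|n]; first by rewrite mulf_neq0 //; split=> //; apply: AM.
  rewrite ltnS leq_eqVlt => /predU1P[-> | /IH dn].
    by rewrite -mulrA; apply: AM.
  by rewrite mulrAC mulrC; apply: AM.
exists d => // i; rewrite coefZ; case: (ltnP i (size p)) => [/dp // | sz].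
by rewrite nth_default // mulr0.
Qed.

(** After clearing denominators, the equation of [a] over [S] and [b] is a polynomial in two
    variables over the field of [S]. Exchanging its variables gives an equation for [b], which is
    nonzero because [a] is transcendental over [S]. *)
Lemma algcl_exchange S a b :
  algcl (b |` S) a -> ~ algcl S a -> algcl (a |` S) b.
Proof.
move=> [p [p0 Sp pa]] Sa.
have hS := is_subfield_generated S.
pose A := [set x | exists q : {poly F}, (forall i, generated_field S q`_i) /\ x = q.[b]].
have polyS (q : {poly F}) : (forall i, generated_field S q`_i) <->
    q \is a polyOver (subfield_pred hS).
  split=> [Sq | /polyOverP Sq i]; last exact/(in_subfield hS).
  by apply/polyOverP => i; apply/in_subfield.
have hA : subring_closed (mem A).
  split; first by rewrite inE; exists 1; rewrite hornerC; split=> //; apply/polyS/rpred1.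
  - move=> x y; rewrite !inE => -[q [/polyS Sq ->]] [r [/polyS Sr ->]].
    by exists (q - r); rewrite !hornerE; split=> //; apply/polyS; rewrite rpredB.
  - move=> x y; rewrite !inE => -[q [/polyS Sq ->]] [r [/polyS Sr ->]].
    by exists (q * r); rewrite !hornerE; split=> //; apply/polyS; rewrite rpredM.
have SA : b |` S `<=` A.
  move=> x [-> | Sx].
    by exists 'X; rewrite hornerX; split=> //; apply/polyS/polyOverX.
  exists x%:P; rewrite hornerC; split=> //; apply/polyS; rewrite polyOverC.
  by apply/in_subfield; apply: sub_generated_field.
have [d d0 Ap] := poly_generated_field_frac hA SA Sp.
have [f Df] := choice Ap.
pose P := \poly_(i < size p) f i.
have Pb : map_poly (horner^~ b) P = d *: p.
  apply/polyP => i; rewrite coef_map_id0 ?horner0 // coef_poly.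
  case: ltnP => [_|sz]; first by rewrite (Df i).2.
  by rewrite horner0 coefZ nth_default ?mulr0.
have SP i j : generated_field S P`_i`_j.
  rewrite coef_poly; case: ifP => _; first exact: (Df i).1.
  by rewrite coef0; apply/(in_subfield hS); rewrite rpred0.
have dp0 : d *: p != 0 by rewrite scaler_eq0 negb_or d0.
pose Q := swapXY P.
exists (map_poly (horner^~ a) Q); split.
- apply: contraNneq dp0 => Qa0; rewrite -Pb.
  suff -> : P = 0 by rewrite map_poly0.
  (* Each coefficient of [Q] is a polynomial over the field of [S] that vanishes at [a], hence it is
     zero. *)
  apply/eqP; rewrite -swapXY_eq0; apply/eqP/polyP => j; rewrite coef0.
  apply/eqP/negPn/negP => Qj0; apply: Sa; exists (swapXY P)`_j; split=> //.
    by move=> i; rewrite coef_swapXY.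
  have := congr1 (fun r : {poly F} => r`_j) Qa0.
  by rewrite coef_map_id0 ?horner0 // coef0 /root => ->.
- move=> i; rewrite coef_map_id0 ?horner0 //.
  have h := is_subfield_generated (a |` S); apply/(in_subfield h).
  apply: rpred_horner; last first.
    by apply/(in_subfield h); apply: sub_generated_field; left.
  apply/polyOverP => j; rewrite coef_swapXY; apply/(in_subfield h).
  apply: generated_field_min (SP j i) => [|x Sx]; first exact: h.
  by apply: sub_generated_field; right.
- rewrite /root.
  have -> : (map_poly (horner^~ a) Q).[b] = (map_poly (horner^~ b) P).[a].
    have hor2 (r : {poly {poly F}}) x y : (map_poly (horner^~ x) r).[y] = r.[y, x].
      by have := horner_map (horner_eval x) r y%:P; rewrite /= /horner_eval hornerC.
    by rewrite !hor2 horner2_swapXY.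
  by rewrite Pb hornerZ (rootP pa) mulr0.
Qed.

End AlgebraicClosure.

(** * Steinitz's theorem for lists of algebraically independent elements *)

Section Steinitz.
Variable F : fieldType.
Implicit Types (S T : set F) (s t : seq F).

Fixpoint algindep S s : Prop :=
  if s is a :: s' then ~ algcl (S `|` [set` s']) a /\ algindep S s' else True.

(** The recursive definition of [algindep] depends on the order of the list; by exchange any element
    can nevertheless be moved into the base. *)
Lemma algindep_extract S s1 a s2 : algindep S (s1 ++ a :: s2) ->
  algindep (a |` S) (s1 ++ s2).
Proof.
elim: s1 => [|c s1 IH] /=; last first.
  move=> [Nc /IH ind]; split=> // ca; apply: Nc; apply: algcl_mono ca => x.
  move=> [[-> | Sx] | /= xs]; [right | by left | right];
    rewrite /= mem_cat inE ?eqxx ?orbT //.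
  by move: xs; rewrite mem_cat => /orP[-> | ->]; rewrite ?orbT.
move=> [Na]; elim: s2 Na => [//|c s2 IH] Na [/= Nc ind]; split; last first.
  apply: IH => // h; apply: Na; apply: algcl_mono h => x [Sx | /= xs];
    by [left | right; rewrite /= inE xs orbT].
rewrite -setUA => /algcl_exchange/(_ Nc) ha; apply: Na.
apply: algcl_mono ha => x [-> | [Sx | /= xs]]; [right | by left | right];
  by rewrite /= inE ?eqxx ?xs ?orbT.
Qed.

Lemma algindep_size S s t : algindep S s ->
  (forall a, a \in s -> algcl (S `|` [set` t]) a) -> (size s <= size t)%N.
Proof.
elim: t S s => [|b t IH] S s ind st.
  case: s ind st => // a s [Na _] /(_ a (mem_head _ _)) ha; case: Na.
  by apply: algcl_mono ha => x [Sx | //]; left.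
have [sub | ] := pselect (forall a, a \in s -> algcl (S `|` [set` t]) a).
  exact: leq_trans (IH _ _ ind sub) _.
move=> /existsNP[a /not_implyP[as_ Na]].
case/splitPr: as_ ind st => s1 s2 ind st.
have hb : algcl (a |` (S `|` [set` t])) b.
  apply: algcl_exchange => //.
  have ha : algcl (S `|` [set` b :: t]) a by apply: st; rewrite mem_cat inE eqxx orbT.
  apply: algcl_mono ha => x [Sx | /=]; first by right; left.
  by rewrite inE => /predU1P[-> | xt]; [left | right; right].
have := IH _ _ (algindep_extract ind).
rewrite !size_cat /= addnS ltnS; apply=> c cs.
have hc : algcl (S `|` [set` b :: t]) c.
  by apply: st; move: cs; rewrite !mem_cat inE => /orP[-> | ->]; rewrite ?orbT.
apply: algcl_min hc => x [Sx | /=].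
  by apply: sub_algcl; left; right.
rewrite inE => /predU1P[-> | xt]; last by apply: sub_algcl; right.
by move: hb; rewrite setUA.
Qed.

Lemma algindep_basis S s : exists t,
  [/\ {subset t <= s}, algindep S t & forall a, a \in s -> algcl (S `|` [set` t]) a].
Proof.
elim: s => [|a s [t [ts ind st]]]; first by exists [::].
have [ha | Na] := pselect (algcl (S `|` [set` t]) a).
  exists t; split=> // [x /ts xs | x]; first by rewrite inE xs orbT.
  by rewrite inE => /predU1P[-> | /st].
exists (a :: t); split=> // x; rewrite !inE => /predU1P[-> | xt].
- by rewrite eqxx.
- by rewrite (ts _ xt) orbT.
- by apply: sub_algcl; right; rewrite /= inE eqxx.
apply: algcl_mono (st _ xt) => y [Sy | /= yt]; [by left | right].
by rewrite /= inE yt orbT.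
Qed.

(** An independent list of maximal length spans [T]; the bound [d] makes such a list exist. *)
Lemma algindep_bounded_basis S T d :
  (forall t, [set` t] `<=` T -> algindep S t -> (size t <= d)%N) ->
  exists t, [/\ [set` t] `<=` T, (size t <= d)%N & T `<=` algcl (S `|` [set` t])].
Proof.
move=> bound.
pose P m := `[< exists t, [/\ [set` t] `<=` T, algindep S t & size t = m] >].
have exP : exists m, P m by exists 0%N; apply/asboolP; exists [::].
have leP m : P m -> (m <= d)%N by move=> /asboolP[t [tT ind <-]]; apply: bound.
case: (ex_maxnP exP leP) => m /asboolP[t [tT ind <-]] max.
exists t; split=> //; first exact: bound.
move=> a Ta; apply: contrapT => Na.
suff: P (size t).+1 by move/max; rewrite ltnn.
apply/asboolP; exists (a :: t); split=> // x /=.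
by rewrite inE => /predU1P[-> | /tT].
Qed.

End Steinitz.

(** * Polynomial independence compared with independence of lists *)

Section MpolyIndependence.

Lemma mpoly_rmorph_eq (R : comNzRingType) (S : nzRingType) n
    (f g : {rmorphism mpoly.mpoly n R -> S}) :
  (forall c, f (mpoly.mpolyC n c) = g (mpoly.mpolyC n c)) ->
  (forall i, f (mpoly.mpolyX R (mpoly.mnm1 i)) =
             g (mpoly.mpolyX R (mpoly.mnm1 i))) ->
  forall p, f p = g p.
Proof.
move=> fgC fgX; apply: mpoly_gen_ind => // p q Hp Hq.
  by rewrite !rmorphD Hp Hq.
by rewrite !rmorphM Hp Hq.
Qed.

Lemma meval_map_mpoly (k F : comNzRingType) (f : {rmorphism k -> F}) n
    (x : 'I_n -> F) q :
  mpoly.meval x (mpoly.map_mpoly f q) = mpoly.mmap f x q.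
Proof.
have := @mpoly_rmorph_eq k F n (mpoly.meval x \o mpoly.map_mpoly f)
  (mpoly.mmap f x).
apply=> [c | i] /=.
  by rewrite mpoly.map_mpolyC mpoly.mevalC mpoly.mmapC.
rewrite [X in mpoly.meval _ X]mpoly.mmapX mpoly.mmap1U mpoly.mevalXU.
by rewrite mpoly.mmapX mpoly.mmap1U.
Qed.

Section LastVariable.
Variables (k : comNzRingType) (n : nat).

Lemma ord_maxP (i : 'I_n.+1) : i = ord_max \/ exists j : 'I_n, i = widen_ord (leqnSn n) j.
Proof.
have [lt_in | ] := ltnP i n; last first.
  by move=> ni; left; apply/val_inj/eqP; rewrite /= eqn_leq ni -ltnS ltn_ord.
by right; exists (Ordinal lt_in); apply/val_inj.
Qed.

Lemma muni_X (i : 'I_n) :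
  mpoly.muni (mpoly.mpolyX k (mpoly.mnm1 (widen_ord (leqnSn n) i))) =
  (mpoly.mpolyX k (mpoly.mnm1 i))%:P.
Proof.
rewrite /mpoly.muni mpoly.mmapX mpoly.mmap1U.
case: splitP => [j /= ij|j].
  by congr (mpoly.mpolyX _ (mpoly.mnm1 _))%:P; apply/val_inj.
by rewrite ord1 /= addn0 => ij; have := ltn_ord i; rewrite ij ltnn.
Qed.

Lemma muni_Xmax : mpoly.muni (mpoly.mpolyX k (mpoly.mnm1 (@ord_max n))) = 'X.
Proof.
rewrite /mpoly.muni mpoly.mmapX mpoly.mmap1U.
by case: splitP => [j /= ij|//]; have := ltn_ord j; rewrite -ij ltnn.
Qed.

Lemma mwiden_X (i : 'I_n) : mpoly.mwiden (mpoly.mpolyX k (mpoly.mnm1 i)) =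
  mpoly.mpolyX k (mpoly.mnm1 (widen_ord (leqnSn n) i)).
Proof. by rewrite /mpoly.mwiden mpoly.mmapX mpoly.mmap1U. Qed.

(** Inverse of [mpoly.muni], which reads a polynomial in [n.+1] variables as a univariate one in the
    last variable. *)
Definition from_uni (P : {poly mpoly.mpoly n k}) : mpoly.mpoly n.+1 k :=
  (map_poly (@mpoly.mwiden n k) P).[mpoly.mpolyX k (mpoly.mnm1 ord_max)].

Lemma muniK : cancel (@mpoly.muni n k) from_uni.
Proof.
move=> p.
pose f := horner_eval (mpoly.mpolyX k (mpoly.mnm1 (@ord_max n))).
have := @mpoly_rmorph_eq k _ n.+1
  (f \o map_poly (@mpoly.mwiden n k) \o @mpoly.muni n k) idfun.
apply=> [c | i] /=; rewrite /f /horner_eval.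
  by rewrite mpoly.muniC map_polyC hornerC /= mpoly.mwidenC.
have [-> | [j ->]] := ord_maxP i.
  by rewrite muni_Xmax map_polyX hornerX.
by rewrite muni_X map_polyC hornerC /= mwiden_X.
Qed.

Lemma muni_mwiden (p : mpoly.mpoly n k) : mpoly.muni (mpoly.mwiden p) = p%:P.
Proof.
have := @mpoly_rmorph_eq k _ n (@mpoly.muni n k \o @mpoly.mwiden n k) polyC.
apply=> [c | i] /=; first by rewrite mpoly.mwidenC mpoly.muniC.
by rewrite mwiden_X muni_X.
Qed.

Lemma from_uniK : cancel from_uni (@mpoly.muni n k).
Proof.
move=> P; rewrite /from_uni -horner_map /= muni_Xmax -map_poly_comp /=.
rewrite (@eq_map_poly _ _ _ polyC); last exact: muni_mwiden.
by rewrite -[RHS]comp_polyXr.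
Qed.

Variables (F : comNzRingType) (f : {rmorphism k -> F}) (x : 'I_n.+1 -> F).
Let x' := x \o widen_ord (leqnSn n).

Lemma mmap_muni p :
  mpoly.mmap f x p = (map_poly (mpoly.mmap f x') (mpoly.muni p)).[x ord_max].
Proof.
have := @mpoly_rmorph_eq k _ n.+1 (mpoly.mmap f x)
  (horner_eval (x ord_max) \o map_poly (mpoly.mmap f x') \o @mpoly.muni n k).
apply=> [c | i] /=; rewrite /horner_eval.
  by rewrite mpoly.muniC map_polyC hornerC /= !mpoly.mmapC.
have [-> | [j ->]] := ord_maxP i.
  by rewrite muni_Xmax map_polyX hornerX mpoly.mmapX mpoly.mmap1U.
by rewrite muni_X map_polyC hornerC /= !mpoly.mmapX !mpoly.mmap1U.
Qed.

End LastVariable.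

Variables (F : fieldType) (K : set F) (hK : is_subfield K).
Let k : fieldType := subfield_type hK.
Let iota : {rmorphism k -> F} := val.

Lemma mpoly_overP n (p : mpoly.mpoly n F) :
  mpoly_over K p <-> exists q : mpoly.mpoly n k, p = mpoly.map_mpoly iota q.
Proof.
split=> [Kp | [q ->] u]; last first.
  by rewrite mpoly.mcoeff_map_mpoly; apply/(in_subfield hK); apply: valP.
exists (\sum_(m <- mpoly.msupp p)
   mpoly.mpolyC n (insubd (0 : k) (mpoly.mcoeff m p)) * mpoly.mpolyX _ m).
rewrite rmorph_sum [LHS]mpoly.mpolyE; apply: eq_bigr => m _;
rewrite -mpoly.mul_mpolyC rmorphM; congr (_ * _).
  by rewrite [RHS]mpoly.mmapC /= insubdK //; apply/in_subfield.
by rewrite [RHS]mpoly.mmapX mpoly.mmap1_id.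
Qed.

Lemma algebraically_independentP n (x : 'I_n -> F) :
  algebraically_independent K x <-> forall q, mpoly.mmap iota x q = 0 -> q = 0.
Proof.
have evE := meval_map_mpoly iota x.
split=> [ind q q0 | ind p /mpoly_overP[q ->]]; last first.
  by rewrite evE => /ind->; rewrite raddf0.
have /ind : mpoly_over K (mpoly.map_mpoly iota q) by apply/mpoly_overP; exists q.
rewrite evE => /(_ q0) q0'; apply/mpoly.mpolyP => m.
have := congr1 (mpoly.mcoeff m) q0'.
by rewrite mpoly.mcoeff_map_mpoly !mpoly.mcoeff0 => /eqP; rewrite fmorph_eq0 => /eqP.
Qed.

Lemma mmap_generated_field n (x : 'I_n -> F) S q :
  K `<=` S -> (forall i, S (x i)) -> generated_field S (mpoly.mmap iota x q).
Proof.
move=> KS Sx; have h := is_subfield_generated S.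
have hS : S `<=` generated_field S by apply: sub_generated_field.
elim/mpoly_gen_ind: q => [c | i | p q Hp Hq | p q Hp Hq].
- by rewrite mpoly.mmapC; apply: hS; apply: KS; apply/(in_subfield hK); exact: valP.
- by rewrite mpoly.mmapX mpoly.mmap1U; apply: hS.
- by rewrite rmorphD; apply/(in_subfield h); rewrite rpredD //; apply/in_subfield.
- by rewrite rmorphM; apply/(in_subfield h); rewrite rpredM //; apply/in_subfield.
Qed.

(** Induction on the number of variables, separating the last one. The list is reversed because
    [algindep] separates the head, whereas [mpoly.muni] separates the last variable. *)
Lemma algebraically_independent_algindep n (x : 'I_n -> F) :
  algebraically_independent K x <-> algindep K (rev [seq x i | i <- enum 'I_n]).
Proof.
elim: n x => [|n IH] x.
  rewrite enum_ord0 /=; split=> // _; apply/algebraically_independentP => q.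
  rewrite [q]mpoly.nvar0_mpolyC mpoly.mmapC => /eqP; rewrite fmorph_eq0 => /eqP->.
  by rewrite mpoly.mpolyC0.
pose x' := x \o widen_ord (leqnSn n).
have -> : rev [seq x i | i <- enum 'I_n.+1] =
    x ord_max :: rev [seq x' i | i <- enum 'I_n].
  by rewrite enum_ordSr map_rcons rev_rcons -map_comp.
set xs := rev _; have mem_xs i : x' i \in xs by rewrite mem_rev map_f ?mem_enum.
split=> [ind | [Nx /IH/algebraically_independentP ind]]; last first.
  apply/algebraically_independentP => q; rewrite mmap_muni -/x' => q0.
  (* A nonzero coefficient of [mpoly.muni q] does not vanish at [x'], so it would make the last
     coordinate algebraic over the others. *)
  suff P0 : mpoly.muni q = 0 by rewrite -[q]muniK P0 /from_uni rmorph0 horner0.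
  apply/polyP => i; rewrite coef0; apply: ind; apply/eqP/negPn/negP => Pi0.
  apply: Nx; exists (map_poly (mpoly.mmap iota x') (mpoly.muni q)); split.
  - apply: contraNneq Pi0 => /polyP/(_ i).
    by rewrite coef_map coef0 => ->.
  - move=> j; rewrite coef_map; apply: mmap_generated_field; first by left.
    by move=> l; right; apply: mem_xs.
  - exact/eqP.
have /algebraically_independentP indx := ind; split; last first.
  apply/IH/algebraically_independentP => q q0.
  have := indx (mpoly.mwiden q); rewrite mmap_muni muni_mwiden map_polyC hornerC /=.
  by move=> /(_ q0); rewrite -(mpoly.mwiden0 n k) => /mpoly.inj_mwiden.
move=> [p [p0 Sp /eqP px]].
(* [A] is the ring generated over [K] by the first [n] coordinates. Scaling [p] into [A] lifts its
   coefficients to polynomials, and [from_uni] makes them a relation between all coordinates. *)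
pose A := range (mpoly.mmap iota x').
have hA : subring_closed (mem A).
  split; first by rewrite inE; exists 1; rewrite ?rmorph1.
  - by move=> a b; rewrite !inE => -[u _ <-] [v _ <-]; exists (u - v); rewrite ?rmorphB.
  - by move=> a b; rewrite !inE => -[u _ <-] [v _ <-]; exists (u * v); rewrite ?rmorphM.
have SA : K `|` [set` xs] `<=` A.
  move=> a [Ka | /=].
    have /(_ Ka) Ka' := (in_subfield hK a).2.
    by exists (mpoly.mpolyC n (Subfield Ka' : k)); rewrite ?mpoly.mmapC.
  rewrite mem_rev => /mapP[i _ ->].
  by exists (mpoly.mpolyX k (mpoly.mnm1 i)); rewrite ?mpoly.mmapX ?mpoly.mmap1U.
have [d d0 Ap] := poly_generated_field_frac hA SA Sp.
have /choice[f Df] : forall i, exists c, mpoly.mmap iota x' c = (d *: p)`_i.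
  by move=> i; have [c _ Dc] := Ap i; exists c.
pose P := \poly_(i < size p) f i.
have PE : map_poly (mpoly.mmap iota x') P = d *: p.
  apply/polyP => i; rewrite coef_map [_`_i]coef_poly; case: ltnP => [_ | sz].
    exact: Df.
  by rewrite raddf0 coefZ nth_default ?mulr0.
have := indx (from_uni P); rewrite mmap_muni from_uniK -/x' PE hornerZ px mulr0.
move=> /(_ erefl) /(congr1 (@mpoly.muni n k)); rewrite from_uniK mpoly.muni0 => P0.
by move/eqP: PE; rewrite P0 map_poly0 eq_sym scaler_eq0 (negbTE d0) (negbTE p0).
Qed.

End MpolyIndependence.

(** * Exponential sums and one-parameter families of matrices *)

Section ExponentialSums.
Variable F : fieldType.
Implicit Types (l : seq (F * F)) (f : F -> F).

Lemma interpolation (s : seq F) f :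
  exists p : {poly F}, forall v, v \in s -> p.[v] = f v.
Proof.
elim: s => [|a s [p Hp]]; first by exists 0.
have [as_ | as_] := boolP (a \in s).
  by exists p => v; rewrite inE => /predU1P[-> | ]; apply: Hp.
pose q := \prod_(b <- s) ('X - b%:P).
have qa : q.[a] != 0 by rewrite -rootE root_prod_XsubC.
exists (p + ((f a - p.[a]) / q.[a])%:P * q) => v; rewrite !hornerE inE.
case/predU1P => [-> | vs]; first by field.
have /eqP-> : q.[v] == 0 by rewrite -rootE root_prod_XsubC.
by rewrite mulr0 addr0 Hp.
Qed.

Definition expsum l f := \sum_(t <- l) t.1 * f t.2.

(** On the finitely many bases [f] agrees with an interpolating polynomial, and a polynomial gives a
    linear combination of the sums with powers. Thus [f] can be arbitrary: a multiplicative map, a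
    logarithm or an indicator. *)
Lemma expsum_vanish l f : (forall k : nat, expsum l (fun v => v ^+ k) = 0) ->
  expsum l f = 0.
Proof.
move=> l0; have [p Hp] := interpolation [seq t.2 | t <- l] f.
transitivity (\sum_(k < size p) p`_k * expsum l (fun v => v ^+ k)); last first.
  by rewrite big1 // => k _; rewrite l0 mulr0.
under eq_bigr do rewrite mulr_sumr.
rewrite exchange_big /= /expsum !big_seq; apply: eq_bigr => t lt_.
rewrite -Hp ?map_f // horner_coef mulr_sumr; apply: eq_bigr => k _.
by rewrite mulrCA.
Qed.

Definition mult_fun f := f 1 = 1 /\ forall v w, f (v * w) = f v * f w.

Lemma mult_fun1 : mult_fun (fun=> 1).
Proof. by split=> // v w; rewrite mulr1. Qed.

Lemma mult_funX k : mult_fun (fun v => v ^+ k).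
Proof. by split=> [|v w]; rewrite ?expr1n ?exprMn. Qed.

(* Functions of the form [f |-> \sum_j c_j f(v_j)] on multiplicative maps f,
   for fixed c_j and bases v_j in Q. The value d = \sum_j c_j nu(v_j) is the
   derivative at 0 of [t |-> \sum_j c_j v_j ^ t] when nu is a logarithm. *)
Variables (Q : set F) (nu : F -> F).
Hypotheses (Q1 : Q 1) (QM : forall v w, Q v -> Q w -> Q (v * w)).
Hypotheses (nu1 : nu 1 = 0)
  (nuM : forall v w, Q v -> Q w -> nu (v * w) = nu v + nu w).

Definition exponential (Phi : (F -> F) -> F) (d : F) : Prop :=
  exists l, [/\ forall t, t \in l -> Q t.2,
    forall f, mult_fun f -> Phi f = expsum l f & d = expsum l nu].

Lemma exponential_cst c : exponential (fun=> c) 0.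
Proof.
exists [:: (c, 1)]; split=> [t | f [f1 _] |]; rewrite ?/expsum ?big_seq1 /=.
- by rewrite inE => /eqP->.
- by rewrite f1 mulr1.
- by rewrite nu1 mulr0.
Qed.

Lemma exponential_base v : Q v -> exponential (fun f => f v) (nu v).
Proof.
move=> Qv; exists [:: (1, v)]; split=> [t | f _ |]; rewrite ?/expsum ?big_seq1 /=.
- by rewrite inE => /eqP->.
- by rewrite mul1r.
- by rewrite mul1r.
Qed.

Lemma exponentialD Phi Psi d e : exponential Phi d -> exponential Psi e ->
  exponential (fun f => Phi f + Psi f) (d + e).
Proof.
move=> [l [Ql Dl ->]] [m [Qm Dm ->]]; exists (l ++ m).
split=> [t | f hf |]; rewrite ?/expsum ?big_cat //=.
- by rewrite mem_cat => /orP[/Ql | /Qm].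
- by rewrite Dl ?Dm.
Qed.

(** The Leibniz rule at time 0, where the constant map 1 plays the part of the zeroth power. *)
Lemma exponentialM Phi Psi d e : exponential Phi d -> exponential Psi e ->
  exponential (fun f => Phi f * Psi f)
    (d * Psi (fun=> 1) + Phi (fun=> 1) * e).
Proof.
move=> [l [Ql Dl ->]] [m [Qm Dm ->]].
exists [seq (t.1 * u.1, t.2 * u.2) | t <- l, u <- m].
split=> [_ /allpairsP[[t u] [/Ql Qt /Qm Qu ->]] | f hf |].
- exact: QM.
- rewrite Dl // Dm // /expsum big_allpairs_dep mulr_suml; apply: eq_bigr => t _.
  by rewrite mulr_sumr; apply: eq_bigr => u _ /=; rewrite hf.2; ring.
have h1 := mult_fun1; rewrite Dl // Dm //.
rewrite /expsum big_allpairs_dep mulr_suml mulr_suml -big_split /= !big_seq.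
apply: eq_bigr => t lt_; rewrite !mulr_sumr -big_split /= !big_seq.
apply: eq_bigr => u mu; rewrite nuM; [| exact: Ql | exact: Qm].
by ring.
Qed.

Lemma exponential_ext Phi Psi d e : (forall f, Phi f = Psi f) -> d = e ->
  exponential Phi d -> exponential Psi e.
Proof.
by move=> PP <- [l [Ql Dl ->]]; exists l; split=> // f hf; rewrite -PP Dl.
Qed.

Lemma exponential_sum (I : finType) (Phi : I -> (F -> F) -> F) (d : I -> F) :
  (forall i, exponential (Phi i) (d i)) ->
  exponential (fun f => \sum_i Phi i f) (\sum_i d i).
Proof.
move=> h; elim: (index_enum I) => [|i s IH].
  apply: exponential_ext (exponential_cst 0) => [f |]; by rewrite big_nil.
apply: exponential_ext (exponentialD (h i) IH) => [f|]; by rewrite big_cons.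
Qed.

(** The chain rule at time 0. *)
Lemma exponential_mpoly n (p : mpoly.mpoly n F) (h : 'I_n -> (F -> F) -> F) dh :
  (forall i, exponential (h i) (dh i)) ->
  exponential (fun f => mpoly.meval (fun i => h i f) p)
    (\sum_i mpoly.meval (fun i => h i (fun=> 1)) (mpoly.mderiv i p) * dh i).
Proof.
move=> hh; elim/mpoly_gen_ind: p => [c | i | p q Hp Hq | p q Hp Hq].
- apply: exponential_ext (exponential_cst c) => [f|]; first by rewrite mpoly.mevalC.
  by rewrite big1 // => i _; rewrite mpoly.mderivC mpoly.meval0 mul0r.
- apply: exponential_ext (hh i) => [f|]; first by rewrite mpoly.mevalXU.
  rewrite (bigD1 i) //= big1 => [|j ji]; rewrite mpoly.mderivX mpoly.mevalZ mpoly.mnm1E.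
    rewrite eqxx mul1r addr0 -[LHS]mul1r; congr (_ * _).
    suff -> : mpoly.mnm_sub (mpoly.mnm1 i) (mpoly.mnm1 i) = mpoly.mnm0.
      by rewrite mpoly.mpolyX0 mpoly.meval1.
    by apply/mpoly.mnmP => j; rewrite mpoly.mnmBE mpoly.mnm0E subnn.
  by rewrite eq_sym (negbTE ji) !mul0r.
- apply: exponential_ext (exponentialD Hp Hq) => [f|]; first by rewrite mpoly.mevalD.
  by rewrite -big_split; apply: eq_bigr => i _; rewrite mpoly.mderivD mpoly.mevalD mulrDl.
- apply: exponential_ext (exponentialM Hp Hq) => [f|]; first by rewrite mpoly.mevalM.
  rewrite mulr_suml mulr_sumr -big_split; apply: eq_bigr => i _ /=.
  by rewrite mpoly.mderivM mpoly.mevalD !mpoly.mevalM; ring.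
Qed.

(** Both conclusions are instances of [expsum_vanish], the second one with [nu] as the function. *)
Lemma exponential_vanish Phi d : exponential Phi d ->
  (forall k : nat, Phi (fun v => v ^+ k) = 0) ->
  (forall f, mult_fun f -> Phi f = 0) /\ d = 0.
Proof.
move=> [l [_ Dl ->]] P0; have l0 k : expsum l (fun v => v ^+ k) = 0.
  by rewrite -Dl ?P0 //; apply: mult_funX.
by split=> [f /Dl->|]; apply: expsum_vanish.
Qed.

End ExponentialSums.

(** * Functional calculus of a diagonalised matrix *)

Section DiagonalCalculus.
Variables (F : fieldType) (n : nat) (P : 'M[F]_n) (D : 'rV[F]_n).
Hypothesis Pu : P \in unitmx.

Definition diagcalc (f : F -> F) : 'M[F]_n :=
  invmx P *m diag_mx (map_mx f D) *m P.

Lemma diagcalcM f g :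
  diagcalc f *m diagcalc g = diagcalc (fun v => f v * g v).
Proof.
rewrite /diagcalc -!mulmxA (mulmxA P) mulmxV // mul1mx; congr (_ *m _).
rewrite !mulmxA mulmx_diag; congr (diag_mx _ *m _).
by apply/rowP => i; rewrite !mxE.
Qed.

Lemma eq_diagcalc f g : (forall i, f (D 0 i) = g (D 0 i)) ->
  diagcalc f = diagcalc g.
Proof.
by move=> fg; congr (_ *m diag_mx _ *m _); apply/rowP => i; rewrite !mxE.
Qed.

Lemma diagcalc1 : diagcalc (fun=> 1) = 1%:M.
Proof.
have -> : diagcalc (fun=> 1) = invmx P *m 1%:M *m P.
  by congr (_ *m _ *m _); apply/matrixP => i j; rewrite !mxE.
by rewrite mulmx1 mulVmx.
Qed.

Lemma diagcalcX k f : diagcalc f ^+ k = diagcalc (fun v => f v ^+ k).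
Proof.
elim: k => [|k IH]; first by rewrite -[LHS]diagcalc1; apply: eq_diagcalc.
rewrite exprS IH [LHS]diagcalcM; apply: eq_diagcalc => i.
by rewrite exprS.
Qed.

Lemma diagcalc_unit f : (forall i, f (D 0 i) != 0) -> diagcalc f \in unitmx.
Proof.
move=> f0.
have /mulmx1_unit[] // : diagcalc f *m diagcalc (fun v => (f v)^-1) = 1%:M.
by rewrite diagcalcM -diagcalc1; apply: eq_diagcalc => i; rewrite divff.
Qed.

Lemma diagcalcN f : diagcalc (fun v => - f v) = - diagcalc f.
Proof.
rewrite /diagcalc (_ : map_mx _ D = - map_mx f D); last first.
  by apply/rowP => i; rewrite !mxE.
by rewrite raddfN mulmxN mulNmx.
Qed.

(** In the eigenbasis, commuting with the first matrix means that the entry [(i, j)] vanishes unless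
    [f] takes equal values at the two eigenvalues; [g] then takes equal values there too. *)
Lemma diagcalc_comm f g (B : 'M[F]_n) :
  (forall i j, f (D 0 i) = f (D 0 j) -> g (D 0 i) = g (D 0 j)) ->
  B *m diagcalc f = diagcalc f *m B -> B *m diagcalc g = diagcalc g *m B.
Proof.
move=> fg; have [B' commE] : exists B', forall h,
    B *m diagcalc h = diagcalc h *m B <->
    B' *m diag_mx (map_mx h D) = diag_mx (map_mx h D) *m B'.
  exists (P *m B *m invmx P) => h; rewrite /diagcalc; split=> E.
    have := congr1 (fun X => P *m X *m invmx P) E.
    by rewrite !mulmxA mulmxV // mul1mx -!mulmxA mulmxV // !mulmx1 => ->.
  have := congr1 (fun X => invmx P *m X *m P) E.
  by rewrite !mulmxA mulVmx // mul1mx -!mulmxA mulVmx // !mulmx1 => ->.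
move=> /commE/matrixP fE; apply/commE/matrixP => i j.
have := fE i j; rewrite !mul_mx_diag !mul_diag_mx !mxE ![_ * B' _ _]mulrC.
have [-> | B0] := eqVneq (B' i j) 0; first by rewrite !mul0r.
by move/(mulfI B0)/fg->.
Qed.

Lemma diagcalc_mull f (Z : 'M[F]_n) :
  diagcalc f *m (invmx P *m Z *m P) =
  invmx P *m (diag_mx (map_mx f D) *m Z) *m P.
Proof. by rewrite /diagcalc !mulmxA (mulmxK Pu). Qed.

Lemma diagcalc_mulr f (Z : 'M[F]_n) :
  (invmx P *m Z *m P) *m diagcalc f =
  invmx P *m (Z *m diag_mx (map_mx f D)) *m P.
Proof. by rewrite /diagcalc !mulmxA (mulmxK Pu). Qed.

Lemma conj_unitK (X : 'M[F]_n) : X = invmx P *m (P *m X *m invmx P) *m P.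
Proof. by rewrite !mulmxA (mulVmx Pu) mul1mx (mulmxKV Pu). Qed.

Lemma conj_unitVK (Z : 'M[F]_n) : P *m (invmx P *m Z *m P) *m invmx P = Z.
Proof. by rewrite !mulmxA (mulmxV Pu) mul1mx (mulmxK Pu). Qed.

Lemma conj_diagcalc (M : 'M[F]_n) : (forall i, D 0 i != 0) ->
  diagcalc id *m (invmx P *m M *m P) *m invmx (diagcalc id) =
  invmx P *m (\matrix_(i, j) (D 0 i / D 0 j * M i j)) *m P.
Proof.
move=> D0; apply: (canLR (mulmxK (diagcalc_unit D0))).
rewrite diagcalc_mull diagcalc_mulr; congr (_ *m _ *m _); apply/matrixP => i j.
by rewrite mul_diag_mx mul_mx_diag !mxE; field.
Qed.

Lemma diagcalc_comm_entries f (X : 'M[F]_n) :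
  (forall i j, (P *m X *m invmx P) i j * f (D 0 j) =
     f (D 0 i) * (P *m X *m invmx P) i j) ->
  X *m diagcalc f = diagcalc f *m X.
Proof.
move=> ZE; rewrite [X]conj_unitK; move: (P *m X *m invmx P) ZE => Z ZE.
rewrite diagcalc_mull diagcalc_mulr; congr (_ *m _ *m _); apply/matrixP => i j.
by rewrite mul_mx_diag mul_diag_mx !mxE ZE.
Qed.

End DiagonalCalculus.

Lemma diagonalizableP_diagcalc (F : fieldType) n (A : 'M[F]_n) :
  diagonalizable A -> exists2 P, P \in unitmx &
    exists D : 'rV[F]_n, A = invmx P *m diag_mx D *m P.
Proof.
move=> [P Pu /(diagonalizable_forLR Pu)[D ->]]; exists P => //; exists D.
exact: conjVmx.
Qed.

Lemma diagcalc_id (F : fieldType) n (P : 'M[F]_n) D :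
  diagcalc P D id = invmx P *m diag_mx D *m P.
Proof. by congr (_ *m diag_mx _ *m _); apply/rowP => i; rewrite mxE. Qed.

Section ExponentialMatrices.
Variables (F : fieldType) (Q : set F) (nu : F -> F).
Hypotheses (Q1 : Q 1) (QM : forall v w, Q v -> Q w -> Q (v * w)).
Hypotheses (nu1 : nu 1 = 0)
  (nuM : forall v w, Q v -> Q w -> nu (v * w) = nu v + nu w).
Variable n : nat.
Implicit Types (A B : (F -> F) -> 'M[F]_n) (dA dB : 'M[F]_n).

Definition exponential_mx A dA : Prop :=
  forall i j, exponential Q nu (fun f => A f i j) (dA i j).

Lemma exponential_mx_cst (B : 'M[F]_n) : exponential_mx (fun=> B) 0.
Proof. by move=> i j; rewrite mxE; apply: exponential_cst. Qed.

Lemma exponential_mxM A B dA dB : exponential_mx A dA -> exponential_mx B dB ->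
  exponential_mx (fun f => A f *m B f) (dA *m B (fun=> 1) + A (fun=> 1) *m dB).
Proof.
move=> hA hB i j.
have h := exponential_sum Q1 nu1 (fun k => exponentialM QM nuM (hA i k) (hB k j)).
apply: exponential_ext h => [f|]; first by rewrite mxE.
by rewrite !mxE big_split.
Qed.

(** When the family passes through the identity at time 0, this derivative is the linear form that
    occurs in [lie_algebra]. *)
Lemma exponential_mx_eval p A dA : exponential_mx A dA ->
  exponential Q nu (fun f => mx_eval p (A f))
    (\sum_i mx_eval (mpoly.mderiv i p) (A (fun=> 1)) * mxvec dA 0 i).
Proof.
move=> hA.
apply: (@exponential_mpoly _ Q nu Q1 QM nu1 nuM _ p (fun i f => mxvec (A f) 0 i)) => i.
case/mxvec_indexP: i => i j; rewrite mxvecE.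
by apply: exponential_ext (hA i j) => // f; rewrite mxvecE.
Qed.

Lemma exponential_diagcalc P (D : 'rV[F]_n) : (forall i, Q (D 0 i)) ->
  exponential_mx (diagcalc P D) (diagcalc P D nu).
Proof.
move=> QD i j.
have h : exponential Q nu (fun f => \sum_k (invmx P i k * P k j) * f (D 0 k))
    (\sum_k (invmx P i k * P k j) * nu (D 0 k)).
  apply: exponential_sum => // k.
  apply: exponential_ext (exponentialM QM nuM (exponential_cst Q1 nu1 (invmx P i k * P k j)) (exponential_base nu (QD k))) => // .
  by rewrite mul0r add0r.
have E f : diagcalc P D f i j = \sum_k (invmx P i k * P k j) * f (D 0 k).
  rewrite /diagcalc mxE; apply: eq_bigr => k _.
  by rewrite mul_mx_diag !mxE; ring.
by rewrite E; apply: exponential_ext h => // f; rewrite E.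
Qed.

End ExponentialMatrices.

(** * Consequences of Schanuel's conjecture *)

Section RationalSpan.
Variable R : realType.
Implicit Types (s t : seq R) (x : R).

Definition qspan s : set R :=
  [set x | exists q : nat -> rat, x = \sum_(i < size s) ratr (q i) * s`_i].

Definition qindep s : Prop := forall q : nat -> rat,
  \sum_(i < size s) ratr (q i) * s`_i = 0 -> forall i, (i < size s)%N -> q i = 0.

Lemma qspan_cons a s x (r : rat) : qspan s x -> qspan (a :: s) (ratr r * a + x).
Proof.
move=> [q ->]; exists (fun i => if i is j.+1 then q j else r).
by rewrite big_ord_recl.
Qed.

Lemma qspan_rconsP s a x : qspan (s ++ [:: a]) x ->
  exists r y, qspan s y /\ x = ratr r * a + y.
Proof.
move=> [q ->]; exists (q (size s)), (\sum_(i < size s) ratr (q i) * s`_i).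
split; first by exists q.
rewrite -(big_mkord xpredT (fun i => ratr (q i) * (s ++ [:: a])`_i)).
rewrite size_cat addn1 big_nat_recr //= nth_cat ltnn subnn addrC; congr (_ + _).
by rewrite big_mkord; apply: eq_bigr => i _; rewrite nth_cat ltn_ord.
Qed.

Lemma qspan_mem s a : a \in s -> qspan s a.
Proof.
move=> as_; have h : (index a s < size s)%N by rewrite index_mem.
exists (fun i => (i == index a s)%:R); rewrite (bigD1 (Ordinal h)) //= eqxx nth_index //.
rewrite rmorph1 mul1r big1 ?addr0 // => i; rewrite -val_eqE /= => /negbTE->.
by rewrite rmorph0 mul0r.
Qed.

Lemma qindep_cons a s : qindep s -> ~ qspan s a -> qindep (a :: s).
Proof.
move=> ind Na q; rewrite big_ord_recl /= => q0.
have [q00 | q00] := eqVneq (q 0%N) 0.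
  move: q0; rewrite q00 rmorph0 mul0r add0r => q0.
  by case=> [//|i] /=; rewrite ltnS => /(ind (q \o S) q0).
case: Na; exists (fun i => - (q i.+1 / q 0%N)).
have r0 : ratr (q 0%N) != 0 :> R by rewrite fmorph_eq0.
apply: (mulfI r0); rewrite -[LHS]subr0 -[X in _ - X]q0 opprD addrA subrr add0r.
rewrite -sumrN mulr_sumr; apply: eq_bigr => i _.
by rewrite rmorphN fmorph_div /=; field.
Qed.

(** The added part [t] is placed before [b], so that with [b] a single element this element stays
    last, the shape required by [qspan_rconsP]. *)
Lemma qindep_extend s b : qindep b -> exists t,
  [/\ {subset t <= s}, qindep (t ++ b) & forall x, x \in s -> qspan (t ++ b) x].
Proof.
move=> indb; elim: s => [|a s [t [ts ind st]]]; first by exists [::].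
have [ha | Na] := pselect (qspan (t ++ b) a).
  exists t; split=> // [x /ts xs | x]; first by rewrite inE xs orbT.
  by rewrite inE => /predU1P[-> | /st].
exists (a :: t); split=> [x | | x] /=; rewrite ?inE.
- by move=> /predU1P[-> | /ts->]; rewrite ?eqxx ?orbT.
- exact: qindep_cons.
move=> /predU1P[-> | xs]; first by apply: qspan_mem; rewrite mem_head.
by have := qspan_cons a 0 (st _ xs); rewrite rmorph0 mul0r add0r.
Qed.

End RationalSpan.

Section CharZero.
Variable F : numFieldType.

Lemma is_subfield_rationals : is_subfield (@rationals F).
Proof.
split; first by rewrite inE; exists 1; rewrite ?rmorph1.
- by move=> x y; rewrite !inE => -[p _ <-] [q _ <-]; exists (p - q); rewrite ?rmorphB.
- by move=> x y; rewrite !inE => -[p _ <-] [q _ <-]; exists (p / q); rewrite ?fmorph_div.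
Qed.

End CharZero.

Section RealComplex.
Variable R : realType.
Notation C := R[i].
Notation toC := (real_complex R).

Lemma is_subfield_in_complex (K : set R) : is_subfield K -> is_subfield (in_complex K).
Proof.
move=> hK; split; first by rewrite inE; exists 1; rewrite ?rmorph1 //; apply/(in_subfield hK)/rpred1.
- move=> x y; rewrite !inE => -[a Ka <-] [b Kb <-]; exists (a - b); rewrite ?rmorphB //.
  by apply/(in_subfield hK); rewrite rpredB //; apply/in_subfield.
- move=> x y; rewrite !inE => -[a Ka <-] [b Kb <-]; exists (a / b); rewrite ?fmorph_div //.
  by apply/(in_subfield hK); rewrite rpred_div //; apply/in_subfield.
Qed.

Lemma in_complex_rationals : in_complex (@rationals R) = @rationals C.
Proof.
apply/seteqP; split=> [_ [_ [q _ <-] <-] | _ [q _ <-]].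
  by exists q; rewrite // (fmorph_rat toC).
by exists (ratr q); [exists q | rewrite (fmorph_rat toC)].
Qed.

(** Schanuel's conjecture is about complex numbers and lengths are real: independence is obtained
    over the complex numbers and brought back. *)
Lemma algebraically_independent_complex (K : set R) n (x : 'I_n -> R) :
  algebraically_independent (in_complex K) (toC \o x) ->
  algebraically_independent K x.
Proof.
move=> ind p Kp px.
have : mpoly.map_mpoly toC p = 0.
  apply: ind => [u|]; first by rewrite mpoly.mcoeff_map_mpoly; exists (mpoly.mcoeff u p).
  rewrite meval_map_mpoly.
  have := @mpoly_rmorph_eq _ _ n (toC \o mpoly.meval x) (mpoly.mmap toC (toC \o x)).
  move=> <- /=; [by rewrite px rmorph0 | move=> c | move=> i].
    by rewrite mpoly.mevalC mpoly.mmapC.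
  by rewrite mpoly.mevalXU mpoly.mmapX mpoly.mmap1U.
move=> p0; apply/mpoly.mpolyP => m; have := congr1 (mpoly.mcoeff m) p0.
by rewrite mpoly.mcoeff_map_mpoly !mpoly.mcoeff0 => /eqP; rewrite fmorph_eq0 => /eqP.
Qed.

Lemma cexp_real (u : R) : cexp (toC u) = toC (expR u).
Proof. by rewrite /cexp /= cos0 sin0 mulr1 mulr0. Qed.

End RealComplex.

(** * Bounds from Schanuel's conjecture, and quadratic relations *)

Section TranscendenceCore.
Variables (R : realType) (schanuel : schanuel_conjecture R).
Notation C := R[i].
Notation toC := (real_complex R).

Lemma algindep_sub (F : fieldType) (S T : set F) s :
  S `<=` algcl T -> algindep T s -> algindep S s.
Proof.
move=> ST; elim: s => [//|a s IH] /= [Na /IH ind]; split=> // ha; apply: Na.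
apply: algcl_min ha => x [Sx | xs]; last by apply: sub_algcl; right.
by apply: algcl_mono (ST _ Sx) => y Ty; left.
Qed.

Lemma algindep_drop (F : fieldType) (S : set F) n s :
  algindep S s -> algindep S (drop n s).
Proof. by elim: s n => [|a s IH] [|n] //= [_ /IH]. Qed.

Lemma trdeg_list (F : fieldType) (K : set F) (s : seq F) : is_subfield K ->
  algindep K s ->
  algebraically_independent K (tnth (in_tuple (rev s))).
Proof.
move=> hK ind; apply/algebraically_independent_algindep => //.
by rewrite map_tnth_enum revK.
Qed.

(** An independent list of elements of [K] has length at most [d], so a maximal one is a
    transcendence basis of this size. *)
Lemma finite_trdeg_basis (K : set R) d :
  (forall m, trdeg_ge (@rationals R) K m -> (m <= d)%N) ->
  exists t : seq C, (size t <= d)%N /\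
    in_complex K `<=` algcl (@rationals C `|` [set` t]).
Proof.
move=> Kd; have [t tK ind | t [_ td sub]] :=
  @algindep_bounded_basis _ (@rationals C) (in_complex K) d; last by exists t.
have /trdeg_list := ind; move=> /(_ (is_subfield_rationals _)).
have /choice[y Dy] : forall i : 'I_(size (rev t)), exists y : R,
    K y /\ toC y = tnth (in_tuple (rev t)) i.
  move=> i; have : tnth (in_tuple (rev t)) i \in rev t by apply: mem_tnth.
  by rewrite mem_rev => /tK[y Ky <-]; exists y.
rewrite -in_complex_rationals => indx; rewrite -size_rev; apply: Kd.
exists y; split=> [i | ]; first exact: (Dy i).1.
apply: algebraically_independent_complex.
by rewrite (_ : toC \o y = tnth (in_tuple (rev t))) //; apply/funext => i; apply: (Dy i).2.
Qed.

Lemma clear_denominators (J : finType) (q : J -> rat) :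
  exists (N : int) (p : J -> int), N != 0 /\ forall j, N%:~R * q j = (p j)%:~R.
Proof.
exists (\prod_j denq (q j)), (fun j => numq (q j) * \prod_(i | i != j) denq (q i)).
split; first by apply/prodf_neq0 => j _; apply: denq_neq0.
move=> j; rewrite (bigD1 j) //= !intrM mulrAC; congr (_ * _).
by rewrite mulrC numqE.
Qed.

(** Schanuel's conjecture yields [#|J|] algebraically independent elements in the closure of [t],
    and [algindep_size] compares the two sizes. Integral relations suffice after clearing
    denominators. *)
Lemma schanuel_bound (J : finType) (z : J -> R) (t : seq C) :
  (forall p : J -> int, \sum_j (p j)%:~R * z j = 0 -> forall j, p j = 0) ->
  (forall j, algcl (@rationals C `|` [set` t]) (toC (z j))) ->
  (forall j, algcl (@rationals C `|` [set` t]) (toC (expR (z j)))) ->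
  (#|J| <= size t)%N.
Proof.
move=> ind hz he.
have [q q0 i | w [wE /algebraically_independent_algindep indw]] :=
    @schanuel #|J| (fun i => toC (z (enum_val i))).
  have q0' : \sum_j ratr (q (enum_rank j)) * z j = 0.
    apply: (complexI (R := R)); rewrite rmorph0 -[RHS]q0 rmorph_sum /=.
    rewrite (reindex (@enum_val J J)) /=; last by apply: onW_bij; apply: enum_val_bij.
    by apply: eq_bigr => j _; rewrite enum_valK rmorphM /= (fmorph_rat toC).
  have [N [p [N0 Dp]]] := clear_denominators (q \o enum_rank).
  have p0 : \sum_j (p j)%:~R * z j = 0.
    transitivity (N%:~R * \sum_j ratr (q (enum_rank j)) * z j).
      rewrite mulr_sumr; apply: eq_bigr => j _.
      rewrite mulrA; congr (_ * _); have := congr1 (@ratr R) (Dp j).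
      by rewrite rmorphM /= !ratr_int.
    by rewrite q0' mulr0.
  have := Dp (enum_val i); rewrite /= enum_valK (ind _ p0) => /eqP.
  by rewrite mulf_eq0 intr_eq0 (negbTE N0) => /eqP.
set E := algcl (@rationals C `|` [set` t]) in hz he.
have wE' i : E (w i).
  apply: generated_field_min (wE i); first exact: is_subfield_algcl.
  by move=> _ [[j _ <-] | [j _ <-]] //; rewrite cexp_real.
have := algindep_size (indw (is_subfield_rationals _)).
move=> /(_ t); rewrite size_rev size_map size_enum_ord; apply=> a.
by rewrite mem_rev => /mapP[i _ ->]; apply: wE'.
Qed.

Definition subgroup_set (L : set R) : Prop :=
  L 0 /\ forall x y, L x -> L y -> L (x - y).

Lemma subgroup_setN (L : set R) x : subgroup_set L -> L x -> L (- x).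
Proof. by move=> [L0 LB] Lx; rewrite -sub0r; apply: LB. Qed.

Lemma subgroup_setD (L : set R) x y : subgroup_set L -> L x -> L y -> L (x + y).
Proof.
by move=> hL Lx Ly; rewrite -[y]opprK; apply: hL.2 => //; apply: subgroup_setN.
Qed.

Lemma subgroup_setMz (L : set R) x (n : int) : subgroup_set L -> L x ->
  L (n%:~R * x).
Proof.
move=> hL Lx; have Ln (m : nat) : L (m%:R * x).
  elim: m => [|m IH]; first by rewrite mul0r; apply: hL.1.
  by rewrite -natr1 mulrDl mul1r; apply: subgroup_setD.
case: n => n; first exact: Ln.
by rewrite NegzE rmorphN mulNr; apply: subgroup_setN => //; apply: Ln.
Qed.

Lemma subgroup_set_sum (L : set R) (I : finType) (x : I -> R) :
  subgroup_set L -> (forall i, L (x i)) -> L (\sum_i x i).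
Proof.
move=> hL Lx; apply: (big_ind L) => // [|u v]; first exact: hL.1.
exact: subgroup_setD.
Qed.

Lemma qspan_subfield (E : set C) s x : is_subfield E ->
  (forall a, a \in s -> E (toC a)) -> qspan s x -> E (toC x).
Proof.
move=> hE Es [q ->]; rewrite rmorph_sum; apply/(in_subfield hE).
apply: rpred_sum => i _; rewrite rmorphM /= (fmorph_rat toC) rpredM ?rpred_rat //.
by apply/(in_subfield hE)/Es/mem_nth.
Qed.

(* If l ^ 2 is the sum of the squares of rational combinations of s and x, then
   x is a root of a quadratic polynomial over the field of l and s; its leading
   coefficient is the sum of the squares of the coefficients of x. *)
Lemma quadratic_closed (S : set C) (x l : R) (s us : seq R) :
  (forall a, a \in s -> algcl S (toC a)) -> algcl S (toC l) ->
  l ^+ 2 = \sum_(u <- us) u ^+ 2 ->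
  x \in us -> (forall u, u \in us -> qspan (s ++ [:: x]) u) ->
  algcl S (toC x).
Proof.
move=> Ss Sl l2 xus us_s; have hS := is_subfield_algcl S.
have /choice[r /choice[y Dry]] : forall u, exists r : rat, exists y : R,
    u \in us -> qspan s y /\ u = ratr r * x + y.
  move=> u; have [/us_s/qspan_rconsP[r [y Dry]] | _] := boolP (u \in us).
    by exists r, y.
  by exists 0, 0.
have Sy u : u \in us -> algcl S (toC (y u)).
  by move=> /Dry[sy _]; apply: qspan_subfield sy.
(* If the leading coefficient vanishes, so does the coefficient of [x] in its own decomposition, and
   [x] is already in the span of [s]. *)
have [r0 | r0] := eqVneq (\sum_(u <- us) r u ^+ 2) 0.
  have rx : r x = 0.
    move/eqP: r0; rewrite psumr_eq0 => [/allP/(_ x xus)|u _]; last exact: sqr_ge0.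
    by rewrite sqrf_eq0 => /eqP.
  have [_] := Dry x xus; rewrite rx rmorph0 mul0r add0r => ->; exact: Sy.
pose lin u : {poly C} := ratr (r u) *: 'X + (toC (y u))%:P.
pose p := \sum_(u <- us) lin u ^+ 2 - (toC l ^+ 2)%:P.
apply: algcl_closed; exists p; split.
- apply: contraNneq r0 => /(congr1 (fun q : {poly C} => q`_2)).
  rewrite coef0 coefB coefC subr0 coef_sum.
  rewrite (eq_bigr (fun u => ratr (r u ^+ 2))) => [|u _]; last first.
    have -> : lin u ^+ 2 = (ratr (r u) ^+ 2)%:P * 'X^2 +
        (ratr (r u) * toC (y u) *+ 2)%:P * 'X + (toC (y u) ^+ 2)%:P.
      rewrite /lin -mul_polyC !rmorphMn !rmorphXn !rmorphM /=; ring.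
    by rewrite !coefD !coefCM coefXn coefX coefC mulr1 mulr0 !addr0 rmorphXn.
  by rewrite -rmorph_sum => /eqP; rewrite fmorph_eq0.
- suff /polyOverP Sp : p \is a polyOver (subfield_pred hS).
    by move=> i; apply/(in_subfield hS).
  rewrite rpredB ?polyOverC ?rpredX //; last exact/in_subfield.
  rewrite big_seq rpred_sum // => u us_u.
  rewrite rpredX // /lin -mul_polyC rpredD ?rpredM ?polyOverC ?polyOverX //.
    exact: rpred_rat.
  exact/in_subfield/Sy.
rewrite /root /p hornerD hornerN hornerC horner_sum -rmorphXn l2 rmorph_sum subr_eq0.
apply/eqP.
rewrite !big_seq; apply: eq_bigr => u us_u; rewrite !hornerE -(fmorph_rat toC).
by rewrite -rmorphM -rmorphD -rmorphXn -(Dry _ us_u).2.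
Qed.

End TranscendenceCore.

Section LengthIndependence.
Variables (R : realType) (schanuel : schanuel_conjecture R).
Notation C := R[i].
Notation toC := (real_complex R).
Variables (K : set R) (d : nat).
Hypothesis Kd : forall m, trdeg_ge (@rationals R) K m -> (m <= d)%N.

Lemma size_flatten_codom (T : Type) M (Z : 'I_M -> seq T) :
  size (flatten [seq Z k | k <- enum 'I_M]) = (\sum_(k < M) size (Z k))%N.
Proof. by rewrite size_flatten /shape sumnE 2!big_map big_enum. Qed.

Lemma qindep_int (s : seq R) (p : 'I_(size s) -> int) : qindep s ->
  \sum_i (p i)%:~R * s`_i = 0 -> forall i, p i = 0.
Proof.
move=> ind p0 i.
pose q n : rat := if insub n is Some j then (p j)%:~R else 0.
have qE (j : 'I_(size s)) : q j = (p j)%:~R by rewrite /q valK.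
have : \sum_(j < size s) ratr (q j) * s`_j = 0.
  by rewrite -[RHS]p0; apply: eq_bigr => j _; rewrite qE ratr_int.
by move=> /ind/(_ i (ltn_ord i)); rewrite qE => /eqP; rewrite intr_eq0 => /eqP.
Qed.

(* The numbers lam k, a maximal Q-independent part of us k for each k, and a
   Q-basis of the finitely many elements of W involved give a Q-independent
   family whose exponentials are algebraic over K; one element of us k is
   algebraic over the others together with lam k, so Schanuel's bound leaves at
   least M - d algebraically independent lam k. *)
Theorem length_independence (F2 W : set R) (m M : nat)
    (L : 'I_M -> set R) (lam : 'I_M -> R) (us : 'I_M -> seq R) :
  is_subfield F2 -> (forall f, F2 f -> algcl (toC @` W) (toC f)) ->
  subgroup_set W -> (forall k, subgroup_set (L k)) ->
  (forall u, W u -> algcl (in_complex K) (toC (expR u))) ->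
  (forall k u, L k u -> algcl (in_complex K) (toC (expR u))) ->
  (forall (v : 'I_M -> R) w, (forall k, L k (v k)) -> W w ->
     \sum_k v k = w -> forall k, v k = 0) ->
  (forall k u, u \in us k -> L k u) ->
  (forall k, lam k ^+ 2 = \sum_(u <- us k) u ^+ 2) ->
  (forall k, lam k != 0) ->
  (m + d <= M)%N ->
  exists x : 'I_m -> R,
    (forall i, exists k, x i = lam k) /\ algebraically_independent F2 x.
Proof.
move=> hF2 F2W hW hL expW expL direct usL lam2 lam0 leM.
pose ls := [seq toC (lam k) | k <- enum 'I_M].
have [I [Ils indI lsI]] := algindep_basis (toC @` W) ls.
suff leI : (m <= size I)%N.
  (* The last [m] elements of [I] stay independent over [W], hence over [F2], which is algebraic
     over [W]. *)
  pose I' := drop (size I - m) I.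
  have szI' : size (rev I') = m by rewrite size_rev size_drop subKn.
  have indI' : algindep (in_complex F2) I'.
    by apply: algindep_sub (algindep_drop _ indI) => _ [f /F2W Wf <-].
  have := trdeg_list (is_subfield_in_complex hF2) indI'.
  have memI' i : exists k, tnth (in_tuple (rev I')) i = toC (lam k).
    have : tnth (in_tuple (rev I')) i \in rev I' by apply: mem_tnth.
    by rewrite mem_rev => /mem_drop/Ils/mapP[k _ ->]; exists k.
  have /choice[f Df] := memI'.
  move=> ind; rewrite -szI'.
  exists (lam \o f); split=> [i | ]; first by exists (f i).
  apply: algebraically_independent_complex.
  by rewrite (_ : toC \o _ = tnth (in_tuple (rev I'))) //; apply/funext => i; rewrite Df.
have [kb [kbd Kkb]] := finite_trdeg_basis Kd.
(* The algebraic relations of the [lam k] over [I] and [W] involve only finitely many elements of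
   [W]. *)
have [y0 [y0W lsy0]] : exists y0 : seq R, [set` y0] `<=` W /\
    forall k, algcl ([set` I] `|` [set` map toC y0]) (toC (lam k)).
  have fin k : exists y : seq R, [set` y] `<=` W /\
      algcl ([set` I] `|` [set` map toC y]) (toC (lam k)).
    have : algcl ([set` I] `|` toC @` W) (toC (lam k)).
      by rewrite setUC; apply: lsI; apply/mapP; exists k; rewrite ?mem_enum.
    move=> /algcl_finite[t [tW ht]].
    exists [seq complex.Re z | z <- t]; split.
      by move=> _ /= /mapP[z /tW[w Ww <-] ->].
    apply: algcl_mono ht => z [Iz | /= zt]; [by left | right].
    have [w Ww Dz] := tW _ zt; rewrite -Dz; apply: map_f.
    by apply/mapP; exists z; rewrite // -Dz.
  have /choice[y Dy] := fin.
  exists (flatten [seq y k | k <- enum 'I_M]); split=> [u /= | k].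
    by move=> /flattenP[s /mapP[k _ ->]]; apply: (Dy k).1.
  apply: algcl_mono (Dy k).2 => z [Iz | /= /mapP[u uy ->]]; [by left | right].
  apply: map_f; apply/flattenP; exists (y k) => //.
  by apply/mapP; exists k; rewrite ?mem_enum.
have qindep0 : qindep ([::] : seq R) by [].
have [y [yy0 indy y0y]] := qindep_extend y0 qindep0.
rewrite cats0 in indy y0y.
have /choice[x Dx] : forall k, exists x, x \in us k /\ x != 0.
  move=> k; apply: contrapT => h; have := lam0 k; rewrite -sqrf_eq0 lam2.
  rewrite big_seq big1 ?eqxx // => u us_u; apply/eqP; rewrite sqrf_eq0.
  by apply/negPn/negP => u0; apply: h; exists u.
have /choice[Z DZ] : forall k, exists Z, [/\ {subset Z <= us k},
    qindep (Z ++ [:: x k]) & forall u, u \in us k -> qspan (Z ++ [:: x k]) u].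
  move=> k; apply: qindep_extend => q; rewrite big_ord_recl big_ord0 addr0 => /eqP.
  rewrite mulf_eq0 (negbTE (Dx k).2) orbF fmorph_eq0 => /eqP q0.
  by case=> [|//] _.
pose B k := Z k ++ [:: x k].
have BL k u : u \in B k -> L k u.
  have [ZU _ _] := DZ k; rewrite mem_cat inE => /orP[/ZU/usL // | /eqP->].
  by apply: usL; have [] := Dx k.
pose J := ({k : 'I_M & 'I_(size (B k))} + 'I_(size y))%type.
pose z (j : J) : R := match j with
  | inl p => (B (tag p))`_(tagged p) | inr i => y`_i end.
(* [t] omits the [x k], which are recovered through the quadratic equation, whereas [J] counts them.
   Hence [#|J| <= size t] reduces to [M <= size I + d]. *)
pose t : seq C := I ++ flatten [seq map toC (Z k) | k <- enum 'I_M] ++ map toC y ++ kb.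
have It a : a \in I -> a \in t by rewrite mem_cat => ->.
have Zt k a : a \in Z k -> toC a \in t.
  move=> aZ; rewrite !mem_cat; apply/or4P/Or42/flattenP.
  exists (map toC (Z k)); last exact: map_f.
  by apply/mapP; exists k; rewrite ?mem_enum.
have yt a : a \in y -> toC a \in t.
  by move=> ay; rewrite !mem_cat; apply/or4P/Or43/map_f.
have kbt a : a \in kb -> a \in t by rewrite !mem_cat => ->; rewrite !orbT.
set S : set C := @rationals C `|` [set` t].
have tS a : a \in t -> algcl S a by move=> ta; apply: sub_algcl; right.
have hS := is_subfield_algcl S.
have KS : algcl (in_complex K) `<=` algcl S.
  apply: algcl_min => a /Kkb; apply: algcl_mono => b [Qb | /kbt tb];
    by [left | right].
have lamS k : algcl S (toC (lam k)).
  apply: algcl_min (lsy0 k) => a [/It/tS // | /= /mapP[u /y0y yu ->]].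
  by apply: qspan_subfield yu => // b /yt/tS.
have xS k : algcl S (toC (x k)).
  apply: (@quadratic_closed R S (x k) (lam k) (Z k) (us k)) => //.
  - by move=> a /Zt/tS.
  - exact: (Dx k).1.
  by have [] := DZ k.
have sizet : (size t <= size I + \sum_k size (Z k) + size y + d)%N.
  rewrite !size_cat size_flatten_codom size_map.
  rewrite (eq_bigr (fun k => size (Z k))) => [|k _]; last by rewrite size_map.
  by rewrite -!addnA !leq_add2l.
have cardJ : #|{: J}| = (\sum_k size (Z k) + M + size y)%N.
  rewrite card_sum card_ord card_tagged sumnE big_map big_enum /=; congr (_ + _)%N.
  rewrite (eq_bigr (fun k => size (Z k) + 1)%N) => [|k _]; last first.
    by rewrite card_ord size_cat.
  by rewrite big_split /= sum1_card card_ord.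
suff : (#|{: J}| <= size t)%N.
  rewrite cardJ => /leq_trans/(_ sizet) h; lia.
apply: (@schanuel_bound R schanuel J z).
(* A relation splits into parts [v k] in [L k] and a part [w] in [W]. Directness kills each part,
   and Q-independence within each part kills the coefficients. *)
- move=> p; rewrite big_sumType /=.
  pose v k := \sum_(i < size (B k)) (p (inl (Tagged _ i)))%:~R * (B k)`_i.
  pose w := \sum_(i < size y) (p (inr i))%:~R * y`_i.
  have -> : \sum_i (p (inl i))%:~R * (B (tag i))`_(tagged i) = \sum_k v k.
    by rewrite /v sig_big_dep; apply: eq_bigr => -[k i] _.
  rewrite -/w => /eqP; rewrite addr_eq0 => /eqP vw.
  have Lv k : L k (v k).
    by apply: subgroup_set_sum => // i; apply: subgroup_setMz => //; apply/BL/mem_nth.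
  have Ww : W w.
    apply: subgroup_set_sum => // i; apply: subgroup_setMz => //.
    by apply/y0W/yy0/mem_nth.
  have v0 := direct v _ Lv (subgroup_setN hW Ww) vw.
  have w0 : w = 0.
    by apply/eqP; rewrite -oppr_eq0 -vw big1 // => k _; rewrite v0.
  case=> [[k i] | i]; last exact: qindep_int w0 i.
  have [_ indB _] := DZ k.
  exact: (@qindep_int (B k) (fun i => p (inl (Tagged _ i))) indB (v0 k) i).
- case=> [[k i] | i] /=; last by apply: tS; apply: yt; apply: mem_nth.
  have := mem_nth 0 (ltn_ord i); rewrite mem_cat inE => /orP[/Zt/tS // | /eqP->].
  exact: xS.
- case=> [[k i] | i] /=; apply: KS.
    by apply: (expL k); apply: BL; apply: mem_nth.
  by apply: expW; apply: y0W; apply: yy0; apply: mem_nth.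
Qed.

End LengthIndependence.

(** * Zariski closures and normal subgroups *)

Lemma invmxM (F : fieldType) n (g h : 'M[F]_n) : g \in unitmx -> h \in unitmx ->
  invmx (g *m h) = invmx h *m invmx g.
Proof.
move=> gu hu; have ghu : g *m h \in unitmx by rewrite unitmx_mul gu.
apply: (can_inj (mulmxK ghu)); rewrite mulVmx // -!mulmxA (mulmxA _ g).
by rewrite mulVmx // mul1mx mulVmx.
Qed.

Section PolynomialFunctions.
Variables (F : fieldType) (n : nat).
Implicit Types (f g : 'M[F]_n -> F) (p q : mpoly.mpoly (n * n) F).

Definition polyfun f : Prop := exists p, forall x, mx_eval p x = f x.

Lemma polyfun_ext f g : f =1 g -> polyfun f -> polyfun g.
Proof. by move=> fg [p pf]; exists p => x; rewrite pf. Qed.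

Lemma polyfun_cst c : polyfun (fun=> c).
Proof. by exists (mpoly.mpolyC _ c) => x; rewrite /mx_eval mpoly.mevalC. Qed.

Lemma polyfun_entry i j : polyfun (fun x => x i j).
Proof.
exists (mpoly.mpolyX F (mpoly.mnm1 (mxvec_index i j))) => x.
by rewrite /mx_eval mpoly.mevalXU mxvecE.
Qed.

Lemma polyfunD f g : polyfun f -> polyfun g -> polyfun (fun x => f x + g x).
Proof.
by move=> [p pf] [q qg]; exists (p + q) => x; rewrite -pf -qg /mx_eval mpoly.mevalD.
Qed.

Lemma polyfunM f g : polyfun f -> polyfun g -> polyfun (fun x => f x * g x).
Proof.
by move=> [p pf] [q qg]; exists (p * q) => x; rewrite -pf -qg /mx_eval mpoly.mevalM.
Qed.

Lemma polyfun_sum (I : Type) (s : seq I) (f : I -> 'M[F]_n -> F) :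
  (forall i, polyfun (f i)) -> polyfun (fun x => \sum_(i <- s) f i x).
Proof.
move=> h; elim: s => [|i s IH].
  by apply: polyfun_ext (polyfun_cst 0) => x; rewrite big_nil.
by apply: polyfun_ext (polyfunD (h i) IH) => x; rewrite big_cons.
Qed.

Lemma polyfun_prod (I : Type) (s : seq I) (f : I -> 'M[F]_n -> F) :
  (forall i, polyfun (f i)) -> polyfun (fun x => \prod_(i <- s) f i x).
Proof.
move=> h; elim: s => [|i s IH].
  by apply: polyfun_ext (polyfun_cst 1) => x; rewrite big_nil.
by apply: polyfun_ext (polyfunM (h i) IH) => x; rewrite big_cons.
Qed.

Lemma polyfunX f e : polyfun f -> polyfun (fun x => f x ^+ e).
Proof.
move=> h; elim: e => [|e IH].
  by apply: polyfun_ext (polyfun_cst 1) => x; rewrite expr0.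
by apply: polyfun_ext (polyfunM h IH) => x; rewrite exprS.
Qed.

Lemma polyfun_det m (a : 'M[F]_n -> 'M[F]_m) :
  (forall i j, polyfun (fun x => a x i j)) -> polyfun (fun x => \det (a x)).
Proof.
move=> h; apply: polyfun_sum => s; apply: polyfunM; first exact: polyfun_cst.
exact: polyfun_prod.
Qed.

Lemma polyfun_mulmx m (a b : 'M[F]_n -> 'M[F]_m) :
  (forall i j, polyfun (fun x => a x i j)) ->
  (forall i j, polyfun (fun x => b x i j)) ->
  forall i j, polyfun (fun x => (a x *m b x) i j).
Proof.
move=> ha hb i j.
apply: (@polyfun_ext (fun x => \sum_k a x i k * b x k j)) => [x|]; first by rewrite mxE.
by apply: polyfun_sum => k; apply: polyfunM.
Qed.

Lemma polyfun_comp m (a : 'M[F]_n -> 'M[F]_m) (p : mpoly.mpoly (m * m) F) :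
  (forall i j, polyfun (fun x => a x i j)) -> polyfun (fun x => mx_eval p (a x)).
Proof.
move=> h; elim/mpoly_gen_ind: p => [c | i | p q Hp Hq | p q Hp Hq].
- by apply: polyfun_ext (polyfun_cst c) => x; rewrite /mx_eval mpoly.mevalC.
- case/mxvec_indexP: i => i j; apply: polyfun_ext (h i j) => x.
  by rewrite /mx_eval mpoly.mevalXU mxvecE.
- by apply: polyfun_ext (polyfunD Hp Hq) => x; rewrite /mx_eval mpoly.mevalD.
- by apply: polyfun_ext (polyfunM Hp Hq) => x; rewrite /mx_eval mpoly.mevalM.
Qed.

Lemma polyfun_translate (u v : 'M[F]_n) p :
  polyfun (fun x => mx_eval p (u *m x *m v)).
Proof.
apply: polyfun_comp; apply: polyfun_mulmx => i j; last exact: polyfun_cst.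
by apply: polyfun_mulmx => k l; [apply: polyfun_cst | apply: polyfun_entry].
Qed.

Lemma polyfun_adj i j : polyfun (fun x : 'M[F]_n => \adj x i j).
Proof.
apply: (@polyfun_ext (fun x => cofactor x j i)) => [x|]; first by rewrite mxE.
apply: polyfunM; first exact: polyfun_cst.
apply: polyfun_det => k l.
by apply: polyfun_ext (polyfun_entry (lift j k) (lift i l)) => x; rewrite !mxE.
Qed.

(** The inverse is the adjugate divided by the determinant, so a power of the determinant clears the
    denominators. *)
Lemma polyfun_inverse p : exists (q : mpoly.mpoly (n * n) F) (e : nat),
  forall x, x \in unitmx -> mx_eval q x = \det x ^+ e * mx_eval p (invmx x).
Proof.
have polydet : polyfun (fun x => \det x) by apply: polyfun_det; apply: polyfun_entry.
elim/mpoly_gen_ind: p => [c | i | p q [a [d Hp]] [b [e Hq]] | p q [a [d Hp]] [b [e Hq]]].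
- by exists (mpoly.mpolyC _ c), 0%N => x _; rewrite /mx_eval !mpoly.mevalC mul1r.
- case/mxvec_indexP: i => i j.
  have [q Dq] := polyfun_adj i j.
  exists q, 1%N => x xu; rewrite Dq /mx_eval mpoly.mevalXU mxvecE.
  have -> : invmx x i j = (\det x)^-1 * \adj x i j by rewrite /invmx xu [LHS]mxE.
  by rewrite mulrA expr1 divff ?mul1r // -unitfE -unitmxE.
- have [c Dc] : polyfun (fun x => \det x ^+ e * mx_eval a x + \det x ^+ d * mx_eval b x).
    by apply: polyfunD; apply: polyfunM; [apply: polyfunX | exists a | apply: polyfunX | exists b].
  exists c, (d + e)%N => x xu; rewrite Dc Hp // Hq // /mx_eval mpoly.mevalD exprD.
  by ring.
- exists (a * b), (d + e)%N => x xu.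
  rewrite [LHS]mpoly.mevalM -/(mx_eval a x) -/(mx_eval b x) Hp // Hq //.
  by rewrite /mx_eval mpoly.mevalM exprD; ring.
Qed.

End PolynomialFunctions.

Section ZariskiClosure.
Variables (F : fieldType) (n : nat).
Implicit Types (X G H : set 'M[F]_n).

Definition zclosure X : set 'M[F]_n := [set g | g \in unitmx /\
  forall p, (forall x, X x -> mx_eval p x = 0) -> mx_eval p g = 0].

Lemma zclosure_closed X : zariski_closed setT (zclosure X).
Proof. by exists [set p | forall x, X x -> mx_eval p x = 0]. Qed.

Lemma sub_zclosure X : (forall x, X x -> x \in unitmx) -> X `<=` zclosure X.
Proof. by move=> Xu x Xx; split=> [|p]; [apply: Xu | apply]. Qed.

Lemma zclosure_min (k : set F) X A : zariski_closed k A -> X `<=` A ->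
  zclosure X `<=` A.
Proof.
move=> [S _ ->] XA g [gu gX]; split=> // p Sp; apply: gX => x /XA[_]; exact.
Qed.

Lemma zclosure_map X (a : 'M[F]_n -> 'M[F]_n) :
  (forall p, polyfun (fun x => mx_eval p (a x))) ->
  (forall x, x \in unitmx -> a x \in unitmx) ->
  (forall x, X x -> zclosure X (a x)) ->
  forall x, zclosure X x -> zclosure X (a x).
Proof.
move=> pa ua Xa x [xu xX]; split=> [|p p0]; first exact: ua.
have [q Dq] := pa p; rewrite -Dq; apply: xX => y /Xa[_ /(_ p p0)].
by rewrite Dq.
Qed.

(** Products are treated in two stages: left translation by an element of [X] preserves the closure,
    hence right translation by an element of the closure sends [X] into the closure. *)
Lemma zclosure_group X : is_matrix_group X -> is_matrix_group (zclosure X).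
Proof.
move=> [Xu X1 XM XV]; have subX := sub_zclosure Xu.
have mul1 x h : X x -> zclosure X h -> zclosure X (x *m h).
  move=> Xx; apply: zclosure_map => [p | y yu | y Xy].
  - by apply: polyfun_ext (polyfun_translate x 1%:M p) => y; rewrite mulmx1.
  - by rewrite unitmx_mul Xu.
  - exact/subX/XM.
split=> [g [] // | | g h Hg | g [gu gX]]; first exact: subX.
- move=> Hh; move: g Hg; apply: zclosure_map => [p | y yu | y Xy].
  + by apply: polyfun_ext (polyfun_translate 1%:M h p) => y; rewrite mul1mx.
  + by rewrite unitmx_mul yu; case: Hh.
  + exact: mul1.
- split=> [|p p0]; first by rewrite unitmx_inv.
  have [q [e Dq]] := polyfun_inverse p.
  have det0 : \det g ^+ e != 0 by rewrite expf_neq0 // -unitfE -unitmxE.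
  apply: (mulfI det0); rewrite mulr0 -Dq //; apply: gX => x Xx.
  by rewrite Dq ?Xu // p0 ?mulr0 //; apply: XV.
Qed.

Lemma zclosure_normal X G : is_matrix_group G -> zclosure X `<=` G ->
  (forall x, X x -> x \in unitmx) ->
  (forall g x, G g -> X x -> X (g *m x *m invmx g)) ->
  normal_in G (zclosure X).
Proof.
move=> [Gu _ _ _] XG Xu nX; split=> // g h Gg; move: h; apply: zclosure_map => [p|y yu|y Xy].
- exact: polyfun_translate.
- by rewrite !unitmx_mul Gu // unitmx_inv yu Gu.
- by apply: sub_zclosure => //; apply: nX.
Qed.

Lemma zclosure_comm X : (forall x y, X x -> X y -> x *m y = y *m x) ->
  forall x y, zclosure X x -> zclosure X y -> x *m y = y *m x.
Proof.
move=> cX.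
have polycomm (y : 'M[F]_n) i j : polyfun (fun x => (x *m y) i j - (y *m x) i j).
  have h : polyfun (fun x => (x *m y) i j + -1 * (y *m x) i j).
    apply: polyfunD; first by apply: polyfun_mulmx => k l;
      [apply: polyfun_entry | apply: polyfun_cst].
    apply: polyfunM; first exact: polyfun_cst.
    by apply: polyfun_mulmx => k l; [apply: polyfun_cst | apply: polyfun_entry].
  by apply: polyfun_ext h => x; rewrite mulN1r.
have step (y : 'M[F]_n) : (forall x, X x -> x *m y = y *m x) ->
    forall x, zclosure X x -> x *m y = y *m x.
  move=> cy x [_ xX]; apply/matrixP => i j; apply/eqP; rewrite -subr_eq0; apply/eqP.
  by have [q Dq] := polycomm y i j; rewrite -Dq; apply: xX => z /cy E; rewrite Dq E subrr.
move=> x y Hx Hy; apply: (step) Hx => z Xz; symmetry.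
by apply: (step) Hy => t Xt; apply: cX.
Qed.

Definition group_span X : set 'M[F]_n := smallest (@is_matrix_group F n) X.

Lemma unit_matrix_group : is_matrix_group [set g : 'M[F]_n | g \in unitmx].
Proof.
split=> //= [|g h gu hu|g gu]; first exact: unitmx1.
  by rewrite unitmx_mul gu.
by rewrite unitmx_inv.
Qed.

Lemma group_span_min X G : is_matrix_group G -> X `<=` G -> group_span X `<=` G.
Proof. by move=> hG XG x; apply. Qed.

Lemma sub_group_span X : X `<=` group_span X.
Proof. by move=> x Xx G [_]; apply. Qed.

Lemma group_span_group X : (forall x, X x -> x \in unitmx) ->
  is_matrix_group (group_span X).
Proof.
move=> Xu; split=> [g | G [[]] // | g h Xg Xh G [hG XG] | g Xg G [hG XG]].
- exact: (group_span_min unit_matrix_group Xu).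
- by have [_ _ GM _] := hG; apply: GM; apply: (group_span_min hG XG).
- by have [_ _ _ GV] := hG; apply: GV; apply: (group_span_min hG XG).
Qed.

End ZariskiClosure.

(** * The normal subgroup generated by an element commuting with its conjugates *)

Section NormalClosure.
Variables (F : fieldType) (n : nat).
Implicit Types (X G H : set 'M[F]_n).

Lemma centralizer_group (y : 'M[F]_n) :
  is_matrix_group [set x | x \in unitmx /\ x *m y = y *m x].
Proof.
split=> [g [] // | | g h [gu gy] [hu hy] | g [gu gy]] /=.
- by rewrite unitmx1 mul1mx mulmx1.
- by rewrite unitmx_mul gu hu -mulmxA hy !mulmxA gy.
- rewrite unitmx_inv gu; split=> //.
  rewrite -[LHS]mulmx1 -(mulmxV gu) !mulmxA; congr (_ *m _).
  by rewrite -!mulmxA -gy !mulmxA mulVmx // mul1mx.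
Qed.

Lemma solvable_commutative H : is_matrix_group H ->
  (forall x y, H x -> H y -> x *m y = y *m x) -> solvable_group H.
Proof.
move=> [Hu _ _ _] cH; exists 1%N => /=; apply: group_span_min.
  split=> [g -> | // | g h -> -> | g ->] /=; rewrite ?unitmx1 ?mulmx1 ?invmx1 //.
move=> _ [g [h [Hg Hh ->]]] /=; rewrite (cH _ _ Hg Hh) -(mulmxA h).
by rewrite mulmxV ?Hu // mulmx1 mulmxV ?Hu.
Qed.

Section Conjugates.
Variables (k : set F) (G : set 'M[F]_n) (s : 'M[F]_n).
Hypotheses (hG : semisimple_group k G) (Gs : G s).
Hypothesis comm_s : forall g, G g ->
  s *m (g *m s *m invmx g) = g *m s *m invmx g *m s.
(** Irreducibility of the Zariski closure of every translated sequence of powers of [s]. *)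
Hypothesis irr_s : forall (a b : 'M[F]_n) p q,
  (forall i : nat, mx_eval p (a *m s ^+ i *m b) * mx_eval q (a *m s ^+ i *m b) = 0) ->
  (forall i : nat, mx_eval p (a *m s ^+ i *m b) = 0) \/
  (forall i : nat, mx_eval q (a *m s ^+ i *m b) = 0).

Let X := [set x | exists2 g, G g & x = g *m s *m invmx g].
Let N := group_span X.

Let groupG : is_matrix_group G. Proof. by case: hG => [[]]. Qed.
Let Gu g : G g -> g \in unitmx. Proof. by case: groupG => h _ _ _ /h. Qed.
Let G1 : G 1%:M. Proof. by case: groupG. Qed.
Let GM g h : G g -> G h -> G (g *m h).
Proof. by case: groupG => _ _ h' _; apply: h'. Qed.
Let GV g : G g -> G (invmx g). Proof. by case: groupG => _ _ _ h'; apply: h'. Qed.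

Let XG : X `<=` G.
Proof. by move=> _ [g Gg ->]; apply: GM; [apply: GM | apply: GV]. Qed.

Let groupN : is_matrix_group N.
Proof. by apply: group_span_group => x /XG/Gu. Qed.

Let NG : N `<=` G. Proof. exact: group_span_min. Qed.

Let normalN g x : G g -> N x -> N (g *m x *m invmx g).
Proof.
move=> Gg; have [Nu N1 NM NV] := groupN; have gu := Gu Gg.
pose A := [set y | y \in unitmx /\ N (g *m y *m invmx g)].
suff hA : is_matrix_group A.
  have XA : X `<=` A.
    move=> y Xy; split; first exact/Gu/XG.
    apply: sub_group_span; have [h Gh ->] := Xy.
    exists (g *m h); first exact: GM.
    by rewrite invmxM ?Gu // !mulmxA.
  by move=> Nx; have [] := group_span_min hA XA Nx.
split=> [y [] // | | y z [yu Ny] [zu Nz] | y [yu Ny]] /=.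
- by split; rewrite ?unitmx1 // mulmx1 mulmxV.
- split; rewrite ?unitmx_mul ?yu //.
  have -> : g *m (y *m z) *m invmx g = (g *m y *m invmx g) *m (g *m z *m invmx g).
    by rewrite -!mulmxA (mulmxA (invmx g) g) mulVmx // mul1mx.
  exact: NM.
- split; rewrite ?unitmx_inv //.
  have -> : g *m invmx y *m invmx g = invmx (g *m y *m invmx g).
    by rewrite !invmxM ?unitmx_mul ?unitmx_inv ?gu // invmxK mulmxA.
  exact: NV.
Qed.

Let commN x y : N x -> N y -> x *m y = y *m x.
Proof.
have commX u v : X u -> X v -> u *m v = v *m u.
  move=> [g Gg ->] [h Gh ->]; have gu := Gu Gg; have hu := Gu Gh.
  (* Conjugating by [g] reduces two arbitrary conjugates of [s] to [s] itself and one conjugate. *)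
  have := comm_s (GM (GV Gg) Gh); rewrite invmxM ?unitmx_inv // invmxK.
  move=> /(congr1 (fun z => g *m z *m invmx g)).
  by rewrite !mulmxA mulmxK // mulmxV // mul1mx.
have comm1 u v : N u -> X v -> u *m v = v *m u.
  move=> Nu Xv; have XC : X `<=` [set x | x \in unitmx /\ x *m v = v *m x].
    by move=> w Xw; split; [apply/Gu/XG | apply: commX].
  by have [] := group_span_min (centralizer_group v) XC Nu.
move=> Nx Ny; have XC : X `<=` [set u | u \in unitmx /\ u *m x = x *m u].
  by move=> w Xw; split; [apply/Gu/XG | rewrite comm1].
by have [] := group_span_min (centralizer_group x) XC Ny.
Qed.

(* Translating by a generator g s g^-1 cannot separate N: y and y g s g^-1 both
   lie in the irreducible set of the y g s^i g^-1, the first two of its points. *)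
Let connectedN : zariski_connected (zclosure N).
Proof.
have [Nu N1 NM NV] := groupN.
have NH : N `<=` zclosure N by apply: sub_zclosure.
move=> A B cA cB HAB AB0.
have NAB x : N x -> A x \/ B x by move=> /NH/HAB.
have NAB0 x : N x -> A x -> B x -> False.
  move=> Nx Ax Bx; have : (zclosure N `&` A `&` B) x by split=> //; split=> //; apply: NH.
  by rewrite AB0.
(* The right translations of [N] that preserve [A] form a group, so it suffices to treat the
   generators [X]. *)
pose S := [set x | N x /\ forall y, N y -> (A y <-> A (y *m x))].
have hS : is_matrix_group S.
  split=> [x [/Nu] // | | x y [Nx Sx] [Ny Sy] | x [Nx Sx]] /=.
  - by split=> // y _; rewrite mulmx1.
  - split=> [|z Nz]; first exact: NM.
    by rewrite mulmxA; apply: iff_trans (Sx z Nz) (Sy _ _); apply: NM.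
  - split=> [|z Nz]; first exact: NV.
    have Nzx : N (z *m invmx x) by apply: NM => //; apply: NV.
    by have := Sx _ Nzx; rewrite mulmxKV ?Nu // => h; apply: iff_sym.
have XS : X `<=` S.
  move=> x Xx; have Nx : N x by apply: sub_group_span.
  split=> // y Ny; have [g Gg Dx] := Xx; have gu := Gu Gg.
  pose c (i : nat) := (y *m g) *m s ^+ i *m invmx g.
  have c0 : c 0%N = y by rewrite /c expr0 mulmx1 mulmxK.
  have cS i : c i.+1 = c i *m x.
    rewrite /c Dx exprSr; rewrite -[_ * s]/(_ *m s) !mulmxA.
    by rewrite mulmxKV // !mulmxA.
  have Nc i : N (c i) by elim: i => [|i IH]; rewrite ?c0 // cS; apply: NM.
  have c1 : c 1%N = y *m x by rewrite cS c0.
  have [SA _ DA] := cA; have [SB _ DB] := cB.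
  have [allA | notA] := pselect (forall i, A (c i)).
    by rewrite -c1 -c0; split=> _; apply: allA.
  have [allB | notB] := pselect (forall i, B (c i)).
    by rewrite -c1 -c0; split=> Ac; case: (NAB0 _ (Nc _) Ac (allB _)).
  (* An equation [p] of [A] fails at [c i] and an equation [q] of [B] fails at [c j], but their
     product vanishes at every [c l] because [A] and [B] cover [N]. This contradicts [irr_s]. *)
  exfalso; move: notA notB => /existsNP[i nAi] /existsNP[j nBj].
  have [p SAp pi0] : exists2 p, SA p & mx_eval p (c i) != 0.
    apply: contrapT => h; apply: nAi; rewrite DA; split; first by apply: Nu; apply: Nc.
    by move=> p SAp; apply/eqP/negPn/negP => p0; apply: h; exists p.
  have [q SBq qj0] : exists2 q, SB q & mx_eval q (c j) != 0.
    apply: contrapT => h; apply: nBj; rewrite DB; split; first by apply: Nu; apply: Nc.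
    by move=> q SBq; apply/eqP/negPn/negP => q0; apply: h; exists q.
  have [l | h | h] := @irr_s (y *m g) (invmx g) p q.
  - have [] := NAB _ (Nc l); rewrite ?DA ?DB => -[_ h].
      by rewrite -/(c l) h // mul0r.
    by rewrite -/(c l) (h q) // mulr0.
  - by move: pi0; rewrite -[c i]/(_ *m _ *m _) h eqxx.
  - by move: qj0; rewrite -[c j]/(_ *m _ *m _) h eqxx.
have NS := group_span_min hS XS.
have AE x : N x -> (A 1%:M <-> A x).
  by move=> /NS[_ /(_ _ N1)]; rewrite mul1mx.
have [A1 | nA1] := pselect (A 1%:M).
  by left; apply: zclosure_min cA _ => x Nx; apply/(AE _ Nx).
right; apply: zclosure_min cB _ => x Nx.
by have [/(AE _ Nx) | ] := NAB x Nx.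
Qed.

(* The closure of the group generated by the conjugates of s is normal,
   commutative and connected, so it lies in the trivial radical of G. *)
Theorem commuting_conjugates_trivial : s = 1%:M.
Proof.
have [[_ cG] _ rad] := hG; have [Nu N1 _ _] := groupN.
have HG : zclosure N `<=` G by apply: zclosure_min cG NG.
have groupH := zclosure_group groupN.
have Ns : N s.
  by apply: sub_group_span; exists 1%:M; rewrite // mul1mx invmx1 mulmx1.
apply: (rad (zclosure N)).
- by split=> //; apply: zclosure_closed.
- exact: connectedN.
- exact: zclosure_normal.
- apply: solvable_commutative => // x y; apply: zclosure_comm => u v; exact: commN.
- exact: sub_zclosure.
Qed.

End Conjugates.
End NormalClosure.

(** * Lie algebra, roots and the hyperbolic part *)

Section CommonEigenvector.

Lemma subspace_mx (F : fieldType) m (S : set 'rV[F]_m) : S 0 ->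
  (forall a u v, S u -> S v -> S (a *: u + v)) ->
  exists U : 'M[F]_m, forall u, S u <-> (u <= U)%MS.
Proof.
move=> S0 SD.
pose P r := `[< exists2 U : 'M[F]_m, (forall u : 'rV_m, (u <= U)%MS -> S u) & \rank U = r >].
have exP : exists r, P r.
  exists 0%N; apply/asboolP; exists 0; rewrite ?mxrank0 // => u.
  by rewrite submx0 => /eqP->.
have leP r : P r -> (r <= m)%N by move=> /asboolP[U _ <-]; apply: rank_leq_row.
case: (ex_maxnP exP leP) => r /asboolP[U US rU] max.
exists U => u; split=> [Su | /US //].
have : P (\rank (U + u)%MS).
  apply/asboolP; exists (U + u)%MS => // w /sub_addsmxP[[a b] /= ->].
  have /sub_rVP[c ->] : (b *m u <= u)%MS by apply: submxMl.
  by rewrite addrC; apply: SD => //; apply: US; apply: submxMl.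
have leif := mxrank_leqif_sup (addsmxSl U u).
move=> /max; rewrite -rU => le_r.
have : \rank U == \rank (U + u)%MS by rewrite eqn_leq leif.1.
by rewrite leif.2 addsmx_sub => /andP[].
Qed.

(** Induction on the rank of [U]. If all matrices act on [U] as scalars, any nonzero vector will do;
    otherwise some eigenspace of a non-scalar one cuts out a smaller nonzero subspace, stable by
    commutation. *)
Lemma common_eigenvector_set (C : numClosedFieldType) m (Ts : set 'M[C]_m)
    (U : 'M[C]_m) :
  (forall A B, Ts A -> Ts B -> comm_mx A B) ->
  (forall A, Ts A -> stablemx U A) -> U != 0 ->
  exists u : 'rV_m, [/\ u != 0, (u <= U)%MS & forall A, Ts A -> stablemx u A].
Proof.
move=> cTs; have [r] := ubnP (\rank U); elim: r U => // r IH U leU stU U0.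
have [scal | nscal] := pselect (forall A, Ts A -> exists c, U *m A = c *: U).
  have [u uU u0] : exists2 u : 'rV_m, (u <= U)%MS & u != 0 by apply/rowV0Pn.
  exists u; split=> // A /scal[c Uc]; have /submxP[w ->] := uU.
  by rewrite -mulmxA Uc -scalemxAr scalemx_sub.
move: nscal => /existsNP[A /not_implyP[TA nA]].
have [|a /eigenvalueP[w wa w0]] := eigenvalue_closed (restrictmx U A).
  by rewrite lt0n mxrank_eq0.
pose v := w *m row_base U.
have v0 : v != 0 by rewrite mulmx_free_eq0 ?row_base_free.
have vU : (v <= U)%MS by rewrite -(eq_row_base U) submxMl.
have vA : v *m A = a *: v.
  have rbA : row_base U *m A = restrictmx U A *m row_base U.
    rewrite [RHS]mulmxKpV // (eqmxMr _ (eq_row_base U)) (eq_row_base U).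
    exact: stU.
  by rewrite /v -mulmxA rbA mulmxA wa scalemxAl.
pose E := (U :&: eigenspace A a)%MS.
have vE : (v <= E)%MS by rewrite sub_capmx vU /=; apply/eigenspaceP.
have [|||u [u0 uE uT]] := IH E.
- rewrite -ltnS; apply: leq_trans leU; rewrite ltnS ltn_neqAle mxrankS ?capmxSl // andbT.
  rewrite (mxrank_leqif_sup (capmxSl _ _)).2 sub_capmx submx_refl /=.
  by apply/negP => /eigenspaceP UA; apply: nA; exists a.
- move=> B TB; rewrite sub_capmx.
  rewrite (submx_trans (submxMr _ (capmxSl _ _))) ?stU //=.
  rewrite (submx_trans (submxMr _ (capmxSr _ _))) //.
  exact/comm_mx_stable_eigenspace/cTs.
- by apply: contraNneq v0 => E0; move: vE; rewrite E0 submx0.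
by exists u; split=> //; apply: submx_trans uE (capmxSl _ _).
Qed.

End CommonEigenvector.

(** * Exponential sums with positive bases *)

Section Positive.
Variable C : numClosedFieldType.

(** The order on [C] is partial, but any two positive elements are comparable. *)
Lemma positive_max (s : seq C) (p : pred C) : (forall v, v \in s -> 0 < v) ->
  has p s -> exists V, [/\ V \in s, p V & forall v, v \in s -> p v -> v <= V].
Proof.
elim: s => //= a s IH pos.
have pos' v : v \in s -> 0 < v by move=> vs; apply: pos; rewrite inE vs orbT.
have a_gt0 : 0 < a by apply: pos; rewrite mem_head.
have [hs _ | /hasPn nh] := boolP (has p s).
  have [V [Vs pV maxV]] := IH pos' hs.
  have [/andP[pa Va] | na] := boolP (p a && (V <= a)).
    exists a; split=> [||v]; rewrite ?mem_head // inE => /predU1P[-> // | vs pv].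
    exact: le_trans (maxV v vs pv) Va.
  exists V; split=> [||v]; rewrite ?inE ?Vs ?orbT //.
  case/predU1P => [-> pa | vs pv]; last exact: maxV.
  have := ger_leVge (ltW a_gt0) (ltW (pos' V Vs)) => /orP[// | Va].
  by move: na; rewrite pa Va.
rewrite orbF => pa; exists a; split=> [||v]; rewrite ?mem_head // inE.
by case/predU1P => [-> // | /nh/negP nv pv]; case: nv.
Qed.

(** The total coefficient of the base [v], as bases may be repeated in [l]. *)
Definition coefsum (l : seq (C * C)) v := expsum l (fun w => (w == v)%:R).

Lemma expsum_collect l f :
  expsum l f = \sum_(v <- undup [seq t.2 | t <- l]) coefsum l v * f v.
Proof.
rewrite /coefsum /expsum; under [RHS]eq_bigr do rewrite mulr_suml.
rewrite exchange_big /= big_seq [RHS]big_seq; apply: eq_bigr => t tl.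
rewrite (bigD1_seq t.2) ?undup_uniq ?mem_undup ?map_f //= eqxx mulr1.
by rewrite big1 ?addr0 // => v /negbTE nv; rewrite eq_sym nv mulr0 mul0r.
Qed.

(* The product of the leading terms of two exponential polynomials with positive
   bases is the leading term of the product. *)
Lemma exponential_irreducible nu Phi Psi d e :
  exponential [set v : C | 0 < v] nu Phi d ->
  exponential [set v : C | 0 < v] nu Psi e ->
  (forall k : nat, Phi (fun v => v ^+ k) * Psi (fun v => v ^+ k) = 0) ->
  (forall k : nat, Phi (fun v => v ^+ k) = 0) \/
  (forall k : nat, Psi (fun v => v ^+ k) = 0).
Proof.
move=> [l [Ql Dl _]] [m [Qm Dm _]] PP0.
pose U l := undup [seq t.2 | t <- l : seq (C * C)].
pose nz l v := coefsum l v != 0.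
have zero l' : ~~ has (nz l') (U l') -> forall f, expsum l' f = 0.
  move=> /hasPn h f; rewrite expsum_collect big_seq big1 // => v /h.
  by rewrite negbK => /eqP->; rewrite mul0r.
have [hl | /zero l0] := boolP (has (nz l) (U l)); last first.
  by left=> k; rewrite Dl ?l0 //; apply: mult_funX.
have [hm | /zero m0] := boolP (has (nz m) (U m)); last first.
  by right=> k; rewrite Dm ?m0 //; apply: mult_funX.
have posU l' : (forall t, t \in l' -> 0 < t.2) -> forall v, v \in U l' -> 0 < v.
  by move=> Q v; rewrite mem_undup => /mapP[t /Q ? ->].
have [V [Vl nzV maxV]] := positive_max (posU l Ql) hl.
have [W [Wm nzW maxW]] := positive_max (posU m Qm) hm.
pose lm := [seq (t.1 * u.1, t.2 * u.2) | t <- l, u <- m].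
have lmE f : expsum lm f = \sum_(t <- l) t.1 * expsum m (fun w => f (t.2 * w)).
  rewrite /expsum /lm big_allpairs_dep; apply: eq_bigr => t _.
  by rewrite mulr_sumr; apply: eq_bigr => u _; rewrite mulrA.
have lm0 k : expsum lm (fun v => v ^+ k) = 0.
  rewrite lmE -[RHS](PP0 k) Dl ?Dm; [| exact: mult_funX | exact: mult_funX].
  rewrite /expsum mulr_suml; apply: eq_bigr => t _; rewrite -mulrA; congr (_ * _).
  by rewrite mulr_sumr; apply: eq_bigr => u _; rewrite exprMn mulrCA.
(* The indicator of [V * W] extracts the leading coefficient of the product; no other pair of bases
   with nonzero coefficients reaches this maximal product. *)
have := expsum_vanish (fun w => (w == V * W)%:R) lm0; rewrite lmE.
rewrite -/(expsum l (fun v => expsum m (fun w => (v * w == V * W)%:R))).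
rewrite expsum_collect (bigD1_seq V) ?undup_uniq //= big1_seq ?addr0; last first.
  move=> v /andP[nvV vl]; have [-> | nzv] := eqVneq (coefsum l v) 0; rewrite ?mul0r //.
  rewrite [expsum m _]expsum_collect big1_seq ?mulr0 // => w /andP[_ wm].
  have [-> | nzw] := eqVneq (coefsum m w) 0; rewrite ?mul0r //.
  rewrite (_ : v * w == V * W = false) ?mulr0 //; apply/lt_eqF.
  have wW : w <= W by apply: maxW.
  have vV : v < V by rewrite lt_neqAle nvV maxV.
  have v_gt0 := posU l Ql v vl; have W_gt0 := posU m Qm W Wm.
  by apply: (@le_lt_trans _ _ (v * W)); rewrite ?ler_pM2l ?ltr_pM2r.
rewrite expsum_collect (bigD1_seq W) ?undup_uniq //= eqxx mulr1 big1_seq; last first.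
  move=> w /andP[nwW wm]; have V0 : V != 0 by rewrite gt_eqF // (posU l Ql).
  by rewrite (inj_eq (mulfI V0)) (negbTE nwW) mulr0.
by rewrite addr0 => /eqP; rewrite mulf_eq0 (negbTE nzV) (negbTE nzW).
Qed.

End Positive.

Section DirectionalDerivative.
Variable F : numFieldType.

Lemma poly_vanish (p : {poly F}) : (forall x, p.[x] = 0) -> p = 0.
Proof.
move=> p0; apply/eqP/negPn/negP => nz.
have := max_poly_roots nz (rs := [seq i%:R | i <- iota 0 (size p)]).
rewrite size_map size_iota ltnn; move=> h; suff: false by []; apply: h.
  by apply/allP => x _; apply/rootP.
by rewrite map_inj_uniq ?iota_uniq //; apply: mulrIn; apply: oner_neq0.
Qed.

Lemma mpoly_line N (p : mpoly.mpoly N F) (a x : 'I_N -> F) : exists q : {poly F},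
  (forall e, q.[e] = mpoly.meval (fun i => a i + e * x i) p) /\
  q`_1 = \sum_i mpoly.meval a (mpoly.mderiv i p) * x i.
Proof.
elim/mpoly_gen_ind: p => [c | i | p q [P [HP dP]] [Q [HQ dQ]] | p q [P [HP dP]] [Q [HQ dQ]]].
- exists c%:P; split=> [e|]; first by rewrite hornerC mpoly.mevalC.
  by rewrite coefC big1 // => i _; rewrite mpoly.mderivC mpoly.meval0 mul0r.
- exists ((a i)%:P + x i *: 'X); split=> [e|].
    by rewrite !hornerE mpoly.mevalXU mulrC.
  rewrite coefD coefC coefZ coefX add0r mulr1.
  rewrite (bigD1 i) //= big1 => [|j ji]; rewrite mpoly.mderivX mpoly.mevalZ mpoly.mnm1E.
    rewrite eqxx mul1r addr0 -[LHS]mul1r; congr (_ * _).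
    suff -> : mpoly.mnm_sub (mpoly.mnm1 i) (mpoly.mnm1 i) = mpoly.mnm0.
      by rewrite mpoly.mpolyX0 mpoly.meval1.
    by apply/mpoly.mnmP => j; rewrite mpoly.mnmBE mpoly.mnm0E subnn.
  by rewrite eq_sym (negbTE ji) !mul0r.
- exists (P + Q); split=> [e|]; first by rewrite hornerD HP HQ mpoly.mevalD.
  rewrite coefD dP dQ -big_split; apply: eq_bigr => i _.
  by rewrite mpoly.mderivD mpoly.mevalD mulrDl.
- exists (P * Q); split=> [e|]; first by rewrite hornerM HP HQ mpoly.mevalM.
  have E0 (r : mpoly.mpoly N F) (S : {poly F}) :
      (forall e, S.[e] = mpoly.meval (fun i => a i + e * x i) r) ->
      S`_0 = mpoly.meval a r.
    move=> HS; rewrite -horner_coef0 HS; apply: mpoly.meval_eq => i.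
    by rewrite mul0r addr0.
  rewrite coefM !big_ord_recl big_ord0 addr0 /= dP dQ (E0 p) // (E0 q) //.
  rewrite mulr_sumr mulr_suml -big_split; apply: eq_bigr => i _ /=.
  by rewrite mpoly.mderivM mpoly.mevalD !mpoly.mevalM; ring.
Qed.

Variable n : nat.
Implicit Types (G : set 'M[F]_n) (X Y t : 'M[F]_n).

Lemma mxvec_linear a X Y i :
  mxvec (a *: X + Y) 0 i = a * mxvec X 0 i + mxvec Y 0 i.
Proof. by case/mxvec_indexP: i => i j; rewrite !mxvecE !mxE. Qed.

Lemma mx_eval_line p X : exists q : {poly F},
  (forall e, q.[e] = mx_eval p (1%:M + e *: X)) /\
  q`_1 = \sum_i mx_eval (mpoly.mderiv i p) 1%:M * mxvec X 0 i.
Proof.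
have [q [Hq dq]] := mpoly_line p (fun i => mxvec (1%:M : 'M[F]_n) 0 i) (fun i => mxvec X 0 i).
exists q; split=> // e; rewrite Hq; apply: mpoly.meval_eq => i.
by rewrite [in RHS]addrC mxvec_linear addrC.
Qed.

Lemma lie_algebra0 G : lie_algebra G 0.
Proof. by move=> p _; rewrite big1 // => i _; rewrite raddf0 mxE mulr0. Qed.

Lemma lie_algebraD G a X Y : lie_algebra G X -> lie_algebra G Y ->
  lie_algebra G (a *: X + Y).
Proof.
move=> LX LY p p0.
transitivity (a * \sum_i mx_eval (mpoly.mderiv i p) 1%:M * mxvec X 0 i +
   \sum_i mx_eval (mpoly.mderiv i p) 1%:M * mxvec Y 0 i).
  rewrite mulr_sumr -big_split; apply: eq_bigr => i _ /=.
  by rewrite mxvec_linear; ring.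
by rewrite LX // LY // mulr0 addr0.
Qed.

Lemma lie_algebra_sum G (I : Type) (s : seq I) (X : I -> 'M[F]_n) (c : I -> F) :
  (forall i, lie_algebra G (X i)) ->
  lie_algebra G (\sum_(i <- s) c i *: X i).
Proof.
move=> h; apply: (big_ind (lie_algebra G)); first exact: lie_algebra0.
  by move=> A B LA LB; rewrite -[A]scale1r; apply: lie_algebraD.
by move=> i _; rewrite -[_ *: _]addr0; apply: lie_algebraD => //; apply: lie_algebra0.
Qed.

(** Composing [p] with conjugation by [t] gives another polynomial [q] vanishing on [G]; restricted
    to lines through 1, the two have equal derivatives in the corresponding directions. *)
Lemma lie_algebra_conj G t X : is_matrix_group G -> G t -> lie_algebra G X ->
  lie_algebra G (t *m X *m invmx t).
Proof.
move=> [Gu _ GM GV] Gt LX p p0; have tu := Gu _ Gt.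
have [q Dq] := polyfun_translate t (invmx t) p.
have [P [HP <-]] := mx_eval_line p (t *m X *m invmx t).
have [Q [HQ dQ]] := mx_eval_line q X.
suff -> : P = Q.
  by rewrite dQ; apply: LX => g Gg; rewrite Dq p0 //; exact: (GM _ _ (GM _ _ Gt Gg) (GV _ Gt)).
apply/eqP; rewrite -subr_eq0; apply/eqP/poly_vanish => e.
rewrite hornerD hornerN HP HQ Dq mulmxDr mulmxDl mulmx1 mulmxV //.
by rewrite -scalemxAr -scalemxAl subrr.
Qed.

End DirectionalDerivative.

Section WeightVectors.
Variables (C : numClosedFieldType) (n : nat).
Implicit Types (G T : set 'M[C]_n).

(** The [v]-eigenspace of the adjoint action of [g0] on the Lie algebra is stable under the
    commutative group [T]. A common eigenvector in it has a weight with value [v] at [g0], and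
    [v != 1] makes this weight nontrivial. *)
Lemma root_of_eigenvector G T g0 (X : 'M[C]_n) v :
  is_matrix_group G -> is_matrix_group T -> T `<=` G ->
  (forall t u, T t -> T u -> t *m u = u *m t) -> T g0 ->
  lie_algebra G X -> X != 0 -> g0 *m X *m invmx g0 = v *: X -> v != 1 ->
  exists2 alpha, Defs.roots G T alpha & alpha g0 = v.
Proof.
move=> hG [Tu T1 TM TV] TG cT Tg0 LX X0 g0X v1.
pose ad (t Z : 'M[C]_n) := t *m Z *m invmx t.
pose S := [set u : 'rV[C]_(n * n) | lie_algebra G (vec_mx u) /\
  ad g0 (vec_mx u) = v *: vec_mx u].
have [|a u w [Lu gu] [Lw gw]|U SU] := @subspace_mx _ _ S.
- by rewrite /S /= raddf0 /ad mulmx0 mul0mx scaler0; split=> //; apply: lie_algebra0.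
- rewrite /S /= linearP; split; first exact: lie_algebraD.
  rewrite /ad mulmxDr mulmxDl -scalemxAr -scalemxAl -/(ad g0 (vec_mx u)) gu.
  by rewrite -/(ad g0 (vec_mx w)) gw scalerDr !scalerA [a * v]mulrC.
pose Ad t := lin_mx (mulmxr (invmx t) \o mulmx t) : 'M[C]_(n * n).
have AdE t u : u *m Ad t = mxvec (ad t (vec_mx u)) by rewrite mul_rV_lin.
have adM s t Z : T s -> T t -> ad s (ad t Z) = ad (s *m t) Z.
  by move=> Ts Tt; rewrite /ad invmxM ?Tu // !mulmxA.
have adC s t Z : T s -> T t -> ad s (ad t Z) = ad t (ad s Z).
  by move=> Ts Tt; rewrite !adM // cT.
have S_ad t u : T t -> S u -> S (mxvec (ad t (vec_mx u))).
  move=> Tt [Lu gu]; rewrite /S /= mxvecK; split.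
    by apply: lie_algebra_conj => //; apply: TG.
  by rewrite adC // gu /ad -scalemxAr -scalemxAl.
have [||| u [u0 uU Tu0]] := @common_eigenvector_set C _ [set Ad t | t in T] U.
- move=> _ _ [s Ts <-] [t Tt <-]; apply/row_matrixP => i.
  by rewrite !rowE !mulmxA !AdE !mxvecK adC.
- move=> _ [t Tt <-]; apply/row_subP => i; apply/SU.
  by rewrite row_mul AdE; apply: S_ad => //; apply/SU/row_sub.
- have /SU : S (mxvec X) by rewrite /S /= mxvecK.
  by apply: contraTneq => ->; rewrite submx0 mxvec_eq0.
have [Lu gu] := (SU u).2 uU.
pose Z := vec_mx u; have Z0 : Z != 0 by rewrite vec_mx_eq0.
have eig t : T t -> exists c, ad t Z = c *: Z.
  move=> Tt; have /sub_rVP[c Dc] : (u *m Ad t <= u)%MS by apply: Tu0; exists t.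
  by exists c; rewrite -[ad t Z]mxvecK -AdE Dc linearZ.
rewrite -/Z in Lu gu; clearbody Z.
have [i [j Zij]] : exists i j, Z i j != 0.
  apply: contrapT => h; move/eqP: Z0; apply; apply/matrixP => i j; rewrite mxE.
  by apply/eqP/negPn/negP => Zij; apply: h; exists i, j.
(* The weight is read off at a nonzero entry of [Z], which also shows that it is regular. *)
pose alpha t := if `[< T t >] then ad t Z i j / Z i j else 0.
have alphaE t : T t -> ad t Z = alpha t *: Z.
  move=> Tt; rewrite /alpha; case: asboolP => // _.
  by have [c Dc] := eig t Tt; rewrite Dc mxE mulfK.
have alpha_g0 : alpha g0 = v.
  have := alphaE _ Tg0; rewrite gu => /(congr1 (fun A : 'M[C]_n => A i j)).
  by rewrite !mxE => /(mulIf Zij).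
exists alpha => //; split.
- split=> [|t Tt|s t Ts Tt|t nTt].
  + have [p Dp] : polyfun (fun t => (t *m Z *m \adj t) i j * (Z i j)^-1).
      apply: polyfunM; last exact: polyfun_cst.
      apply: polyfun_mulmx => k l; last exact: polyfun_adj.
      by apply: polyfun_mulmx => a b; [apply: polyfun_entry | apply: polyfun_cst].
    exists p, 1%N => t Tt; rewrite /alpha; case: asboolP => // _; rewrite Dp expr1.
    have -> : ad t Z i j = (\det t)^-1 * (t *m Z *m \adj t) i j.
      by rewrite /ad /invmx Tu // -scalemxAr [LHS]mxE.
    by rewrite [RHS]mulrC mulrA.
  + apply: contraNneq Z0 => at0; have := alphaE _ Tt; rewrite at0 scale0r => adt.
    have -> : Z = invmx t *m ad t Z *m t.
      by rewrite /ad !mulmxA mulVmx ?Tu // mul1mx mulmxKV ?Tu.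
    by rewrite adt mulmx0 mul0mx.
  + have := alphaE _ (TM _ _ Ts Tt); rewrite -adM // (alphaE t) //.
    rewrite {1}/ad -scalemxAr -scalemxAl -/(ad s Z) (alphaE s) // scalerA.
    move=> /(congr1 (fun A : 'M[C]_n => A i j)); rewrite !mxE => /(mulIf Zij) <-.
    exact: mulrC.
  + by rewrite /alpha; case: asboolP.
- by exists g0 => //; rewrite alpha_g0; apply/eqP.
- by exists Z; split=> //; apply/eqP.
Qed.

End WeightVectors.

(** * The hyperbolic part of an element with roots of modulus 1 *)

Section HyperbolicPart.
Variables (C : numClosedFieldType) (nu : C -> C).
Let Q := [set v : C | v != 0].
(** [nu] stands for the logarithm of the modulus, with values in [C]. *)
Hypotheses (nu1 : nu 1 = 0)
  (nuM : forall v w, Q v -> Q w -> nu (v * w) = nu v + nu w)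
  (nu_norm : forall v w, Q v -> Q w -> nu v = nu w <-> `|v| = `|w|).

Let Q1 : Q 1. Proof. exact: oner_neq0. Qed.
Let QM v w : Q v -> Q w -> Q (v * w). Proof. exact: mulf_neq0. Qed.
Let nuV v : Q v -> nu v^-1 = - nu v.
Proof.
move=> v0; apply/eqP; rewrite -addr_eq0 -nuM ?mulVf ?nu1 //.
by rewrite /Q /= invr_eq0.
Qed.

Variables (n : nat) (k : set C) (G : set 'M[C]_n) (P : 'M[C]_n) (D : 'rV[C]_n).
Hypotheses (hG : semisimple_group k G) (Pu : P \in unitmx)
  (D0 : forall i, D 0 i != 0) (Gg0 : G (diagcalc P D id)).

Let groupG : is_matrix_group G. Proof. by case: hG => [[]]. Qed.
Let Gu g : G g -> g \in unitmx. Proof. by case: groupG => h _ _ _ /h. Qed.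
Let GM g h : G g -> G h -> G (g *m h).
Proof. by case: groupG => _ _ h' _; apply: h'. Qed.
Let GV g : G g -> G (invmx g). Proof. by case: groupG => _ _ _ h'; apply: h'. Qed.

Let g0X i : G (diagcalc P D (fun v => v ^+ i)).
Proof.
rewrite -(diagcalcX D Pu i id); elim: i => [|i IH].
  by rewrite expr0; case: groupG.
by rewrite exprS; apply: GM.
Qed.

Definition hyperbolic_part := diagcalc P D Num.norm.

Let mult_norm : mult_fun (Num.norm : C -> C).
Proof. by split=> [|v w]; [apply: normr1 | apply: normrM]. Qed.

(** The equations of [G] vanish at all powers of the given element, hence at every multiplicative
    function of its eigenvalues, in particular at the modulus. *)
Lemma hyperbolic_part_mem : G hyperbolic_part.
Proof.
have [[_ [S _ DG]] _ _] := hG; rewrite DG; split=> [|p Sp].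
  by apply: diagcalc_unit => // i; rewrite normr_eq0.
have hD : exponential_mx Q nu (diagcalc P D) (diagcalc P D nu).
  exact: exponential_diagcalc.
have h0 i : mx_eval p (diagcalc P D (fun v => v ^+ i)) = 0.
  by have := g0X i; rewrite DG => -[_ ->].
have [h _] := exponential_vanish (exponential_mx_eval Q1 QM nu1 nuM p hD) h0.
exact: h.
Qed.

(* This is the derivative at 0 of the one-parameter family of commutators
   g0^t g g0^-t g^-1, whose integral members lie in G. *)
Lemma log_conj_lie_algebra g : G g ->
  lie_algebra G (diagcalc P D nu - g *m diagcalc P D nu *m invmx g).
Proof.
move=> Gg p p0; have gu := Gu Gg.
have hD : exponential_mx Q nu (diagcalc P D) (diagcalc P D nu).
  exact: exponential_diagcalc.
(* With the inverse eigenvalues, the inverse power [g0^-t] becomes an exponential family in the same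
   multiplicative map. *)
pose D' := map_mx (fun v => v^-1) D.
have D'E f : diagcalc P D' f = diagcalc P D (fun v => f v^-1).
  by congr (_ *m diag_mx _ *m _); apply/rowP => i; rewrite !mxE.
have hD' : exponential_mx Q nu (diagcalc P D') (diagcalc P D' nu).
  by apply: exponential_diagcalc => // i; rewrite /Q /= mxE invr_eq0.
have hA := exponential_mxM Q1 QM nu1 nuM (exponential_mxM Q1 QM nu1 nuM
  (exponential_mxM Q1 QM nu1 nuM hD (exponential_mx_cst Q1 nu1 g)) hD')
  (exponential_mx_cst Q1 nu1 (invmx g)).
have [|_] := exponential_vanish (exponential_mx_eval Q1 QM nu1 nuM p hA).
  move=> i; apply: p0; have Gi := g0X i.
  have -> : diagcalc P D' (fun v => v ^+ i) = invmx (diagcalc P D (fun v => v ^+ i)).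
    rewrite D'E; apply: (can_inj (mulKmx (Gu Gi))).
    rewrite mulmxV ?Gu // diagcalcM // -(diagcalc1 D Pu); apply: eq_diagcalc => j.
    by rewrite -exprMn divff // expr1n.
  exact: GM (GM (GM Gi Gg) (GV Gi)) (GV Gg).
have d1 := diagcalc1 D Pu; have d1' := diagcalc1 D' Pu.
have dnu : diagcalc P D' nu = - diagcalc P D nu.
  by rewrite D'E -diagcalcN; apply: eq_diagcalc => i; apply/nuV/D0.
rewrite d1 d1' dnu; move: (diagcalc P D nu) => Y.
by rewrite !mulmx0 !mulmx1 !mul1mx !addr0 (mulmxV gu) mulmxDl mulmxN mulNmx mulmxK.
Qed.

Variable T : set 'M[C]_n.
Hypotheses (groupT : is_matrix_group T) (TG : T `<=` G)
  (cT : forall t u, T t -> T u -> t *m u = u *m t) (Tg0 : T (diagcalc P D id))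
  (root1 : forall alpha, Defs.roots G T alpha -> `|alpha (diagcalc P D id)| = 1).

(** [X] is split into eigenvectors of the adjoint action, with eigenvalues [D 0 i / D 0 j]. Each
    nonzero component lies in the Lie algebra, so its eigenvalue is 1 or a value of a root, and has
    modulus 1 in both cases. *)
Let lie_log_comm (X : 'M[C]_n) : lie_algebra G X ->
  X *m diagcalc P D nu = diagcalc P D nu *m X.
Proof.
move=> LX; pose Z := P *m X *m invmx P.
(* [A f] is the function [f] of the adjoint operator, applied to [X]. *)
pose A (f : C -> C) := invmx P *m (\matrix_(i, j) (f (D 0 i / D 0 j) * Z i j)) *m P.
have A1 : A (fun=> 1) = X.
  rewrite [RHS](conj_unitK Pu) /A; congr (_ *m _ *m _).
  by apply/matrixP => i j; rewrite mxE mul1r.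
have adA f : diagcalc P D id *m A f *m invmx (diagcalc P D id) = A (fun v => v * f v).
  rewrite /A conj_diagcalc //; congr (_ *m _ *m _); apply/matrixP => i j.
  by rewrite !mxE mulrA.
have LA (p : {poly C}) : lie_algebra G (A (horner p)).
  have LAX i : lie_algebra G (A (fun v => v ^+ i)).
    elim: i => [|i IH]; first by rewrite (_ : A _ = X) // -A1.
    rewrite (_ : A _ = A (fun v => v * v ^+ i)); last first.
      by congr (_ *m _ *m _); apply/matrixP => a b; rewrite !mxE exprS.
    by rewrite -adA; apply: lie_algebra_conj.
  suff -> : A (horner p) = \sum_(i < size p) p`_i *: A (fun v => v ^+ i).
    exact: lie_algebra_sum.
  rewrite /A; under eq_bigr do rewrite scalemxAl scalemxAr.
  rewrite -mulmx_suml -mulmx_sumr; congr (_ *m _ *m _).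
  apply/matrixP => i j; rewrite mxE summxE horner_coef mulr_suml.
  by apply: eq_bigr => l _; rewrite !mxE mulrA.
apply: diagcalc_comm_entries => // i j; rewrite -/Z.
have [-> | Z0] := eqVneq (Z i j) 0; first by rewrite mul0r mulr0.
rewrite mulrC; congr (_ * _); apply/nu_norm; [exact: D0 | exact: D0 | ].
pose v := D 0 i / D 0 j.
suff : `|v| = 1 by rewrite normf_div => /divr1_eq/esym.
(* This polynomial in the adjoint operator projects onto its [v]-eigenspace. *)
have [p Hp] := interpolation [seq D 0 a / D 0 b | a <- enum 'I_n, b <- enum 'I_n]
  (fun w => (w == v)%:R).
have pE a b : p.[D 0 a / D 0 b] = (D 0 a / D 0 b == v)%:R.
  by apply: Hp; apply/allpairsP; exists (a, b); rewrite !mem_enum.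
have Xv0 : A (horner p) != 0.
  apply: contraNneq Z0 => /(congr1 (fun B => P *m B *m invmx P)).
  rewrite mulmx0 mul0mx /A conj_unitVK //.
  by move=> /matrixP/(_ i j); rewrite !mxE pE eqxx mul1r => ->.
have adv : diagcalc P D id *m A (horner p) *m invmx (diagcalc P D id) = v *: A (horner p).
  rewrite adA /A scalemxAl scalemxAr; congr (_ *m _ *m _).
  apply/matrixP => a b; rewrite !mxE pE.
  by case: eqP => [-> | _]; rewrite ?mulr1 ?mul1r ?mulr0 ?mul0r ?mulr0.
have [v1 | v1] := eqVneq v 1; first by rewrite v1 normr1.
have [alpha ra <-] := root_of_eigenvector groupG groupT TG cT Tg0 (LA p) Xv0 adv v1.
exact: root1.
Qed.

Let hyperbolic_part_comm g : G g ->
  hyperbolic_part *m (g *m hyperbolic_part *m invmx g) =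
  g *m hyperbolic_part *m invmx g *m hyperbolic_part.
Proof.
have norm_nu i j : nu (D 0 i) = nu (D 0 j) -> `|D 0 i| = `|D 0 j|.
  by move/nu_norm; apply; apply: D0.
move=> Gg; have gu := Gu Gg.
(* The logarithm commutes with its conjugate by [invmx g]. Two uses of [diagcalc_comm], separated by
   a conjugation by [g], replace each logarithm by the hyperbolic part. *)
have := lie_log_comm (log_conj_lie_algebra (GV Gg)); rewrite invmxK.
rewrite mulmxBl mulmxBr => /addrI/oppr_inj.
move=> /(diagcalc_comm Pu norm_nu); rewrite -/hyperbolic_part => comm1.
symmetry; apply: (diagcalc_comm Pu norm_nu); rewrite -/hyperbolic_part.
move: hyperbolic_part (diagcalc P D nu) comm1 => s Y comm1.
have := congr1 (fun B => g *m B *m invmx g) comm1.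
by rewrite !mulmxA (mulmxV gu) mul1mx (mulmxK gu) => ->.
Qed.

Let hyperbolic_part_irreducible (a b : 'M[C]_n) p q :
  (forall i : nat, mx_eval p (a *m hyperbolic_part ^+ i *m b) *
     mx_eval q (a *m hyperbolic_part ^+ i *m b) = 0) ->
  (forall i : nat, mx_eval p (a *m hyperbolic_part ^+ i *m b) = 0) \/
  (forall i : nat, mx_eval q (a *m hyperbolic_part ^+ i *m b) = 0).
Proof.
pose Qp := [set v : C | 0 < v]; pose D' := map_mx Num.norm D.
have Qp1 : Qp 1 by apply: ltr01.
have QpM v w : Qp v -> Qp w -> Qp (v * w) by apply: mulr_gt0.
(* Only values are compared here, and the zero map is an additive choice of logarithm. *)
pose z (v : C) : C := 0.
have zM v w : Qp v -> Qp w -> z (v * w) = z v + z w by rewrite /z addr0.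
have hD : exponential_mx Qp z (diagcalc P D') (diagcalc P D' z).
  by apply: exponential_diagcalc => // i; rewrite /Qp /= mxE normr_gt0.
have hA := exponential_mxM Qp1 QpM (erefl : z 1 = 0) zM
  (exponential_mxM Qp1 QpM (erefl : z 1 = 0) zM (exponential_mx_cst Qp1 (erefl : z 1 = 0) a) hD)
  (exponential_mx_cst Qp1 (erefl : z 1 = 0) b).
have E i : hyperbolic_part ^+ i = diagcalc P D' (fun v => v ^+ i).
  rewrite /hyperbolic_part diagcalcX //.
  by congr (_ *m diag_mx _ *m _); apply/rowP => j; rewrite !mxE.
have h r := exponential_mx_eval Qp1 QpM (erefl : z 1 = 0) zM r hA.
move=> pq0; have [i | p0 | q0] := exponential_irreducible (h p) (h q).
- by rewrite -E.
- by left=> i; rewrite E.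
- by right=> i; rewrite E.
Qed.

Theorem eigenvalues_norm1 i : `|D 0 i| = 1.
Proof.
have s1 := commuting_conjugates_trivial hG hyperbolic_part_mem
  hyperbolic_part_comm hyperbolic_part_irreducible.
have : hyperbolic_part = diagcalc P D (fun=> 1) by rewrite diagcalc1.
move=> /(congr1 (fun B => P *m B *m invmx P)).
rewrite /hyperbolic_part /diagcalc !conj_unitVK //.
by move=> /matrixP/(_ i i); rewrite !mxE eqxx.
Qed.

End HyperbolicPart.

(** * Discrete subgroups *)

Section Modulus.
Variable R : realType.
Notation C := R[i].
Notation toC := (real_complex R).

Definition modulus (z : C) : R := complex.Re `|z|.

Lemma modulusE z : toC (modulus z) = `|z|.
Proof. by rewrite /modulus normc_def. Qed.

Lemma modulusM v w : modulus (v * w) = modulus v * modulus w.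
Proof. by apply: (complexI (R := R)); rewrite rmorphM !modulusE normrM. Qed.

Lemma modulus_gt0 v : v != 0 -> 0 < modulus v.
Proof. by move=> v0; rewrite -ltcR modulusE normr_gt0. Qed.

Lemma modulus1 : modulus 1 = 1.
Proof. by apply: (complexI (R := R)); rewrite modulusE normr1 rmorph1. Qed.

Definition lnmod (z : C) : R := ln (modulus z).

Lemma lnmodM v w : v != 0 -> w != 0 -> lnmod (v * w) = lnmod v + lnmod w.
Proof. by move=> v0 w0; rewrite /lnmod modulusM lnM // posrE modulus_gt0. Qed.

Lemma lnmod1 : lnmod 1 = 0.
Proof. by rewrite /lnmod modulus1 ln1. Qed.

Lemma lnmodV v : v != 0 -> lnmod v^-1 = - lnmod v.
Proof.
move=> v0; apply/eqP; rewrite -addr_eq0 -lnmodM ?invr_eq0 // mulVf //.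
by rewrite lnmod1.
Qed.

Lemma lnmod_inj v w : v != 0 -> w != 0 -> lnmod v = lnmod w -> `|v| = `|w|.
Proof.
move=> v0 w0 vw; rewrite -!modulusE; congr toC.
by apply: ln_inj; rewrite ?posrE ?modulus_gt0.
Qed.

Lemma lnmod_eq0 v : v != 0 -> (lnmod v == 0) = (`|v| == 1).
Proof.
move=> v0; apply/eqP/eqP => [h | h]; last by rewrite /lnmod /modulus h /= ln1.
by rewrite -[RHS]normr1; apply: lnmod_inj; rewrite ?oner_neq0 ?lnmod1.
Qed.

Lemma modulus_sqr (z : C) : modulus z ^+ 2 = complex.Re z ^+ 2 + complex.Im z ^+ 2.
Proof.
by apply: (complexI (R := R)); rewrite [LHS]rmorphXn /= modulusE add_Re2_Im2.
Qed.

Lemma modulus_ge0 z : 0 <= modulus z.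
Proof. by rewrite -lecR modulusE normr_ge0. Qed.

Lemma modulus_sum (I : finType) (F : I -> C) :
  modulus (\sum_i F i) <= \sum_i modulus (F i).
Proof.
rewrite -lecR modulusE rmorph_sum /=.
by under [leRHS]eq_bigr do rewrite modulusE; apply: ler_norm_sum.
Qed.

Lemma modulusX z i : modulus (z ^+ i) = modulus z ^+ i.
Proof.
by elim: i => [|i IH]; rewrite ?modulus1 // !exprS modulusM IH.
Qed.

(** Pigeonhole principle: for two exponents [a < b] all powers fall into the same cells, and [b - a]
    is the required exponent. *)
Lemma unit_circle_recurrence n (z : 'I_n -> C) (delta : R) : 0 < delta ->
  (forall i, modulus (z i) = 1) ->
  exists2 k, (0 < k)%N & forall i, modulus (z i ^+ k - 1) < delta.
Proof.
move=> d_gt0 z1; pose N := (Num.truncn (2 / delta)).+1.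
have N_gt0 : 0 < N%:R :> R by rewrite ltr0n.
have Nd : 2 / N%:R < delta.
  by rewrite ltr_pdivrMr // mulrC -ltr_pdivrMr // truncnS_gt.
(* For [x] between -1 and 1 the truncation ranges from 0 to [2 * N] inclusive. Cells have side
   [1 / N], so two points in one square are less than [2 / N] apart. *)
pose cell (x : R) : 'I_(2 * N).+1 := inord (Num.truncn ((x + 1) * N%:R)).
have cellP x y : -1 <= x <= 1 -> -1 <= y <= 1 -> cell x = cell y ->
    (x - y) ^+ 2 < N%:R^-1 ^+ 2.
  have val_cell u : -1 <= u <= 1 -> cell u = Num.truncn ((u + 1) * N%:R) :> nat.
    move=> /andP[u1 u2]; rewrite inordK // ltnS -ltnS truncn_lt_nat; last first.
      by rewrite mulr_ge0 ?ler0n //; lra.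
    rewrite -natr1 natrM; nra.
  move=> hx hy /(congr1 val) /=; rewrite !val_cell // => xy.
  have /andP[x1 x2] : (Num.truncn ((x + 1) * N%:R))%:R <= (x + 1) * N%:R
      < (Num.truncn ((x + 1) * N%:R)).+1%:R.
    by apply: truncn_itv; rewrite mulr_ge0 ?ler0n //; lra.
  have /andP[y1 y2] : (Num.truncn ((y + 1) * N%:R))%:R <= (y + 1) * N%:R
      < (Num.truncn ((y + 1) * N%:R)).+1%:R.
    by apply: truncn_itv; rewrite mulr_ge0 ?ler0n //; lra.
  rewrite -xy -natr1 in y1 y2; rewrite -natr1 in x2.
  rewrite -(ltr_pM2r (exprn_gt0 2 N_gt0)) -!exprMn mulVf ?gt_eqF //.
  nra.
pose f (k : nat) := [ffun i => (cell (complex.Re (z i ^+ k)), cell (complex.Im (z i ^+ k)))].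
pose M := #|{: {ffun 'I_n -> 'I_(2 * N).+1 * 'I_(2 * N).+1}}|.
have [a [b [lt_ab fab]]] : exists a b : nat, (a < b)%N /\ f a = f b.
  have /injectivePn[a [b ab fab]] : ~~ injectiveb (fun k : 'I_M.+1 => f k).
    by apply/negP => /injectiveP/leq_card; rewrite card_ord -/M ltnn.
  move: ab; rewrite -val_eqE neq_ltn => /orP[ab | ba]; first by exists a, b.
  by exists b, a.
exists (b - a)%N => [|i]; first by rewrite subn_gt0.
have zX k : modulus (z i ^+ k) = 1 by rewrite modulusX z1 expr1n.
have bound k : -1 <= complex.Re (z i ^+ k) <= 1 /\ -1 <= complex.Im (z i ^+ k) <= 1.
  have := modulus_sqr (z i ^+ k); rewrite zX expr1n => h.
  by split; nra.
have -> : modulus (z i ^+ (b - a) - 1) = modulus (z i ^+ b - z i ^+ a).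
  by rewrite -[LHS]mul1r -(zX a) -modulusM mulrBr mulr1 -exprD subnKC // ltnW.
apply: le_lt_trans Nd; rewrite -(ler_pXn2r (n := 2)) ?nnegrE ?modulus_ge0 //.
have := congr1 (fun g : {ffun _} => g i) fab; rewrite !ffunE => -[/esym re /esym im].
have re2 := cellP _ _ (bound b).1 (bound a).1 re.
have im2 := cellP _ _ (bound b).2 (bound a).2 im.
rewrite modulus_sqr !raddfB /= exprMn; nra.
Qed.

Lemma mx_complexX n (g : 'M[R]_n) i : mx_complex (g ^+ i) = mx_complex g ^+ i.
Proof.
elim: i => [|i IH]; first by rewrite !expr0 /mx_complex map_mx1.
by rewrite !exprS /mx_complex map_mxM -IH.
Qed.

(** The entries of [g ^+ k - 1] are fixed linear combinations of the [D 0 l ^+ k - 1]. A suitable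
    positive [k] makes them small, and discreteness forces [g ^+ k] to be 1. *)
Lemma discrete_norm1_torsion n (Gamma : set 'M[R]_n) g P (D : 'rV[C]_n) :
  is_matrix_group Gamma -> discrete_set Gamma -> Gamma g -> P \in unitmx ->
  mx_complex g = diagcalc P D id -> (forall i, modulus (D 0 i) = 1) ->
  ~ infinite_order g.
Proof.
move=> [_ G1 GM _] disc Gg Pu gD D1 inf.
have GX i : Gamma (g ^+ i).
  by elim: i => [|i IH]; rewrite ?expr0 // exprS; apply: GM.
have [_ [V /nbhs_ballP[e /= e_gt0 eV] V1]] := disc _ G1.
have iso h : Gamma h -> (forall i j, `|h i j - (1%:M : 'M[R]_n) i j| < e) -> h = 1%:M.
  move=> Gh he; suff : (V `&` Gamma) h by rewrite V1.
  split=> //; apply: eV; split=> // i j.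
  by rewrite -ball_normE /= distrC.
have [S [SE S_ge0]] : exists S : 'I_n -> 'I_n -> R,
    (forall i j, \sum_l modulus (invmx P i l * P l j) = S i j) /\ forall i j, 0 <= S i j.
  exists (fun i j => \sum_l modulus (invmx P i l * P l j)); split=> // i j.
  by apply: sumr_ge0 => l _; apply: modulus_ge0.
(* The summand 1 makes [B] positive and a strict bound of every [S i j]. *)
pose B := 1 + \sum_i \sum_j S i j.
have B_gt0 : 0 < B.
  by rewrite ltr_wpDr //; apply: sumr_ge0 => i _; apply: sumr_ge0.
have S_lt i j : S i j < B.
  rewrite /B (bigD1 i) //= (bigD1 j) //=.
  have h1 : 0 <= \sum_(l | l != j) S i l by apply: sumr_ge0.
  have h2 : 0 <= \sum_(l | l != i) \sum_j S l j.
    by apply: sumr_ge0 => l _; apply: sumr_ge0.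
  by lra.
have [k k_gt0 hk] := unit_circle_recurrence (divr_gt0 e_gt0 B_gt0) D1.
apply: (inf k k_gt0); apply: iso => // i j.
have E : toC ((g ^+ k) i j - (1%:M : 'M[R]_n) i j) =
    \sum_l (invmx P i l * P l j) * (D 0 l ^+ k - 1).
  transitivity ((mx_complex (g ^+ k) - 1%:M) i j).
    by rewrite !mxE rmorphB /= rmorph_nat.
  rewrite mx_complexX gD diagcalcX // -(diagcalc1 D Pu) 2!mxE.
  rewrite /diagcalc !mxE -sumrB; apply: eq_bigr => l _.
  by rewrite !mul_mx_diag !mxE; ring.
have -> : `|(g ^+ k) i j - (1%:M : 'M[R]_n) i j| = modulus (toC ((g ^+ k) i j - (1%:M : 'M[R]_n) i j)).
  by apply: (complexI (R := R)); rewrite modulusE normc_def /= expr0n addr0 sqrtr_sqr.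
rewrite E; apply: le_lt_trans (modulus_sum _) _.
apply: (@le_lt_trans _ _ (\sum_l modulus (invmx P i l * P l j) * (e / B))).
  by apply: ler_sum => l _; rewrite modulusM ler_wpM2l ?modulus_ge0 // ltW.
rewrite -mulr_suml SE mulrA ltr_pdivrMr // mulrC ltr_pM2l //.
Qed.

End Modulus.

(** * Characters and lengths *)

Section Characters.
Variables (F : fieldType) (n : nat) (T : set 'M[F]_n).
Hypothesis groupT : is_matrix_group T.
Implicit Types chi psi : 'M[F]_n -> F.

Let Tu t : T t -> t \in unitmx. Proof. by case: groupT => h _ _ _; apply: h. Qed.
Let T1 : T 1%:M. Proof. by case: groupT. Qed.
Let TM s t : T s -> T t -> T (s *m t).
Proof. by case: groupT => _ _ h _; apply: h. Qed.
Let TV t : T t -> T (invmx t). Proof. by case: groupT => _ _ _ h; apply: h. Qed.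

Let detT t e : T t -> \det t ^+ e != 0.
Proof. by move=> /Tu tu; rewrite expf_neq0 // -unitfE -unitmxE. Qed.

Lemma character1E chi : characters T chi -> chi 1%:M = 1.
Proof.
move=> [_ c0 cM _]; apply: (mulfI (c0 _ T1)).
by rewrite -cM // mulmx1 mulr1.
Qed.

Lemma characterV chi t : characters T chi -> T t -> chi (invmx t) = (chi t)^-1.
Proof.
move=> hc Tt; have [_ c0 cM _] := hc; apply: (mulfI (c0 _ Tt)).
by rewrite -cM ?mulmxV ?Tu ?divff ?c0 ?character1E //; apply: TV.
Qed.

Lemma characterX chi t i : characters T chi -> T t -> chi (t ^+ i) = chi t ^+ i.
Proof.
move=> hc Tt; have [_ _ cM _] := hc.
have TX j : T (t ^+ j) by elim: j => [|j IH]; rewrite ?expr0 // exprS; apply: TM.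
elim: i => [|i IH]; first by rewrite !expr0 character1E.
by rewrite !exprS [LHS]cM // IH.
Qed.

Lemma trivial_character : characters T (fun t => if `[< T t >] then 1 else 0).
Proof.
split=> [|t Tt|s t Ts Tt|t nTt].
- exists (mpoly.mpolyC _ 1), 0%N => t Tt; case: asboolP => // _.
  by rewrite /mx_eval mpoly.mevalC divr1.
- by case: asboolP => // _; apply: oner_neq0.
- by rewrite !asboolT ?mulr1 //; apply: TM.
- by rewrite asboolF.
Qed.

Lemma characterM chi psi : characters T chi -> characters T psi ->
  characters T (fun t => chi t * psi t).
Proof.
move=> [[p [d Dp]] c0 cM cT] [[q [e Dq]] d0 dM dT]; split=> [|t Tt|s t Ts Tt|t nTt].
- exists (p * q), (d + e)%N => t Tt.
  rewrite Dp // Dq // /mx_eval mpoly.mevalM exprD invfM; ring.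
- by rewrite mulf_neq0 ?c0 ?d0.
- by rewrite cM // dM //; ring.
- by rewrite cT // mul0r.
Qed.

Lemma character_inv chi : characters T chi -> characters T (fun t => (chi t)^-1).
Proof.
move=> hc; have [[p [d Dp]] c0 cM cT] := hc; split=> [|t Tt|s t Ts Tt|t nTt].
- have [q [e Dq]] := polyfun_inverse p.
  have [r Dr] : polyfun (fun t : 'M[F]_n => mx_eval q t * \det t ^+ d).
    apply: polyfunM; first by exists q.
    by apply/polyfunX/polyfun_det; apply: polyfun_entry.
  exists r, e => t Tt; rewrite -characterV // Dp ?Dr; last exact: TV.
  rewrite Dq ?Tu // det_inv exprVn invrK.
  by have := detT e Tt => ?; field.
- by rewrite invr_neq0 ?c0.
- by rewrite cM // invfM.
- by rewrite cT // invr0.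
Qed.

(* Up to a power of the determinant, chi(g)^i is a fixed exponential sum in i
   with bases in Q, hence chi(g) itself is one of these bases. *)
Lemma character_value (Q : set F) P (D : 'rV[F]_n) chi :
  Q 1 -> (forall v w, Q v -> Q w -> Q (v * w)) ->
  P \in unitmx -> (forall i, Q (D 0 i)) -> T (diagcalc P D id) -> characters T chi ->
  exists e, Q (chi (diagcalc P D id) * \det (diagcalc P D id) ^+ e).
Proof.
move=> Q1 QM Pu QD Tg hc; have [[p [e Dp]] _ _ _] := hc.
set g := diagcalc P D id in Tg *; exists e; set w := chi g * _.
pose z (v : F) : F := 0.
have zM v u : Q v -> Q u -> z (v * u) = z v + z u by rewrite /z addr0.
have hD := exponential_diagcalc Q1 QM (erefl : z 1 = 0) zM P QD.
have [l [Ql lE _]] := exponential_mx_eval Q1 QM (erefl : z 1 = 0) zM p hD.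
have wX i : w ^+ i = expsum l (fun v => v ^+ i).
  rewrite -lE; last exact: mult_funX.
  rewrite -(diagcalcX D Pu i id) -/g.
  have TX : T (g ^+ i).
    by elim: i => [|i IH]; rewrite ?expr0 // exprS; apply: TM.
  rewrite /w exprMn -(characterX i hc Tg) Dp // exprAC.
  have -> : \det (g ^+ i) = \det g ^+ i.
    elim: i {TX} => [|i IH]; first by rewrite !expr0 det1.
    by rewrite !exprS [LHS]det_mulmx IH.
  by rewrite mulfVK // exprAC expf_neq0 // detT.
(* Evaluated at the indicator of [w], this vanishing sum shows that [w] occurs among the bases of
   [l]. *)
have l0 i : expsum ((-1, w) :: l) (fun v => v ^+ i) = 0.
  by rewrite /expsum big_cons mulN1r wX addNr.
have := expsum_vanish (fun v => (v == w)%:R) l0.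
rewrite /expsum big_cons eqxx mulr1.
have [/hasP[t tl /eqP <-] _ | /hasPn nw] := boolP (has (fun t => t.2 == w) l).
  exact: Ql.
rewrite big_seq big1 ?addr0 => [/eqP|t /nw/negbTE ->]; last by rewrite mulr0.
by rewrite oppr_eq0 oner_eq0.
Qed.

Let weight chi (X : 'M[F]_n) := forall t, T t -> t *m X *m invmx t = chi t *: X.

(** Dedekind's argument: acting by some [t] that separates two characters and subtracting [a t]
    times the relation eliminates the first weight vector. *)
Lemma weight_independent (X : ('M[F]_n -> F) -> 'M[F]_n) (s : seq ('M[F]_n -> F))
    (c : ('M[F]_n -> F) -> F) : uniq s ->
  (forall chi, chi \in s -> [/\ characters T chi, weight chi (X chi) & X chi != 0]) ->
  \sum_(chi <- s) c chi *: X chi = 0 -> forall chi, chi \in s -> c chi = 0.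
Proof.
elim: s c => // a s IH c /= /andP[as_ us] h; rewrite big_cons => sum0.
have [ha wa Xa0] := h a (mem_head _ _).
have hs chi : chi \in s -> [/\ characters T chi, weight chi (X chi) & X chi != 0].
  by move=> cs; apply: h; rewrite inE cs orbT.
have cs0 chi : chi \in s -> c chi = 0.
  move=> chis; have [hchi _ _] := hs _ chis.
  have [t [Tt nt]] : exists t, T t /\ chi t != a t.
    apply: contrapT => nex; have ca : chi = a.
      apply/funext => t; have [Tt | nTt] := pselect (T t).
        by apply/eqP/negPn/negP => nt; apply: nex; exists t.
      by have [_ _ _ ->] := hchi => //; have [_ _ _ ->] := ha.
    by move: as_; rewrite -ca chis.
  have sum1 : \sum_(psi <- s) (c psi * (psi t - a t)) *: X psi = 0.
    have := congr1 (fun Z => t *m Z *m invmx t - a t *: Z) sum0.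
    rewrite mulmx0 mul0mx scaler0 subr0 mulmxDr mulmxDl scalerDr opprD addrACA.
    rewrite -scalemxAr -scalemxAl wa // !scalerA [a t * _]mulrC subrr add0r.
    move=> sum0'; rewrite -[RHS]sum0' mulmx_sumr mulmx_suml scaler_sumr -sumrB !big_seq.
    apply: eq_bigr => psi /hs[_ wpsi _]; rewrite -scalemxAr -scalemxAl wpsi //.
    by rewrite !scalerA -scalerBl; congr (_ *: _); ring.
  have /eqP := IH _ us hs sum1 _ chis.
  by rewrite mulf_eq0 subr_eq0 (negbTE nt) orbF => /eqP.
move: sum0; rewrite big_seq big1 ?addr0 => [/eqP | chi /cs0->]; last by rewrite scale0r.
rewrite scaler_eq0 (negbTE Xa0) orbF => /eqP ca0 chi.
by rewrite inE => /predU1P[-> | /cs0].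
Qed.

(** Root vectors of distinct roots are linearly independent, so there are at most [n * n] roots.
    Finiteness gives the sum in [lambda_wrt] its intended value. *)
Lemma finite_roots (G : set 'M[F]_n) : finite_set (Defs.roots G T).
Proof.
have /choice[X DX] : forall chi, exists X, Defs.roots G T chi ->
    [/\ characters T chi, weight chi X & X != 0].
  move=> chi; have [[hc _ [X [_ /eqP X0 wX]]] | nr] := pselect (Defs.roots G T chi).
    by exists X.
  by exists 0.
pose P m := `[< exists s, [/\ uniq s, [set` s] `<=` Defs.roots G T & size s = m] >].
have exP : exists m, P m by exists 0%N; apply/asboolP; exists [::].
have leP m : P m -> (m <= n * n)%N.
  move=> /asboolP[s [us sr <-]].
  pose M := \matrix_(i < size s) mxvec (X (nth (fun=> 0) s i)).
  suff : row_free M by rewrite -row_leq_rank => /leq_trans/(_ (rank_leq_col M)).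
  apply: inj_row_free => v; rewrite mulmx_sum_row => v0.
  have := @weight_independent X s (fun chi => if insub (index chi s) is Some i then v 0 i else 0) us.
  have sX : forall chi, chi \in s -> [/\ characters T chi, weight chi (X chi) & X chi != 0].
    by move=> chi /sr/DX.
  move=> /(_ sX) h; apply/rowP => i; rewrite mxE.
  have /h/(_ (nth (fun=> 0) s i)) : \sum_(chi <- s)
      (if insub (index chi s) is Some i then v 0 i else 0) *: X chi = 0.
    apply: (can_inj mxvecK); rewrite raddf0 -v0 raddf_sum /= (big_nth (fun=> 0)) big_mkord.
    apply: eq_bigr => j _; rewrite linearZ rowK /=; congr (_ *: _).
    by rewrite index_uniq // insubT //= => ?; congr (v 0 _); apply/val_inj.
  by rewrite mem_nth // index_uniq // valK; apply.
case: (ex_maxnP exP leP) => m /asboolP[s [us sr <-]] max.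
apply: (sub_finite_set _ (finite_seq s)) => chi rchi.
apply: contrapT => /negP ns; suff /max : P (size s).+1 by rewrite ltnn.
apply/asboolP; exists (chi :: s); split=> //=; first by rewrite ns.
by move=> psi /=; rewrite inE => /predU1P[-> | /sr].
Qed.

End Characters.

(** * Complex conjugation and characters of real tori *)

Section RealTori.
Variable R : realType.
Notation C := R[i].
Notation toC := (real_complex R).

Definition conj_mx n (g : 'M[C]_n) : 'M[C]_n := map_mx (@conjc R) g.

Lemma conj_mxK n : involutive (@conj_mx n).
Proof. by move=> g; apply/matrixP => i j; rewrite !mxE conjcK. Qed.

Lemma conj_mx_complex n (g : 'M[R]_n) : conj_mx (mx_complex g) = mx_complex g.
Proof. by apply/matrixP => i j; rewrite !mxE conjc_real. Qed.

Lemma conj_meval N (p : mpoly.mpoly N C) (h : 'I_N -> C) :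
  conjc (mpoly.meval h p) =
  mpoly.meval (@conjc R \o h) (mpoly.map_mpoly (@conjc R) p).
Proof.
elim/mpoly_gen_ind: p => [c | i | p q Hp Hq | p q Hp Hq].
- by rewrite mpoly.mevalC mpoly.map_mpolyC mpoly.mevalC.
- rewrite mpoly.mevalXU [mpoly.map_mpoly _ _]mpoly.mmapX mpoly.mmap1U.
  by rewrite mpoly.mevalXU.
- rewrite [in LHS]mpoly.mevalD [LHS]rmorphD /= Hp Hq -mpoly.mevalD.
  by congr mpoly.meval; exact/esym/rmorphD.
- rewrite [in LHS]mpoly.mevalM [LHS]rmorphM /= Hp Hq -mpoly.mevalM.
  by congr mpoly.meval; exact/esym/rmorphM.
Qed.

Lemma conj_mx_eval n (p : mpoly.mpoly (n * n) C) (g : 'M[C]_n) :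
  conjc (mx_eval p g) = mx_eval (mpoly.map_mpoly (@conjc R) p) (conj_mx g).
Proof.
rewrite /mx_eval conj_meval; apply: mpoly.meval_eq => i /=.
by case/mxvec_indexP: i => i j; rewrite !mxvecE mxE.
Qed.

Lemma conj_mpoly_real N (p : mpoly.mpoly N C) :
  mpoly_over (in_complex [set: R]) p -> mpoly.map_mpoly (@conjc R) p = p.
Proof.
move=> pR; apply/mpoly.mpolyP => u; rewrite mpoly.mcoeff_map_mpoly.
by have [x _ <-] := pR u; exact: conjc_real.
Qed.

Variable n : nat.
Implicit Types (G T : set 'M[C]_n) (g : 'M[R]_n).

Lemma real_closed_conj T : zariski_closed (in_complex [set: R]) T ->
  forall t, T t -> T (conj_mx t).
Proof.
move=> [S SR ->] t [tu tS]; split=> [|p Sp]; first by rewrite map_unitmx.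
by rewrite -(conj_mpoly_real (SR p Sp)) -conj_mx_eval tS // conjc0.
Qed.

Lemma maximal_real_torus_facts G g T : maximal_real_torus_at G g T ->
  [/\ is_matrix_group T, T `<=` G, forall t u, T t -> T u -> t *m u = u *m t,
      T (mx_complex g) & forall t, T t -> T (conj_mx t)].
Proof.
move=> [[[[hT cT] [d [f [f' [[fD fM _] _ f'f _]]]]] TG _] Tg]; split=> //.
  move=> t u Tt Tu; have [_ _ TM _] := hT.
  rewrite -[LHS]f'f ?[RHS]f'f; try exact: TM.
  rewrite -[RHS]f'f; last exact: TM.
  rewrite !fM //; congr f'.
  have [_ /diag_mxP[a ->]] := fD t Tt; have [_ /diag_mxP[b ->]] := fD u Tu.
  exact: diag_mxC.
exact: real_closed_conj.
Qed.

Lemma character_conj T chi : (forall t, T t -> T (conj_mx t)) ->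
  characters T chi -> characters T (fun t => conjc (chi (conj_mx t))).
Proof.
move=> TJ [[p [e Dp]] c0 cM cT]; split=> [|t Tt|s t Ts Tt|t nTt].
- exists (mpoly.map_mpoly (@conjc R) p), e => t Tt; rewrite Dp; last exact: TJ.
  by rewrite rmorphM fmorphV rmorphXn /= conj_mx_eval conj_mxK -det_map_mx -/(conj_mx _) conj_mxK.
- by rewrite conjc_eq0 c0 //; apply: TJ.
- rewrite /conj_mx map_mxM -!/(conj_mx _) cM ?rmorphM //; exact: TJ.
- by rewrite cT ?conjc0 // => /TJ; rewrite conj_mxK.
Qed.

(** The character whose value at a real point is the squared modulus of [chi]. *)
Definition norm_character chi (t : 'M[C]_n) : C := chi t * conjc (chi (conj_mx t)).

Lemma norm_characterE chi g : norm_character chi (mx_complex g) =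
  toC (modulus (chi (mx_complex g)) ^+ 2).
Proof. by rewrite /norm_character conj_mx_complex -sqr_normc rmorphXn /= modulusE. Qed.

Definition log_values T g : set R :=
  [set u | exists2 chi, characters T chi & u = lnmod (chi (mx_complex g))].

Lemma subgroup_log_values T g : is_matrix_group T -> T (mx_complex g) ->
  subgroup_set (log_values T g).
Proof.
move=> hT Tg; split.
  exists (fun t => if `[< T t >] then 1 else 0); first exact: trivial_character.
  by rewrite asboolT // lnmod1.
move=> _ _ [chi hc ->] [psi hp ->].
exists (fun t => chi t * (psi t)^-1); first by apply: characterM => //; apply: character_inv.
have [_ c0 _ _] := hc; have [_ p0 _ _] := hp.
by rewrite lnmodM ?invr_eq0 ?c0 ?p0 // lnmodV ?p0.
Qed.

Variable K : set R.
Notation E := (algcl (in_complex K)).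

Lemma algcl_sqr (S : set C) x : algcl S (x ^+ 2) -> algcl S x.
Proof.
move=> Sx2; apply: algcl_closed; exists ('X^2 - (x ^+ 2)%:P); split.
- by rewrite -size_poly_gt0 size_XnsubC.
- have hS := is_subfield_algcl S; suff /polyOverP Sp : 'X^2 - (x ^+ 2)%:P \is a polyOver (subfield_pred hS).
    by move=> i; apply/(in_subfield hS).
  by rewrite rpredB ?rpredX ?polyOverX ?polyOverC //; apply/in_subfield.
- by rewrite /root !hornerE subrr.
Qed.

Lemma eigenvalue_algebraic g P (D : 'rV[C]_n) i : (forall i j, K (g i j)) ->
  P \in unitmx -> mx_complex g = diagcalc P D id -> E (D 0 i).
Proof.
move=> Kg Pu gD; have hS := is_subfield_generated (in_complex K).
exists (char_poly (mx_complex g)); split.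
- by rewrite monic_neq0 ?char_poly_monic.
- suff /polyOverP Sp : char_poly (mx_complex g) \is a polyOver (subfield_pred hS).
    by move=> j; apply/(in_subfield hS).
  apply: rpred_sum => s _; apply: rpredM; first by rewrite rpredX // rpredN rpred1.
  apply: rpred_prod => j _; rewrite !mxE rpredB ?rpredMn ?polyOverX ?polyOverC //.
  by apply/in_subfield; apply: sub_generated_field; exists (g j (s j)).
- rewrite -eigenvalue_root_char; apply/eigenvalueP; exists (row i P).
    rewrite gD diagcalc_id !mulmxA -row_mul mulmxV // -row_mul mul1mx.
    by rewrite -row_mul mul_diag_mx; apply/rowP => j; rewrite !mxE.
  apply/eqP => ri0.
  have := congr1 (fun v => (v *m invmx P) 0 i) ri0.
  by rewrite -row_mul mulmxV // mul0mx !mxE eqxx => /eqP; rewrite oner_eq0.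
Qed.

(** By [character_value], up to a power of the determinant the value lies in any multiplicatively
    closed set with 1 that contains the eigenvalues, such as the algebraic closure of [K]. *)
Lemma character_algebraic g T chi : (forall i j, K (g i j)) ->
  semisimple_element g -> is_matrix_group T -> T (mx_complex g) ->
  characters T chi -> E (chi (mx_complex g)).
Proof.
move=> Kg /diagonalizableP_diagcalc[P Pu [D]]; rewrite -diagcalc_id => gD hT Tg hc.
have hE := is_subfield_algcl (in_complex K).
have inE' x : E x <-> x \in subfield_pred hE by split=> /(in_subfield hE).
have [|||||e] := @character_value C n T hT E P D chi _ _ Pu.
- by apply/inE'; rewrite rpred1.
- by move=> v w /inE' Ev /inE' Ew; apply/inE'; rewrite rpredM.
- by move=> i; apply: eigenvalue_algebraic gD.
- by rewrite -gD.
- exact: hc.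
rewrite -gD => /inE' Ee.
have tu : mx_complex g \in unitmx by case: hT => h _ _ _; apply: h.
have d0 : \det (mx_complex g) != 0 by rewrite -unitfE -unitmxE.
apply/inE'; rewrite -[chi _](mulfK (expf_neq0 e d0)) rpred_div // rpredX //.
apply: rpred_sum => s _; apply: rpredM; first by rewrite rpredX // rpredN rpred1.
apply: rpred_prod => j _; rewrite mxE; apply/inE'; apply: sub_algcl.
by exists (g j (s j)).
Qed.

Lemma log_values_algebraic g T u : (forall i j, K (g i j)) ->
  semisimple_element g -> is_matrix_group T -> T (mx_complex g) ->
  (forall t, T t -> T (conj_mx t)) -> log_values T g u -> E (toC (expR u)).
Proof.
move=> Kg sg hT Tg TJ [chi hc ->]; have [_ c0 _ _] := hc.
rewrite /lnmod lnK ?posrE ?modulus_gt0 ?c0 //; apply: algcl_sqr.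
rewrite -rmorphXn /= -norm_characterE.
apply: (character_algebraic Kg sg hT Tg (chi := norm_character chi)).
by apply: characterM => //; apply: character_conj.
Qed.

End RealTori.

(** If all roots had modulus 1 at [g], so would all its eigenvalues, against discreteness and
    infinite order. This makes the lengths nonzero. *)
Lemma root_lnmod_neq0 (R : realType) n (k : set R[i]) (K : set R) (G T : set 'M[R[i]]_n)
    (Gamma : set 'M[R]_n) g :
  semisimple_group k G -> admissible_subgroup K G Gamma -> Gamma g ->
  semisimple_element g -> infinite_order g -> maximal_real_torus_at G g T ->
  exists2 alpha, Defs.roots G T alpha & lnmod (alpha (mx_complex g)) != 0.
Proof.
move=> hG [hGam GamG disc _ _] Gg /diagonalizableP_diagcalc[P Pu [D]].
rewrite -diagcalc_id => gD inf /maximal_real_torus_facts[hT TG cT Tg TJ].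
apply: contrapT => nr; apply: (discrete_norm1_torsion hGam disc Gg Pu gD) => // i.
have gu : mx_complex g \in unitmx by case: hT => h _ _ _; apply: h.
have D0 j : D 0 j != 0.
  have Du : diag_mx D \in unitmx.
    rewrite -(conj_unitVK Pu (diag_mx D)) -diagcalc_id -gD !unitmx_mul Pu gu.
    by rewrite unitmx_inv.
  move: Du; rewrite unitmxE det_diag unitfE => /prodf_neq0; apply=> //.
have [_ GG] := GamG _ Gg.
apply: (complexI (R := R)); rewrite modulusE rmorph1.
apply: (@eigenvalues_norm1 _ (real_complex R \o @lnmod R) _ _ _ n k G P D hG Pu D0 _ T) => //=.
- by rewrite lnmod1.
- by move=> v w v0 w0; rewrite lnmodM // rmorphD.
- move=> v w v0 w0; split=> [/complexI | vw]; first exact: lnmod_inj.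
  by rewrite /lnmod /modulus vw.
- by rewrite -gD.
- by rewrite -gD.
move=> alpha ra; rewrite -gD; apply/eqP.
have [[_ a0 _ _] _ _] := ra.
rewrite -lnmod_eq0 ?a0 //; apply/negPn/negP => h; apply: nr; by exists alpha.
Qed.

(** * Length fields and groups of logarithms *)

Section LengthFields.
Variables (R : realType) (K : set R).
Notation C := R[i].
Notation toC := (real_complex R).

Section OneGroup.
Variables (n : nat) (G : set 'M[C]_n) (Gamma : set 'M[R]_n).

Lemma lambda_wrt_sqr T g :
  lambda_wrt G T g ^+ 2 =
  \sum_(alpha <- fset_set (Defs.roots G T)) lnmod (alpha (mx_complex g)) ^+ 2.
Proof.
rewrite /lambda_wrt fsbig_finite ?sqr_sqrtr //; last exact: finite_roots.
by apply: sumr_ge0 => alpha _; apply: sqr_ge0.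
Qed.

Lemma root_log_value T g (alpha : 'M[C]_n -> C) : alpha \in fset_set (Defs.roots G T) ->
  log_values T g (lnmod (alpha (mx_complex g))).
Proof.
rewrite in_fset_set; last exact: finite_roots.
by rewrite inE => -[hc _ _]; exists alpha.
Qed.

(** The group [W] of [length_independence]. The free number [m] of elements makes it closed under
    differences, by concatenation and inversion of characters. *)
Definition log_sums : set R := [set u | exists m (g : 'I_m -> 'M[R]_n)
    (T : 'I_m -> set 'M[C]_n) (chi : 'I_m -> 'M[C]_n -> C),
  (forall k, [/\ Gamma (g k), semisimple_element (g k),
     maximal_real_torus_at G (g k) (T k) & characters (T k) (chi k)]) /\
  u = \sum_k lnmod (chi k (mx_complex (g k)))].

Lemma subgroup_log_sums : subgroup_set log_sums.
Proof.
split.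
  exists 0%N, (fun=> 0), (fun=> set0), (fun _ _ => 0).
  by split=> [[]//|]; rewrite big_ord0.
move=> _ _ [m [g [T [chi [h ->]]]]] [m' [g' [T' [chi' [h' ->]]]]].
pose joined A (x : 'I_m -> A) (y : 'I_m' -> A) (k : 'I_(m + m')) :=
  match fintype.split k with inl i => x i | inr j => y j end.
exists (m + m')%N, (joined _ g g'), (joined _ T T'),
  (joined _ chi (fun k t => (chi' k t)^-1)); split=> [k|].
  rewrite /joined; case: fintype.split => j; first exact: h.
  have [Gg sg hT hc] := h' j; split=> //; apply: character_inv => //.
  by have [] := maximal_real_torus_facts hT.
rewrite big_split_ord -sumrN; congr (_ + _); apply: eq_bigr => j _; rewrite /joined.
  by rewrite (unsplitK (inl j) : fintype.split (lshift m' j) = inl j).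
rewrite (unsplitK (inr j) : fintype.split (rshift m j) = inr j) lnmodV //.
have [_ _ /maximal_real_torus_facts[_ _ _ Tg _] [_ c0 _ _]] := h' j.
exact: c0.
Qed.

Hypothesis adm : admissible_subgroup K G Gamma.

Lemma admissible_entries g : Gamma g -> forall i j, K (g i j).
Proof. by case: adm => _ GK _ _ _ /GK[]. Qed.

Lemma log_sums_algebraic u : log_sums u -> algcl (in_complex K) (toC (expR u)).
Proof.
have hE := is_subfield_algcl (in_complex K).
move=> [m [g [T [chi [h ->]]]]].
apply: (big_ind (fun u => algcl (in_complex K) (toC (expR u)))) => [|x y Ex Ey|k _].
- by rewrite expR0 rmorph1; apply/(in_subfield hE)/rpred1.
- by rewrite expRD rmorphM; apply/(in_subfield hE); rewrite rpredM //; apply/in_subfield.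
have [Gg sg hT hc] := h k; have [? _ _ ? ?] := maximal_real_torus_facts hT.
apply: (log_values_algebraic (g := g k) (T := T k)) => //.
  exact: admissible_entries.
by exists (chi k).
Qed.

(** The square of each generator is a sum of squares of elements of [log_sums]. *)
Lemma length_field_algebraic f : length_field G Gamma f ->
  algcl (toC @` log_sums) (toC f).
Proof.
have hE := is_subfield_algcl (toC @` log_sums).
have inE' x : algcl (toC @` log_sums) x <-> x \in subfield_pred hE.
  by split=> /(in_subfield hE).
move: f; apply: (generated_field_min (K := [set f | algcl (toC @` log_sums) (toC f)])).
  split; first by rewrite inE /= rmorph1; apply/inE'/rpred1.
  - move=> x y; rewrite !inE /= => /inE' Ex /inE' Ey; rewrite rmorphB.
    by apply/inE'; rewrite rpredB.
  - move=> x y; rewrite !inE /= => /inE' Ex /inE' Ey; rewrite fmorph_div.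
    by apply/inE'; rewrite rpred_div.
move=> _ [g [T [Gg g1 sg hT ->]]] /=.
apply: algcl_sqr; rewrite -rmorphXn lambda_wrt_sqr rmorph_sum.
apply/inE'; rewrite big_seq; apply: rpred_sum => alpha ra; rewrite rmorphXn rpredX //.
apply/inE'; apply: sub_algcl; exists (lnmod (alpha (mx_complex g))) => //.
have [chi hc ->] := root_log_value g ra.
by exists 1%N, (fun=> g), (fun=> T), (fun=> chi); rewrite big_ord1.
Qed.

End OneGroup.

Lemma prod_norm_character n m (G : set 'M[C]_n) (g : 'I_m -> 'M[R]_n) T chi :
  (forall k, maximal_real_torus_at G (g k) (T k)) ->
  (forall k, characters (T k) (chi k)) ->
  \prod_k norm_character (chi k) (mx_complex (g k)) =
  toC (expR (\sum_k lnmod (chi k (mx_complex (g k))) *+ 2)).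
Proof.
move=> hT hc; rewrite expR_sum rmorph_prod; apply: eq_bigr => k _.
rewrite norm_characterE mulr2n expRD /lnmod lnK -?expr2 // posrE modulus_gt0 //.
have [_ _ _ Tg _] := maximal_real_torus_facts (hT k).
by have [_ c0 _ _] := hc k; apply: c0.
Qed.

Lemma norm_character_character n (G : set 'M[C]_n) g T chi :
  maximal_real_torus_at G g T -> characters T chi ->
  characters T (norm_character chi).
Proof.
move=> /maximal_real_torus_facts[hT _ _ _ TJ] hc.
by apply: characterM => //; apply: character_conj.
Qed.

(** Doubling and exponentiating turns the relation into an equality of products of squared moduli,
    that is, of values of characters on both sides. Absence of weak containment makes the common
    value 1, and multiplicative independence makes each factor 1. *)
Lemma log_values_direct n n' (G : set 'M[C]_n) (G' : set 'M[C]_n')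
    (Gamma' : set 'M[R]_n') m (g : 'I_m -> 'M[R]_n) (T : 'I_m -> set 'M[C]_n) :
  (forall k, maximal_real_torus_at G (g k) (T k)) ->
  (forall chi : 'I_m -> 'M[C]_n -> C, (forall k, characters (T k) (chi k)) ->
     \prod_k chi k (mx_complex (g k)) = 1 ->
     forall k, chi k (mx_complex (g k)) = 1) ->
  ~ weakly_contained G G' g Gamma' ->
  forall (v : 'I_m -> R) w, (forall k, log_values (T k) (g k) (v k)) ->
    log_sums G' Gamma' w -> \sum_k v k = w -> forall k, v k = 0.
Proof.
move=> hT indep nweak v w hv [m' [g' [T' [chi' [h' Dw]]]]] vw.
have /choice[chi hchi] : forall k, exists chi, characters (T k) chi /\
    v k = lnmod (chi (mx_complex (g k))).
  by move=> k; have [chi hc vE] := hv k; exists chi.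
have hc k : characters (T k) (chi k) by case: (hchi k).
have hc' k : characters (T' k) (chi' k) by case: (h' k).
have hT' k : maximal_real_torus_at G' (g' k) (T' k) by case: (h' k).
have hN k : characters (T k) (norm_character (chi k)).
  exact: norm_character_character (hc k).
have prod1 := prod_norm_character hT hc; have prod2 := prod_norm_character hT' hc'.
have prodE : \prod_k norm_character (chi k) (mx_complex (g k)) =
    \prod_k norm_character (chi' k) (mx_complex (g' k)).
  rewrite prod1 prod2 !sumrMnl -Dw -vw; congr (toC (expR (_ *+ 2))).
  by apply: eq_bigr => k _; rewrite (hchi k).2.
have z1 : \prod_k norm_character (chi k) (mx_complex (g k)) = 1.
  apply: contrapT => z1; apply: nweak.
  exists m', g', (\prod_k norm_character (chi k) (mx_complex (g k))); split=> //.
  - by move=> k; have [] := h' k.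
  - by exists T, (fun k => norm_character (chi k)).
  - exists T', (fun k => norm_character (chi' k)); split=> // k.
    exact: norm_character_character (hc' k).
move=> k; have := indep _ hN z1 k; rewrite norm_characterE => /complexI mod1.
have [_ c0 _ _] := hc k; have [_ _ _ Tg _] := maximal_real_torus_facts (hT k).
have m0 := modulus_gt0 (c0 _ Tg).
rewrite (hchi k).2 /lnmod; suff -> : modulus (chi k (mx_complex (g k))) = 1 by rewrite ln1.
by apply/eqP; rewrite -(pexpr_eq1 (n := 2)) ?ltW // mod1.
Qed.

Lemma infinite_trdeg_length (schanuel : schanuel_conjecture R)
    (K_trdeg : finite_trdeg (@rationals R) K) n n'
    (G : set 'M[C]_n) (G' : set 'M[C]_n')
    (Gamma : set 'M[R]_n) (Gamma' : set 'M[R]_n') (E : set R) :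
  semisimple_group (in_complex K) G ->
  admissible_subgroup K G Gamma -> admissible_subgroup K G' Gamma' ->
  length_field G Gamma `<=` E ->
  condition_C G Gamma G' Gamma' -> infinite_trdeg (length_field G' Gamma') E.
Proof.
move=> hG adm adm' FE hC m; have [d Kd] := K_trdeg.
(* Schanuel's bound loses at most [d] of the lengths; the successor keeps the number of elements
   positive, as [condition_C] asks. *)
have [g [hg [T [hT indep]] nweak]] := hC (m + d).+1 isT.
have factT k := maximal_real_torus_facts (hT k).
pose us k := [seq lnmod (alpha (mx_complex (g k))) |
  alpha <- fset_set (Defs.roots G (T k))].
have [] := @length_independence R schanuel K d Kd (length_field G' Gamma')
  (log_sums G' Gamma') m (m + d).+1 (fun k => log_values (T k) (g k))
  (fun k => lambda_wrt G (T k) (g k)) us.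
- exact: is_subfield_generated.
- exact: length_field_algebraic.
- exact: subgroup_log_sums.
- by move=> k; have [? _ _ ? _] := factT k; apply: subgroup_log_values.
- exact: log_sums_algebraic.
- move=> k u; have [? _ _ ? ?] := factT k; have [Gg sg _] := hg k.
  by apply: log_values_algebraic => //; apply: (admissible_entries adm Gg).
- exact: log_values_direct hT indep nweak.
- by move=> k u /mapP[alpha ra ->]; apply: (root_log_value (g k) ra).
- by move=> k /=; rewrite lambda_wrt_sqr /us big_map.
- move=> k; have [Gg sg ig] := hg k.
  have [alpha ra l0] := root_lnmod_neq0 hG adm Gg sg ig (hT k).
  rewrite /= -sqrf_eq0 lambda_wrt_sqr psumr_eq0 => [|? _]; last exact: sqr_ge0.
  apply/allPn; exists alpha; rewrite /= ?sqrf_eq0 //.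
  by rewrite in_fset_set ?inE //; apply: finite_roots.
- exact: leqnSn.
move=> x [hx indx]; exists x; split=> // i; have [k ->] := hx i.
have [Gg sg ig] := hg k; apply: FE; apply: sub_generated_field; exists (g k), (T k); split=> //.
by move=> g1; apply: (ig 1%N) => //; rewrite expr1.
Qed.

End LengthFields.

Theorem corollary7p3 (R : realType) (schanuel : schanuel_conjecture R)
    (K : set R) (K_field : is_subfield K)
    (K_trdeg : finite_trdeg (@rationals R) K)
    (n1 n2 : nat) (G1 : set 'M[R[i]]_n1) (G2 : set 'M[R[i]]_n2)
    (G1_semisimple : semisimple_group (in_complex K) G1)
    (G2_semisimple : semisimple_group (in_complex K) G2)
    (Gamma1 : set 'M[R]_n1) (Gamma2 : set 'M[R]_n2)
    (Gamma1_adm : admissible_subgroup K G1 Gamma1)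
    (Gamma2_adm : admissible_subgroup K G2 Gamma2) :
  let F1 := length_field G1 Gamma1 in
  let F2 := length_field G2 Gamma2 in
  let F12 := generated_field (F1 `|` F2) in
  (condition_C G1 Gamma1 G2 Gamma2 -> infinite_trdeg F2 F12) /\
  (condition_C G2 Gamma2 G1 Gamma1 -> infinite_trdeg F1 F12).
Proof.
move=> F1 F2 F12; split.
  apply: (infinite_trdeg_length schanuel K_trdeg G1_semisimple Gamma1_adm Gamma2_adm) => x Fx.
  by apply: sub_generated_field; left.
apply: (infinite_trdeg_length schanuel K_trdeg G2_semisimple Gamma2_adm Gamma1_adm) => x Fx.
by apply: sub_generated_field; right.
Qed.
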